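(* Let $m$ be either $2n$ or $2n+1$. Then the differential algebra $\Omega_{\mathrm{alg}}(GL_\theta(m,\mathbb{R}))$ is a graded-involutive differential Hopf algebra, and $\Omega_{\mathrm{alg}}(\mathbb{R}^m_\theta)$ is canonically a graded-involutive differential comodule over $\Omega_{\mathrm{alg}}(GL_\theta(m,\mathbb{R}))$.
   Context: Setting. $n\ge2$, $\theta\in M_n(\mathbb{R})$ antisymmetric, $\lambda^{\mu\nu}=e^{i\theta_{\mu\nu}}$. A graded-involutive differential algebra is a graded complex algebra with an antilinear involution $\omega\mapsto\bar\omega$, $\overline{\omega\omega'}=(-1)^{pp'}\bar\omega'\bar\omega$ for degrees $p,p'$, and a differential $d$ (degree-one antiderivation, $d^2=0$) with $d\bar\omega=\overline{d\omega}$. $\otimes_{\mathrm{gr}}$ is the graded tensor product: $(x'\otimes x'')(y'\otimes y'')=(-1)^{|x''||y'|}x'y'\otimes x''y''$, with differential $d\otimes I+(-I)^{\mathrm{gr}}\otimes d$ (where $(-I)^{\mathrm{gr}}=(-1)^p$ in degree $p$) and involution $\overline{\omega'\otimes\omega''}=\bar\omega'\otimes\bar\omega''$. Index notation. Let $I_{2n}=\{1,\dots,n,\bar1,\dots,\bar n\}$ and $I_{2n+1}=I_{2n}\cup\{0\}$, with involution $\mu\leftrightarrow\bar\mu$, $\bar0=0$. Put $\Lambda^{\mu\nu}=\Lambda^{\bar\mu\bar\nu}=\lambda^{\mu\nu}$, $\Lambda^{\bar\mu\nu}=\Lambda^{\mu\bar\nu}=\lambda^{\nu\mu}$, $\Lambda^{0i}=\Lambda^{i0}=1$.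 Write $\xi^\mu=z^\mu$, $\xi^{\bar\mu}=\bar z^\mu$, $\xi^0=x$. $\Omega_{\mathrm{alg}}(\mathbb{R}^m_\theta)$ is the graded unital algebra generated by $\xi^i$ (degree 0) and $d\xi^i$ (degree 1), $i\in I_m$, with relations $\xi^i\xi^j=\Lambda^{ij}\xi^j\xi^i$, $\xi^id\xi^j=\Lambda^{ij}d\xi^j\,\xi^i$, $d\xi^id\xi^j=-\Lambda^{ij}d\xi^jd\xi^i$, differential $\xi^i\mapsto d\xi^i$, involution $\overline{\xi^i}=\xi^{\bar i}$, $\overline{d\xi^i}=d\xi^{\bar i}$. Its degree-0 part is $C_{\mathrm{alg}}(\mathbb{R}^m_\theta)$. $M_\theta(m,\mathbb{R})$ is the unital $*$-algebra generated by $t^i_j$ ($i,j\in I_m$) with relations $t^i_jt^k_l=\Lambda^{ik}\Lambda^{lj}t^k_lt^i_j$ (no summation) and $(t^i_j)^*=t^{\bar i}_{\bar j}$; equivalently the relations are those expressing that $\sum_jt^i_j\otimes\xi^j$ and $\sum_jt^i_j\otimes d\xi^j$ in $M_\theta(m,\mathbb R)\otimes\Omega_{\mathrm{alg}}(\mathbb R^m_\theta)$ satisfy the same relations among themselves as the $\xi^i$, respectively the $d\xi^i$. It is a $*$-bialgebra with $\Delta t^i_j=\sum_kt^i_k\otimes t^k_j$, $\varepsilon(t^i_j)=\delta^i_j$, and it coacts on $\Omega_{\mathrm{alg}}(\mathbb{R}^m_\theta)$ by the algebra homomorphism $\xi^i\mapsto\sum_jt^i_j\otimes\xi^j$, $d\xi^i\mapsto\sum_jt^i_j\otimes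 d\xi^j$. The hermitian central element $\det_\theta\in M_\theta(m,\mathbb{R})$ is defined by the fact that this coaction sends $\Omega_0=\prod_{\mu=1}^nd\bar z^\mu dz^\mu$ (multiplied by $dx$ if $m=2n+1$) to $\det_\theta\otimes\Omega_0$. $C_{\mathrm{alg}}(GL_\theta(m,\mathbb{R}))$ is the $*$-Hopf algebra obtained by adding to $M_\theta(m,\mathbb{R})$ a hermitian central inverse $\det_\theta^{-1}$ of $\det_\theta$, with $\Delta\det_\theta^{-1}=\det_\theta^{-1}\otimes\det_\theta^{-1}$, $\varepsilon(\det_\theta^{-1})=1$. $\Omega_{\mathrm{alg}}(M_\theta(m,\mathbb R))$ is the graded-involutive differential algebra generated by the $t^i_j$ (degree 0) and $dt^i_j$ (degree 1), $i,j\in I_m$, with the relations $t^i_jt^k_l=\Lambda^{ik}\Lambda^{lj}t^k_lt^i_j$ (no summation) and $\overline{t^i_j}=(t^i_j)^*=t^{\bar i}_{\bar j}$ together with $t^i_jdt^k_l=\Lambda^{ik}\Lambda^{lj}dt^k_l\,t^i_j$, $dt^i_jdt^k_l=-\Lambda^{ik}\Lambda^{lj}dt^k_ldt^i_j$, with $\overline{dt^i_j}=dt^{\bar i}_{\bar j}$. $\Omega_{\mathrm{alg}}(GL_\theta(m,\mathbb{R}))$ is obtained from it by adding $\det_\theta^{-1}$ in degree 0, inverse to $\det_\theta$, hermitian, commuting with all elements, with $d(\det_\theta^{-1})=-(\det_\theta^{-1})^2d(\det_\theta)$. A graded-involutive differential Hopf algebra is a graded-involutive differential algebra $\Omega$ with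 a coassociative coproduct $\Delta:\Omega\to\Omega\otimes_{\mathrm{gr}}\Omega$ which is a homomorphism of graded-involutive differential algebras, a counit $\varepsilon:\Omega\to\mathbb{C}$ which is a real algebra homomorphism with $\varepsilon\circ d=0$, and an antipode $S$ (then $S\circ d=d\circ S$). Here these structures extend those of $C_{\mathrm{alg}}(GL_\theta(m,\mathbb{R}))$. A graded-involutive differential comodule over $\Omega$ is a graded-involutive differential algebra $\Omega'$ with a homomorphism of graded-involutive differential algebras $\delta:\Omega'\to\Omega\otimes_{\mathrm{gr}}\Omega'$ satisfying $(\Delta\otimes I)\circ\delta=(I\otimes\delta)\circ\delta$, $(\varepsilon\otimes I)\circ\delta=I$; here $\delta$ is the one with $\delta\xi^i=\sum_jt^i_j\otimes\xi^j$. *)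

(* Defs.v *)
From HB Require Import structures.
From mathcomp Require Import all_boot all_algebra generic_quotient.
From mathcomp Require Import all_classical all_reals.
From mathcomp Require Import trigo.
From mathcomp.real_closed Require Import complex.

Set Implicit Arguments.
Unset Strict Implicit.
Unset Printing Implicit Defensive.

Import GRing.Theory.
Local Open Scope classical_set_scope.
Local Open Scope ring_scope.
Local Open Scope quotient_scope.

(* [algType] requires [1 != 0], which cannot be assumed of an algebra given by
   generators and relations. *)
Record ualgebra (K : comNzRingType) := UAlgebra {
  ua_mod : lmodType K;
  ua_one : ua_mod;
  ua_mul : ua_mod -> ua_mod -> ua_mod;
  ua_mulA : associative ua_mul;
  ua_mul1 : left_id ua_one ua_mul;
  ua_mulr1 : right_id ua_one ua_mul;
  ua_mulDl : left_distributive ua_mul +%R;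
  ua_mulDr : right_distributive ua_mul +%R;
  ua_scaleAl : forall k x y, k *: ua_mul x y = ua_mul (k *: x) y;
  ua_scaleAr : forall k x y, k *: ua_mul x y = ua_mul x (k *: y)
}.
Definition ua_sort (K : comNzRingType) (A : ualgebra K) : Type := ua_mod A.
Coercion ua_sort : ualgebra >-> Sortclass.

HB.instance Definition _ (K : comNzRingType) (A : ualgebra K) :=
  GRing.Lmodule.copy (ua_sort A) (ua_mod A).
HB.instance Definition _ (K : comNzRingType) (A : ualgebra K) :=
  GRing.Zmodule_isPzRing.Build (ua_sort A)
    (@ua_mulA K A) (@ua_mul1 K A) (@ua_mulr1 K A) (@ua_mulDl K A) (@ua_mulDr K A).

Section UAlgebraTheory.
Variables (K : comNzRingType) (A : ualgebra K).
Lemma uscalerAl (k : K) (x y : A) : k *: (x * y) = (k *: x) * y.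
Proof. exact: ua_scaleAl. Qed.
Lemma uscalerAr (k : K) (x y : A) : k *: (x * y) = x * (k *: y).
Proof. exact: ua_scaleAr. Qed.
End UAlgebraTheory.

Inductive term (K X : Type) : Type :=
| Gen of X
| Scal of K
| Add of term K X & term K X
| Mul of term K X & term K X.
Arguments Gen {K X} _.
Arguments Scal {K X} _.

Fixpoint rename (K X Y : Type) (f : X -> Y) (a : term K X) : term K Y :=
  match a with
  | Gen x => Gen (f x)
  | Scal k => Scal k
  | Add a b => Add (rename f a) (rename f b)
  | Mul a b => Mul (rename f a) (rename f b)
  end.

HB.instance Definition _ (K X : Type) := gen_eqMixin (term K X).
HB.instance Definition _ (K X : Type) := gen_choiceMixin (term K X).

Section Presented.
Variables (K : comNzRingType) (X : Type) (rel : term K X -> term K X -> Prop).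
Implicit Types a b c : term K X.

(* The least congruence making [term K X] a unital associative [K]-algebra and
   containing [rel]. *)
Inductive pres_cong : term K X -> term K X -> Prop :=
| pc_rel a b : rel a b -> pres_cong a b
| pc_refl a : pres_cong a a
| pc_sym a b : pres_cong a b -> pres_cong b a
| pc_trans a b c : pres_cong a b -> pres_cong b c -> pres_cong a c
| pc_add a a' b b' :
    pres_cong a a' -> pres_cong b b' -> pres_cong (Add a b) (Add a' b')
| pc_mul a a' b b' :
    pres_cong a a' -> pres_cong b b' -> pres_cong (Mul a b) (Mul a' b')
| pc_addA a b c : pres_cong (Add a (Add b c)) (Add (Add a b) c)
| pc_addC a b : pres_cong (Add a b) (Add b a)
| pc_add0 a : pres_cong (Add (Scal 0) a) a
| pc_mulA a b c : pres_cong (Mul a (Mul b c)) (Mul (Mul a b) c)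
| pc_mul0 a : pres_cong (Mul (Scal 0) a) (Scal 0)
| pc_mul1 a : pres_cong (Mul (Scal 1) a) a
| pc_mulDl a b c : pres_cong (Mul (Add a b) c) (Add (Mul a c) (Mul b c))
| pc_mulDr a b c : pres_cong (Mul a (Add b c)) (Add (Mul a b) (Mul a c))
| pc_scalD k l : pres_cong (Scal (k + l)) (Add (Scal k) (Scal l))
| pc_scalM k l : pres_cong (Scal (k * l)) (Mul (Scal k) (Scal l))
| pc_scalC k a : pres_cong (Mul (Scal k) a) (Mul a (Scal k)).


Lemma pres_cong_equiv : equiv_class_of (fun a b => `[< pres_cong a b >]).
Proof.
split=> [a|a b|b a c].
- by apply/asboolP; apply: pc_refl.
- by apply/asboolP/asboolP; apply: pc_sym.
- by move=> /asboolP ab /asboolP bc; apply/asboolP; apply: pc_trans ab bc.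
Qed.
Canonical pres_equiv := EquivRelPack pres_cong_equiv.

Definition pres_sort : Type := {eq_quot pres_equiv}.
HB.instance Definition _ := Choice.on pres_sort.
HB.instance Definition _ := EqQuotient.on pres_sort.

Definition pcls (a : term K X) : pres_sort := \pi_pres_sort a.

Lemma pclsP a b : pcls a = pcls b <-> pres_cong a b.
Proof.
by split=> [/eqP|ab]; [|apply/eqP]; rewrite piE; [move/asboolP|apply/asboolP].
Qed.

Lemma pcls_repr (x : pres_sort) : pcls (repr x) = x.
Proof. exact: reprK. Qed.

Lemma repr_pcls a : pres_cong (repr (pcls a)) a.
Proof. by apply/pclsP; rewrite pcls_repr. Qed.

Definition padd (x y : pres_sort) := pcls (Add (repr x) (repr y)).
Definition pmul (x y : pres_sort) := pcls (Mul (repr x) (repr y)).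
Definition pscale (k : K) (x : pres_sort) := pcls (Mul (Scal k) (repr x)).
Definition popp (x : pres_sort) := pscale (-1) x.

Lemma paddE a b : padd (pcls a) (pcls b) = pcls (Add a b).
Proof. by apply/pclsP; apply: pc_add; apply: repr_pcls. Qed.
Lemma pmulE a b : pmul (pcls a) (pcls b) = pcls (Mul a b).
Proof. by apply/pclsP; apply: pc_mul; apply: repr_pcls. Qed.
Lemma pscaleE k a : pscale k (pcls a) = pcls (Mul (Scal k) a).
Proof. by apply/pclsP; apply: pc_mul; [apply: pc_refl|apply: repr_pcls]. Qed.

Lemma presW (P : pres_sort -> Prop) : (forall a, P (pcls a)) -> forall x, P x.
Proof. by move=> Pcls x; rewrite -(pcls_repr x). Qed.

Lemma paddA : associative padd.
Proof.
elim/presW=> a; elim/presW=> b; elim/presW=> c.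
by rewrite !paddE; apply/pclsP/pc_addA.
Qed.
Lemma paddC : commutative padd.
Proof.
by elim/presW=> a; elim/presW=> b; rewrite !paddE; apply/pclsP/pc_addC.
Qed.
Lemma padd0 : left_id (pcls (Scal 0)) padd.
Proof. by elim/presW=> a; rewrite !paddE; apply/pclsP/pc_add0. Qed.
Lemma pscaleDl x k l : pscale (k + l) x = padd (pscale k x) (pscale l x).
Proof.
elim/presW: x => a; rewrite !pscaleE paddE; apply/pclsP.
apply: pc_trans (pc_mulDl _ _ _).
by apply: pc_mul; [apply: pc_scalD|apply: pc_refl].
Qed.
Lemma pscale1 : left_id 1 pscale.
Proof. by elim/presW=> a; rewrite pscaleE; apply/pclsP/pc_mul1. Qed.
Lemma paddN : left_inverse (pcls (Scal 0)) popp padd.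
Proof.
move=> x; rewrite -[X in padd _ X]pscale1 -pscaleDl addNr.
by elim/presW: x => a; rewrite pscaleE; apply/pclsP/pc_mul0.
Qed.
HB.instance Definition _ :=
  GRing.isZmodule.Build pres_sort paddA paddC padd0 paddN.

Lemma pmulA : associative pmul.
Proof.
elim/presW=> a; elim/presW=> b; elim/presW=> c.
by rewrite !pmulE; apply/pclsP/pc_mulA.
Qed.
Lemma pmul1 : left_id (pcls (Scal 1)) pmul.
Proof. by elim/presW=> a; rewrite !pmulE; apply/pclsP/pc_mul1. Qed.
Lemma pmulr1 : right_id (pcls (Scal 1)) pmul.
Proof.
elim/presW=> a; rewrite !pmulE; apply/pclsP.
by apply: pc_trans (pc_mul1 a); apply/pc_sym/pc_scalC.
Qed.
Lemma pmulDl : left_distributive pmul +%R.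
Proof.
elim/presW=> a; elim/presW=> b; elim/presW=> c.
by rewrite /GRing.add /= !(pmulE, paddE); apply/pclsP/pc_mulDl.
Qed.
Lemma pmulDr : right_distributive pmul +%R.
Proof.
elim/presW=> a; elim/presW=> b; elim/presW=> c.
by rewrite /GRing.add /= !(pmulE, paddE); apply/pclsP/pc_mulDr.
Qed.

Lemma pscaleM k x : pscale k x = pmul (pcls (Scal k)) x.
Proof. by elim/presW: x => a; rewrite pscaleE pmulE. Qed.
Lemma pscalM k l : pcls (Scal (k * l)) = pmul (pcls (Scal k)) (pcls (Scal l)).
Proof. by rewrite pmulE; apply/pclsP/pc_scalM. Qed.
Lemma pscalC k x : pmul (pcls (Scal k)) x = pmul x (pcls (Scal k)).
Proof. by elim/presW: x => a; rewrite !pmulE; apply/pclsP/pc_scalC. Qed.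

Lemma pscaleA k l x : pscale k (pscale l x) = pscale (k * l) x.
Proof. by rewrite !pscaleM pmulA pscalM. Qed.
Lemma pscaleDr : right_distributive pscale +%R.
Proof. by move=> k x y; rewrite !pscaleM pmulDr. Qed.
HB.instance Definition _ :=
  GRing.Zmodule_isLmodule.Build K pres_sort pscaleA pscale1 pscaleDr pscaleDl.

Lemma pscaleAl (k : K) (x y : pres_sort) : k *: pmul x y = pmul (k *: x) y.
Proof. by rewrite /GRing.scale /= !pscaleM pmulA. Qed.
Lemma pscaleAr (k : K) (x y : pres_sort) : k *: pmul x y = pmul x (k *: y).
Proof. by rewrite /GRing.scale /= !pscaleM !pmulA pscalC. Qed.

(* The algebra generated by [X] subject to the relations [a = b], [rel a b]. *)
Definition presented : ualgebra K :=
  UAlgebra pmulA pmul1 pmulr1 pmulDl pmulDr pscaleAl pscaleAr.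

Definition peval (a : term K X) : presented := pcls a.
Definition pgen (x : X) : presented := peval (Gen x).

End Presented.
Arguments peval {K X} rel a.
Arguments pgen {K X} rel x.

Section Tensor.
Variables (K : comNzRingType) (A B : lmodType K).
Implicit Types s t : seq (A * B).

(* A formal sum of pure tensors is the list of its terms. *)
Inductive tens_cong : seq (A * B) -> seq (A * B) -> Prop :=
| tc_refl s : tens_cong s s
| tc_sym s t : tens_cong s t -> tens_cong t s
| tc_trans s t u : tens_cong s t -> tens_cong t u -> tens_cong s u
| tc_cat s s' t t' :
    tens_cong s s' -> tens_cong t t' -> tens_cong (s ++ t) (s' ++ t')
| tc_catC s t : tens_cong (s ++ t) (t ++ s)
| tc_0l b : tens_cong [:: (0, b)] [::]
| tc_Dl a a' b : tens_cong [:: (a + a', b)] [:: (a, b); (a', b)]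
| tc_Dr a b b' : tens_cong [:: (a, b + b')] [:: (a, b); (a, b')]
| tc_Z k a b : tens_cong [:: (k *: a, b)] [:: (a, k *: b)].

Lemma tens_cong_equiv : equiv_class_of (fun s t => `[< tens_cong s t >]).
Proof.
split=> [s|s t|t s u].
- by apply/asboolP; apply: tc_refl.
- by apply/asboolP/asboolP; apply: tc_sym.
- by move=> /asboolP st /asboolP tu; apply/asboolP; apply: tc_trans st tu.
Qed.
Canonical tens_equiv := EquivRelPack tens_cong_equiv.

Definition tensor : Type := {eq_quot tens_equiv}.
HB.instance Definition _ := Choice.on tensor.
HB.instance Definition _ := EqQuotient.on tensor.

Definition tcls s : tensor := \pi_tensor s.
Definition tens (a : A) (b : B) : tensor := tcls [:: (a, b)].

Lemma tclsP s t : tcls s = tcls t <-> tens_cong s t.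
Proof.
by split=> [/eqP|st]; [|apply/eqP]; rewrite piE; [move/asboolP|apply/asboolP].
Qed.
Lemma tcls_repr (x : tensor) : tcls (repr x) = x.
Proof. exact: reprK. Qed.
Lemma repr_tcls s : tens_cong (repr (tcls s)) s.
Proof. by apply/tclsP; rewrite tcls_repr. Qed.
Lemma tensW (P : tensor -> Prop) : (forall s, P (tcls s)) -> forall x, P x.
Proof. by move=> Pcls x; rewrite -(tcls_repr x). Qed.

Definition zscale (k : K) s := [seq (k *: p.1, p.2) | p <- s].
Definition tadd (x y : tensor) := tcls (repr x ++ repr y).
Definition tscale (k : K) (x : tensor) := tcls (zscale k (repr x)).
Definition topp (x : tensor) := tscale (-1) x.

Lemma tc_zscale k s t : tens_cong s t -> tens_cong (zscale k s) (zscale k t).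
Proof.
elim=> {s t} [s|s t _|s t u _ + _|s s' t t' _ + _|s t|b|a a' b|a b b'|l a b] /=.
- exact: tc_refl.
- exact: tc_sym.
- exact: tc_trans.
- by rewrite /zscale !map_cat; apply: tc_cat.
- by rewrite /zscale !map_cat; apply: tc_catC.
- by rewrite scaler0; apply: tc_0l.
- by rewrite scalerDr; apply: tc_Dl.
- exact: tc_Dr.
- by rewrite scalerA mulrC -scalerA; apply: tc_Z.
Qed.

Lemma taddE s t : tadd (tcls s) (tcls t) = tcls (s ++ t).
Proof. by apply/tclsP/tc_cat; apply: repr_tcls. Qed.
Lemma tscaleE k s : tscale k (tcls s) = tcls (zscale k s).
Proof. by apply/tclsP/tc_zscale/repr_tcls. Qed.

Lemma taddA : associative tadd.
Proof.
by elim/tensW=> s; elim/tensW=> t; elim/tensW=> u; rewrite !taddE catA.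
Qed.
Lemma taddC : commutative tadd.
Proof.
by elim/tensW=> s; elim/tensW=> t; rewrite !taddE; apply/tclsP/tc_catC.
Qed.
Lemma tadd0 : left_id (tcls [::]) tadd.
Proof. by elim/tensW=> s; rewrite !taddE. Qed.
Lemma tscaleDl x k l : tscale (k + l) x = tadd (tscale k x) (tscale l x).
Proof.
elim/tensW: x => s; rewrite !tscaleE taddE; apply/tclsP.
elim: s => [|[a b] s IHs] /=; first exact: tc_refl.
rewrite scalerDl; apply: tc_trans (tc_cat (tc_Dl _ _ _) IHs) _.
apply: (@tc_cat [:: _] _ (_ :: _) _ (tc_refl _)).
rewrite -[X in tens_cong X]/(([:: (l *: a, b)] ++ zscale k s) ++ zscale l s).
rewrite -[X in tens_cong _ X]/(zscale k s ++ [:: (l *: a, b)] ++ zscale l s).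
by rewrite catA; apply: tc_cat (tc_refl _); apply: tc_catC.
Qed.
Lemma tscale1 : left_id 1 tscale.
Proof.
elim/tensW=> s; rewrite tscaleE /zscale; congr tcls.
by rewrite -[RHS]map_id; apply: eq_map => -[a b] /=; rewrite scale1r.
Qed.
Lemma taddN : left_inverse (tcls [::]) topp tadd.
Proof.
move=> x; rewrite -[X in tadd _ X]tscale1 -tscaleDl addNr.
elim/tensW: x => s; rewrite tscaleE; apply/tclsP.
elim: s => [|[a b] s IHs] /=; first exact: tc_refl.
by rewrite scale0r; apply: tc_cat (tc_0l b) IHs.
Qed.
HB.instance Definition _ :=
  GRing.isZmodule.Build tensor taddA taddC tadd0 taddN.

Lemma tscaleA k l x : tscale k (tscale l x) = tscale (k * l) x.
Proof.
elim/tensW: x => s; rewrite !tscaleE /zscale -map_comp; congr tcls.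
by apply: eq_map => -[a b] /=; rewrite scalerA.
Qed.
Lemma tscaleDr : right_distributive tscale +%R.
Proof.
move=> k; elim/tensW=> s; elim/tensW=> t.
by rewrite /GRing.add /= taddE !tscaleE taddE /zscale map_cat.
Qed.
HB.instance Definition _ :=
  GRing.Zmodule_isLmodule.Build K tensor tscaleA tscale1 tscaleDr tscaleDl.

Lemma tclsD s t : tcls (s ++ t) = tcls s + tcls t.
Proof. by rewrite /GRing.add /= taddE. Qed.
Lemma tcls0 : tcls [::] = 0. Proof. by []. Qed.
Lemma tclsE s : tcls s = \sum_(p <- s) tens p.1 p.2.
Proof.
elim: s => [|[a b] s IHs]; first by rewrite big_nil.
by rewrite big_cons -IHs -tclsD.
Qed.

Lemma tens_Dl b : {morph tens^~ b : a a' / a + a'}.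
Proof. by move=> a a'; rewrite -[RHS]tclsD; apply/tclsP/tc_Dl. Qed.
Lemma tens_Dr a : {morph tens a : b b' / b + b'}.
Proof. by move=> b b'; rewrite -[RHS]tclsD; apply/tclsP/tc_Dr. Qed.
Lemma tens_Zl k a b : tens (k *: a) b = k *: tens a b.
Proof. by rewrite /GRing.scale /= tscaleE. Qed.
Lemma tens_Zr k a b : tens a (k *: b) = k *: tens a b.
Proof. by rewrite -tens_Zl; apply/esym/tclsP/tc_Z. Qed.

Lemma tens_0l b : tens 0 b = 0.
Proof. by rewrite -(scale0r 0) tens_Zl scale0r. Qed.
Lemma tens_0r a : tens a 0 = 0.
Proof. by rewrite -(scale0r 0) tens_Zr scale0r. Qed.

Lemma tens_linearl b : linear (tens^~ b).
Proof. by move=> k a a'; rewrite tens_Dl tens_Zl. Qed.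
Lemma tens_linearr a : linear (tens a).
Proof. by move=> k b b'; rewrite tens_Dr tens_Zr. Qed.
HB.instance Definition _ :=
  bilinear_isBilinear.Build K A B tensor _ _ tens (tens_linearl, tens_linearr).

Lemma tens_ind (P : tensor -> Prop) :
    P 0 -> (forall x y, P x -> P y -> P (x + y)) ->
    (forall a b, P (tens a b)) -> forall x, P x.
Proof.
move=> P0 PD Pt; elim/tensW=> s; rewrite tclsE.
by elim/big_ind: _ => // p _; apply: Pt.
Qed.

(* The additive map determined by [f] on pure tensors, for [f] additive in each
   variable and balanced; a junk value otherwise. *)
Definition tlift (V : zmodType) (f : A -> B -> V) (x : tensor) : V :=
  \sum_(p <- repr x) f p.1 p.2.

Definition balanced (V : zmodType) (f : A -> B -> V) : Prop :=
  [/\ forall b, {morph f^~ b : a a' / a + a'},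
      forall a, {morph f a : b b' / b + b'} &
      forall k a b, f (k *: a) b = f a (k *: b)].

Section Lift.
Variables (V : zmodType) (f : A -> B -> V).
Hypothesis bal_f : balanced f.

Lemma tlift_tcls s : tlift f (tcls s) = \sum_(p <- s) f p.1 p.2.
Proof.
case: bal_f => fDl fDr fZ; rewrite /tlift.
suff cong_eq s1 s2 : tens_cong s1 s2 ->
    \sum_(p <- s1) f p.1 p.2 = \sum_(p <- s2) f p.1 p.2.
  exact: cong_eq (repr_tcls s).
elim=> {s s1 s2} //= [s t u _ -> _ //|s s' t t' _ + _|s t|b|||].
- by rewrite !big_cat /= => -> ->.
- by rewrite !big_cat /= addrC.
- rewrite big_seq1 big_nil /=; apply: (addIr (f 0 b)).
  by rewrite -fDl !add0r.
- by move=> a a' b; rewrite !big_cons !big_nil !addr0 fDl.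
- by move=> a b b'; rewrite !big_cons !big_nil !addr0 fDr.
- by move=> k a b; rewrite !big_seq1 /= fZ.
Qed.

Lemma tliftE a b : tlift f (tens a b) = f a b.
Proof. by rewrite tlift_tcls big_seq1. Qed.
Lemma tliftD : {morph tlift f : x y / x + y}.
Proof.
elim/tensW=> s; elim/tensW=> t.
by rewrite -tclsD !tlift_tcls big_cat.
Qed.
Lemma tlift0 : tlift f 0 = 0.
Proof. by rewrite -tcls0 tlift_tcls big_nil. Qed.
End Lift.

Lemma tlift_linear (V : lmodType K) (f : A -> B -> V) :
  balanced f -> (forall k a b, f (k *: a) b = k *: f a b) -> linear (tlift f).
Proof.
move=> bf fZ k x y; rewrite tliftD //; congr (_ + _).
elim/tens_ind: x => [|x x' IHx IHx'|a b]; first by rewrite scaler0 tlift0 ?scaler0.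
  by rewrite scalerDr !tliftD // IHx IHx' scalerDr.
by rewrite -tens_Zl !tliftE.
Qed.

Lemma tens_ext (V : zmodType) (f g : tensor -> V) :
    {morph f : x y / x + y} -> {morph g : x y / x + y} ->
    (forall a b, f (tens a b) = g (tens a b)) -> f =1 g.
Proof.
have h0 (h : tensor -> V) : {morph h : x y / x + y} -> h 0 = 0.
  by move=> hD; apply: (addIr (h 0)); rewrite -hD !add0r.
move=> fD gD fg; elim/tens_ind => [|x y IHx IHy|//]; first by rewrite !h0.
by rewrite fD gD IHx IHy.
Qed.
End Tensor.
Arguments tens {K A B} a b.

Section TensorMaps.
Variable K : comNzRingType.

Definition tmap (A A' B B' : lmodType K) (f : A -> A') (g : B -> B') :
    tensor A B -> tensor A' B' :=
  tlift (fun a b => tens (f a) (g b)).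

Definition tassoc (A B C : lmodType K) :
    tensor (tensor A B) C -> tensor A (tensor B C) :=
  tlift (fun x c => tlift (fun a b => tens a (tens b c)) x).

(* The maps [phi (x) I] and [I (x) phi], with [K (x) B] and [A (x) K] identified
   with [B] and [A]. *)
Definition tforml (A B : lmodType K) (phi : A -> K) : tensor A B -> B :=
  tlift (fun a b => phi a *: b).
Definition tformr (A B : lmodType K) (phi : B -> K) : tensor A B -> A :=
  tlift (fun a b => phi b *: a).

Definition tmult (A : ualgebra K) : tensor A A -> A :=
  tlift (fun x y : A => x * y).

Section TmapLinear.
Variables (A A' B B' : lmodType K) (f : {linear A -> A'}) (g : {linear B -> B'}).
Lemma tmap_balanced : balanced (fun a b => tens (f a) (g b)).
Proof.
by split=> [b a a'|a b b'|k a b];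
  rewrite ?linearD ?linearZ ?tens_Dl ?tens_Dr ?tens_Zl ?tens_Zr.
Qed.
Lemma tmapE a b : tmap f g (tens a b) = tens (f a) (g b).
Proof. exact: tliftE tmap_balanced a b. Qed.
Lemma tmap_linear : linear (tmap f g).
Proof. by apply: tlift_linear tmap_balanced _ => k a b; rewrite linearZ tens_Zl. Qed.
HB.instance Definition _ :=
  GRing.isLinear.Build K (tensor A B) (tensor A' B') _ (tmap f g) tmap_linear.
End TmapLinear.
End TensorMaps.
Arguments tassoc {K A B C}.

(* A [nat]-grading of [A], given by the projections [gpr p] onto the
   homogeneous components. *)
Record graded (K : comNzRingType) (A : ualgebra K) := Graded {
  gpr : nat -> {linear A -> A};
  gpr_idem : forall p q x, gpr p (gpr q x) = if p == q then gpr q x else 0;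
  gpr_sum : forall x, exists N, x = \sum_(p < N) gpr p x;
  gpr_1 : gpr 0 1 = 1;
  gpr_M : forall p q x y, gpr p x = x -> gpr q y = y -> gpr (p + q) (x * y) = x * y
}.

Definition homog (K : comNzRingType) (A : ualgebra K) (G : graded A)
  (p : nat) (x : A) : Prop := gpr G p x = x.

Section GradedTheory.
Variables (K : comNzRingType) (A : ualgebra K) (G : graded A).
Implicit Types x y : A.

Definition gev x : A := \sum_(p \in [set p | ~~ odd p]) gpr G p x.
Definition god x : A := \sum_(p \in [set p | odd p]) gpr G p x.
(* Multiplication by [(-1)^p] in degree [p]. *)
Definition gsgn x : A := gev x - god x.

Lemma homog_gpr p x : homog G p (gpr G p x).
Proof. by rewrite /homog gpr_idem eqxx. Qed.
Lemma homogD p x y : homog G p x -> homog G p y -> homog G p (x + y).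
Proof. by rewrite /homog linearD => -> ->. Qed.
Lemma homogZ p k x : homog G p x -> homog G p (k *: x).
Proof. by rewrite /homog linearZ => ->. Qed.
Lemma homogM p q x y : homog G p x -> homog G q y -> homog G (p + q) (x * y).
Proof. exact: gpr_M. Qed.
Lemma homog1 : homog G 0 1.
Proof. exact: gpr_1. Qed.
Lemma gpr_homog p q x : homog G q x -> gpr G p x = if p == q then x else 0.
Proof. by move=> xq; rewrite -{1}xq gpr_idem xq. Qed.

Lemma homog_ind (P : A -> Prop) :
    P 0 -> (forall x y, P x -> P y -> P (x + y)) ->
    (forall p x, homog G p x -> P x) -> forall x, P x.
Proof.
move=> P0 PD Ph x; have [N ->] := gpr_sum G x.
by elim/big_ind: _ => // p _; apply: Ph (homog_gpr p x).
Qed.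

Lemma gpr_bound x : exists N, forall p, (N <= p)%N -> gpr G p x = 0.
Proof.
have [N xE] := gpr_sum G x; exists N => p leNp.
rewrite xE linear_sum /= big1 // => q _; rewrite gpr_idem.
by rewrite gtn_eqF // (leq_trans (ltn_ord q)).
Qed.

Lemma gparE (P : pred nat) N x : (forall p, (N <= p)%N -> gpr G p x = 0) ->
  \sum_(p \in [set p | P p]) gpr G p x = \sum_(0 <= p < N | P p) gpr G p x.
Proof.
move=> xN; rewrite (@bigfs _ _ _ _ _ P) ?iota_uniq // => p _.
by rewrite mem_index_iota /= -leqNgt => /xN.
Qed.

Lemma gpar_linear (P : pred nat) :
  linear (fun x => \sum_(p \in [set p | P p]) gpr G p x).
Proof.
move=> k x y; have [N xN] := gpr_bound x; have [M yM] := gpr_bound y.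
rewrite !(@gparE _ (maxn N M)) => [|p|p|p]; rewrite ?geq_max.
- by rewrite scaler_sumr -big_split /=; apply: eq_bigr => p _; rewrite linearP.
- by case/andP => _ /yM.
- by case/andP => /xN.
- by case/andP => pN pM; rewrite linearP xN // yM // scaler0 addr0.
Qed.
HB.instance Definition _ :=
  GRing.isLinear.Build K A A _ gev (gpar_linear (predC odd)).
HB.instance Definition _ := GRing.isLinear.Build K A A _ god (gpar_linear odd).

Lemma gpar_homog (P : pred nat) p x : homog G p x ->
  \sum_(q \in [set q | P q]) gpr G q x = if P p then x else 0.
Proof.
move=> xp; rewrite (@gparE _ p.+1) => [|q ltpq].
  rewrite big_mkcond /= big_nat_recr //= big_nat_cond big1 ?add0r ?xp //.
  by move=> q /andP[/andP[_ ltqp] _]; rewrite (gpr_homog _ xp) ltn_eqF ?if_same.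
by rewrite (gpr_homog _ xp) gtn_eqF.
Qed.

Lemma gev_homog p x : homog G p x -> gev x = if odd p then 0 else x.
Proof. by move=> xp; rewrite /gev (gpar_homog (predC odd) xp) /= if_neg. Qed.
Lemma god_homog p x : homog G p x -> god x = if odd p then x else 0.
Proof. by move=> xp; rewrite /god (gpar_homog odd xp). Qed.

Lemma gsgn_linear : linear gsgn.
Proof.
move=> k x y; rewrite /gsgn (linearP gev) (linearP god) /=.
by rewrite scalerBr opprD addrACA.
Qed.
HB.instance Definition _ := GRing.isLinear.Build K A A _ gsgn gsgn_linear.

Lemma gsgnD x y : gsgn (x + y) = gsgn x + gsgn y.
Proof. exact: (linearD gsgn). Qed.
Lemma gsgn0 : gsgn 0 = 0.
Proof. exact: (linear0 gsgn). Qed.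
Lemma gsgnZ k x : gsgn (k *: x) = k *: gsgn x.
Proof. by rewrite -[k *: x]addr0 gsgn_linear gsgn0 addr0. Qed.

Lemma gsgn_homog p x : homog G p x -> gsgn x = (-1) ^+ p *: x.
Proof.
move=> xp; rewrite /gsgn (gev_homog xp) (god_homog xp) -signr_odd.
by case: odd; rewrite ?expr1 ?expr0 ?sub0r ?subr0 ?scaleN1r ?scale1r.
Qed.

Lemma gsgnK : involutive gsgn.
Proof.
move=> x; elim/homog_ind: x => [|x y IHx IHy|p x xp]; rewrite ?gsgn0 //.
  by rewrite [gsgn (x + y)]gsgnD gsgnD IHx IHy.
by rewrite (gsgn_homog xp) gsgnZ (gsgn_homog xp) scalerA -exprD addnn
           -signr_odd odd_double scale1r.
Qed.

Lemma gsgnM x y : gsgn (x * y) = gsgn x * gsgn y.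
Proof.
elim/homog_ind: x => [|x x' IHx IHx'|p x xp]; first by rewrite !(mul0r, gsgn0).
  by rewrite mulrDl !gsgnD mulrDl IHx IHx'.
elim/homog_ind: y => [|y y' IHy IHy'|q y yq]; first by rewrite !(mulr0, gsgn0).
  by rewrite mulrDr !gsgnD mulrDr IHy IHy'.
rewrite (gsgn_homog (homogM xp yq)) (gsgn_homog xp) (gsgn_homog yq).
by rewrite -uscalerAl -uscalerAr scalerA exprD.
Qed.
Lemma gsgn1 : gsgn 1 = 1.
Proof. by rewrite (gsgn_homog homog1) scale1r. Qed.
Lemma gev1 : gev 1 = 1. Proof. exact: gev_homog homog1. Qed.
Lemma god1 : god 1 = 0. Proof. exact: god_homog homog1. Qed.
Lemma gevDod x : gev x + god x = x.
Proof.
elim/homog_ind: x => [|x y IHx IHy|p x xp]; first by rewrite !linear0 addr0.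
  by rewrite (linearD gev) (linearD god) /= addrACA IHx IHy.
by rewrite (gev_homog xp) (god_homog xp); case: odd; rewrite ?add0r ?addr0.
Qed.

Lemma gparM x y : [/\ gev (x * gev y) = gev x * gev y,
  gev (x * god y) = god x * god y, god (x * gev y) = god x * gev y &
  god (x * god y) = gev x * god y].
Proof.
elim/homog_ind: x => [|x x' [IH1 IH2 IH3 IH4] [IH'1 IH'2 IH'3 IH'4]|p x xp].
- by split; rewrite ?linear0 !mul0r linear0.
- split; rewrite mulrDl !linearD /= mulrDl.
  + by rewrite IH1 IH'1.
  + by rewrite IH2 IH'2.
  + by rewrite IH3 IH'3.
  + by rewrite IH4 IH'4.
elim/homog_ind: y => [|y y' [IH1 IH2 IH3 IH4] [IH'1 IH'2 IH'3 IH'4]|q y yq].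
- by split; rewrite ?linear0 !mulr0 linear0.
- split; rewrite linearD /= !mulrDr linearD /=.
  + by rewrite IH1 IH'1.
  + by rewrite IH2 IH'2.
  + by rewrite IH3 IH'3.
  + by rewrite IH4 IH'4.
rewrite (gev_homog xp) (god_homog xp) (gev_homog yq) (god_homog yq).
have xyE := gev_homog (homogM xp yq); have xyO := god_homog (homogM xp yq).
by case oq: (odd q); rewrite oddD oq in xyE xyO;
   split; rewrite ?mulr0 ?linear0 // ?xyE ?xyO; case: (odd p); rewrite ?mul0r.
Qed.

End GradedTheory.

Section GradedTensor.
Variables (K : comNzRingType) (A B : ualgebra K) (GA : graded A) (GB : graded B).
Implicit Types (a : A) (b : B).

(* [gt_mul (a (x) b) (a' (x) b')] is [(-1)^(q p') a a' (x) b b'] for [b] of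
   degree [q] and [a'] of degree [p'], see [gtens_mulE]. *)
Definition gt_mul0 a b a' b' : tensor A B :=
  tens (a * gev GA a') (b * b') + tens (a * god GA a') (gsgn GB b * b').
Definition gt_mul (x y : tensor A B) : tensor A B :=
  tlift (fun a b => tlift (gt_mul0 a b) y) x.

Lemma gt_mul0_balanced a b : balanced (gt_mul0 a b).
Proof.
split=> [b' a' a''|a' b' b''|k a' b'] /=; rewrite /gt_mul0.
- by rewrite !linearD /= !mulrDr !tens_Dl addrACA.
- by rewrite !mulrDr !tens_Dr addrACA.
- by rewrite !linearZ /= -!uscalerAr !tens_Zl !tens_Zr.
Qed.

Lemma gt_mulrD x y y' : gt_mul x (y + y') = gt_mul x y + gt_mul x y'.
Proof.
rewrite /gt_mul /tlift -big_split /=; apply: eq_bigr => -[a b] _ /=.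
exact: (tliftD (gt_mul0_balanced a b)).
Qed.

Lemma gt_mul0Dl a a' b x y :
  gt_mul0 (a + a') b x y = gt_mul0 a b x y + gt_mul0 a' b x y.
Proof. by rewrite /gt_mul0 !mulrDl !tens_Dl addrACA. Qed.
Lemma gt_mul0Dr a b b' x y :
  gt_mul0 a (b + b') x y = gt_mul0 a b x y + gt_mul0 a b' x y.
Proof. by rewrite /gt_mul0 gsgnD !mulrDl !tens_Dr addrACA. Qed.
Lemma gt_mul0Zl k a b x y : gt_mul0 (k *: a) b x y = k *: gt_mul0 a b x y.
Proof. by rewrite /gt_mul0 -!uscalerAl !tens_Zl scalerDr. Qed.
Lemma gt_mul0Zr k a b x y : gt_mul0 a (k *: b) x y = k *: gt_mul0 a b x y.
Proof. by rewrite /gt_mul0 gsgnZ -!uscalerAl !tens_Zr scalerDr. Qed.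

Lemma gt_mul_balanced y : balanced (fun a b => tlift (gt_mul0 a b) y).
Proof.
split=> [b a a'|a b b'|k a b] /=; rewrite /tlift -?big_split /=;
  apply: eq_bigr => p _.
- exact: gt_mul0Dl.
- exact: gt_mul0Dr.
- by rewrite gt_mul0Zl gt_mul0Zr.
Qed.

Lemma gt_mulDr x x' y : gt_mul (x + x') y = gt_mul x y + gt_mul x' y.
Proof. exact: (tliftD (gt_mul_balanced y)). Qed.

Lemma gt_mul_tens a b a' b' : gt_mul (tens a b) (tens a' b') = gt_mul0 a b a' b'.
Proof.
by rewrite /gt_mul (tliftE (gt_mul_balanced _)) (tliftE (gt_mul0_balanced _ _)).
Qed.

Lemma gt_mul0l y : gt_mul 0 y = 0.
Proof. exact: (tlift0 (gt_mul_balanced y)). Qed.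
Lemma gt_mul0r x : gt_mul x 0 = 0.
Proof. by apply: (addIr (gt_mul x 0)); rewrite -gt_mulrD !add0r. Qed.

Lemma gt_mulZl k x y : k *: gt_mul x y = gt_mul (k *: x) y.
Proof.
elim/tens_ind: x => [|x x' IH IH'|a b]; first by rewrite gt_mul0l !scaler0 gt_mul0l.
  by rewrite scalerDr !gt_mulDr scalerDr IH IH'.
elim/tens_ind: y => [|y y' IH IH'|a' b']; first by rewrite !gt_mul0r scaler0.
  by rewrite !gt_mulrD scalerDr IH IH'.
by rewrite -tens_Zl !gt_mul_tens gt_mul0Zl.
Qed.
Lemma gt_mulZr k x y : k *: gt_mul x y = gt_mul x (k *: y).
Proof.
elim/tens_ind: x => [|x x' IH IH'|a b]; first by rewrite !gt_mul0l scaler0.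
  by rewrite !gt_mulDr scalerDr IH IH'.
elim/tens_ind: y => [|y y' IH IH'|a' b'].
- by rewrite gt_mul0r !scaler0 gt_mul0r.
- by rewrite scalerDr !gt_mulrD scalerDr IH IH'.
rewrite -tens_Zr !gt_mul_tens /gt_mul0 -!uscalerAr !tens_Zr.
by rewrite scalerDr.
Qed.

Lemma gt_mulA : associative gt_mul.
Proof.
move=> x y z.
elim/tens_ind: x => [|x x' IH IH'|a b]; first by rewrite !gt_mul0l.
  by rewrite !gt_mulDr IH IH'.
elim/tens_ind: y => [|y y' IH IH'|a' b']; first by rewrite !(gt_mul0l, gt_mul0r).
  by rewrite !(gt_mulDr, gt_mulrD) IH IH'.
elim/tens_ind: z => [|z z' IH IH'|a'' b'']; first by rewrite !gt_mul0r.
  by rewrite !gt_mulrD IH IH'.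
rewrite !gt_mul_tens /gt_mul0 gt_mulrD gt_mulDr !gt_mul_tens /gt_mul0.
have [e1 e2 e3 e4] := gparM GA a' a''.
rewrite e1 e2 e3 e4 !gsgnM gsgnK !mulrA.
by rewrite -!addrA; congr (_ + _); rewrite addrA addrC.
Qed.

Lemma gt_mul1 : left_id (tens (1 : A) (1 : B)) gt_mul.
Proof.
elim/tens_ind => [|x y IHx IHy|a b]; first exact: gt_mul0r.
  by rewrite gt_mulrD IHx IHy.
by rewrite gt_mul_tens /gt_mul0 gsgn1 !mul1r -tens_Dl gevDod.
Qed.
Lemma gt_mulr1 : right_id (tens (1 : A) (1 : B)) gt_mul.
Proof.
elim/tens_ind => [|x y IHx IHy|a b]; first exact: gt_mul0l.
  by rewrite gt_mulDr IHx IHy.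
rewrite gt_mul_tens /gt_mul0 gev1 god1 !mulr1 mulr0.
by rewrite tens_0l addr0.
Qed.
Lemma gt_mulDl' : left_distributive gt_mul +%R.
Proof. by move=> x y z; apply: gt_mulDr. Qed.
Lemma gt_mulDr' : right_distributive gt_mul +%R.
Proof. by move=> x y z; apply: gt_mulrD. Qed.

Definition gtens : ualgebra K :=
  UAlgebra gt_mulA gt_mul1 gt_mulr1 gt_mulDl' gt_mulDr' gt_mulZl gt_mulZr.

Definition gten (a : A) (b : B) : gtens := tens a b.

Lemma gten_ind (P : gtens -> Prop) :
    P 0 -> (forall x y, P x -> P y -> P (x + y)) ->
    (forall p q a b, homog GA p a -> homog GB q b -> P (gten a b)) ->
  forall x, P x.
Proof.
move=> P0 PD Ph; apply: tens_ind => // a b.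
elim/(homog_ind (G := GA)): a => [|a a' IH IH'|p a ap].
- by rewrite tens_0l.
- by rewrite tens_Dl; apply: PD.
elim/(homog_ind (G := GB)): b => [|b b' IH IH'|q b bq]; last exact: Ph ap bq.
- by rewrite tens_0r.
- by rewrite tens_Dr; apply: PD.
Qed.

Lemma gtenDl a a' b : gten (a + a') b = gten a b + gten a' b.
Proof. exact: tens_Dl. Qed.
Lemma gtenDr a b b' : gten a (b + b') = gten a b + gten a b'.
Proof. exact: tens_Dr. Qed.
Lemma gtenZl k a b : gten (k *: a) b = k *: gten a b.
Proof. exact: tens_Zl. Qed.
Lemma gtenZr k a b : gten a (k *: b) = k *: gten a b.
Proof. exact: tens_Zr. Qed.
Lemma gten0l b : gten 0 b = 0.
Proof. exact: tens_0l. Qed.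
Lemma gten0r a : gten a 0 = 0.
Proof. exact: tens_0r. Qed.

Lemma gtens_mulE p q a b a' b' : homog GB q b -> homog GA p a' ->
  gten a b * gten a' b' = (-1) ^+ (q * p) *: gten (a * a') (b * b').
Proof.
move=> bq ap; rewrite /gten [LHS]gt_mul_tens /gt_mul0.
rewrite (gev_homog ap) (god_homog ap) (gsgn_homog bq) -uscalerAl.
rewrite -(signr_odd _ (q * p)) oddM -(signr_odd _ q).
case: (odd p); rewrite ?andbT ?andbF mulr0 tens_0l ?add0r ?addr0.
  exact: tens_Zr.
by rewrite scale1r.
Qed.

Lemma tgpr_balanced p :
  balanced (fun a b => \sum_(i < p.+1) gten (gpr GA i a) (gpr GB (p - i) b)).
Proof.
split=> [b a a'|a b b'|k a b] /=; rewrite -?big_split /=; apply: eq_bigr => i _.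
- by rewrite linearD gtenDl.
- by rewrite linearD gtenDr.
- by rewrite !linearZ gtenZl gtenZr.
Qed.
Definition tgpr (p : nat) : gtens -> gtens :=
  tlift (fun a b => \sum_(i < p.+1) gten (gpr GA i a) (gpr GB (p - i) b)).

Lemma tgpr_linear p : linear (tgpr p).
Proof.
apply: (tlift_linear (tgpr_balanced p)) => k a b.
by rewrite scaler_sumr; apply: eq_bigr => i _; rewrite linearZ /= gtenZl.
Qed.
HB.instance Definition _ p :=
  GRing.isLinear.Build K gtens gtens _ (tgpr p) (tgpr_linear p).

Lemma tgprE p a b :
  tgpr p (gten a b) = \sum_(i < p.+1) gten (gpr GA i a) (gpr GB (p - i) b).
Proof. exact: (tliftE (tgpr_balanced p)). Qed.

Lemma tgpr_homog p r s a b : homog GA r a -> homog GB s b ->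
  tgpr p (gten a b) = if p == (r + s)%N then gten a b else 0.
Proof.
move=> ar bs; rewrite tgprE.
transitivity (\sum_(i < p.+1) if i == r :> nat then
   (if p == (r + s)%N then gten a b else 0) else 0 : gtens).
  apply: eq_bigr => i _; rewrite (gpr_homog i ar) (gpr_homog _ bs).
  case: eqP => [ir|_]; last exact: gten0l.
  have ler : (r <= p)%N by rewrite -ir -ltnS.
  by rewrite ir -(eqn_add2l r) subnKC //; case: eqP => // _; apply: gten0r.
rewrite -big_mkcond /=; case: eqP => [->|_]; last by rewrite big1.
have ltr : (r < (r + s).+1)%N by rewrite ltnS leq_addr.
by rewrite (big_pred1 (Ordinal ltr)) // => i; rewrite -val_eqE.
Qed.

Lemma tgpr_idem p q x : tgpr p (tgpr q x) = if p == q then tgpr q x else 0.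
Proof.
elim/gten_ind: x => [|x y IHx IHy|r s a b ar bs].
- by rewrite !linear0 if_same.
- by rewrite !linearD /= IHx IHy; case: eqP; rewrite ?addr0.
rewrite (tgpr_homog q ar bs); case: (q =P (r + s)%N) => [->|_].
  by rewrite (tgpr_homog p ar bs).
by rewrite linear0 if_same.
Qed.

Lemma tgpr_sum x : exists N, x = \sum_(p < N) tgpr p x.
Proof.
suff [N xN] : exists N, forall M, (N <= M)%N -> x = \sum_(p < M) tgpr p x.
  by exists N; apply: xN.
elim/gten_ind: x => [|x y [N xN] [M yM]|r s a b ar bs].
- by exists 0%N => M _; rewrite big1 // => i _; rewrite linear0.
- exists (maxn N M) => L; rewrite geq_max => /andP[NL ML].
  rewrite {1}(xN L NL) {1}(yM L ML) -big_split /=.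
  by apply: eq_bigr => i _; rewrite linearD.
exists (r + s).+1 => M ltM.
rewrite (bigD1 (Ordinal ltM)) //= (tgpr_homog _ ar bs) eqxx big1 ?addr0 // => i.
by rewrite (tgpr_homog _ ar bs) -val_eqE /= => /negbTE->.
Qed.

Lemma tgpr_1 : tgpr 0 1 = 1.
Proof. exact: (tgpr_homog 0 (homog1 GA) (homog1 GB)). Qed.

Lemma thomog_ind p (P : gtens -> Prop) :
    P 0 -> (forall x y, P x -> P y -> P (x + y)) ->
    (forall r s a b, homog GA r a -> homog GB s b -> (r + s)%N = p ->
      P (gten a b)) ->
  forall x, tgpr p x = x -> P x.
Proof.
move=> P0 PD Ph x <-; elim/gten_ind: x => [|x y IHx IHy|r s a b ar bs].
- by rewrite linear0.
- by rewrite linearD; apply: PD.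
by rewrite (tgpr_homog p ar bs); case: eqP => // prs; apply: Ph ar bs _.
Qed.

Lemma tgpr_M p q x y :
  tgpr p x = x -> tgpr q y = y -> tgpr (p + q) (x * y) = x * y.
Proof.
move=> xp yq; elim/(thomog_ind (p := p)): x / xp => [|x x' IH IH'|r s a b ar bs rsp].
- by rewrite mul0r linear0.
- by rewrite mulrDl linearD /= IH IH'.
elim/(thomog_ind (p := q)): y / yq => [|y y' IH IH'|r' s' a' b' ar' bs' rsq].
- by rewrite mulr0 linear0.
- by rewrite mulrDr linearD /= IH IH'.
rewrite (gtens_mulE _ _ bs ar') linearZ /=.
rewrite (tgpr_homog _ (homogM ar ar') (homogM bs bs')).
by rewrite -rsp -rsq addnACA eqxx.
Qed.

Definition tgraded : graded gtens :=
  Graded (gpr := tgpr) tgpr_idem tgpr_sum tgpr_1 tgpr_M.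

End GradedTensor.

(* [cj] is the conjugation of scalars. *)
Section Gida.
Variables (K : comNzRingType) (cj : {rmorphism K -> K}).

Record gida (A : ualgebra K) := Gida {
  gida_gr :> graded A;
  bar : A -> A;
  barD : forall x y, bar (x + y) = bar x + bar y;
  barZ : forall k x, bar (k *: x) = cj k *: bar x;
  barK : involutive bar;
  bar_homog : forall p x, homog gida_gr p x -> homog gida_gr p (bar x);
  barM : forall p q x y, homog gida_gr p x -> homog gida_gr q y ->
    bar (x * y) = (-1) ^+ (p * q) *: (bar y * bar x);
  dif : {linear A -> A};
  dif_homog : forall p x, homog gida_gr p x -> homog gida_gr p.+1 (dif x);
  difM : forall p x y, homog gida_gr p x ->
    dif (x * y) = dif x * y + (-1) ^+ p *: (x * dif y);
  difK : forall x, dif (dif x) = 0;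
  dif_bar : forall x, dif (bar x) = bar (dif x)
}.

Section TensorGida.
Variables (A B : ualgebra K) (GA : gida A) (GB : gida B).
Local Notation T := (gtens GA GB).
Local Notation "a ⊗ b" := (gten GA GB a b) (at level 40).

Lemma cj_sign n : cj ((-1) ^+ n) = (-1) ^+ n.
Proof. by rewrite rmorphXn /= rmorphN1. Qed.

Lemma signr_parity m n : odd m = odd n -> (-1) ^+ m = (-1) ^+ n :> K.
Proof. by move=> mn; rewrite -signr_odd mn signr_odd. Qed.

Lemma bar0 (A' : ualgebra K) (G : gida A') : bar G 0 = 0.
Proof. by apply: (addIr (bar G 0)); rewrite -barD !add0r. Qed.

Definition tbar0 (a : A) (b : B) : T := bar GA a ⊗ bar GB b.
Definition tbar : T -> T := tlift tbar0.
Lemma tbar_balanced : balanced tbar0.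
Proof.
split=> [b a a'|a b b'|k a b]; rewrite /tbar0.
- by rewrite barD gtenDl.
- by rewrite barD gtenDr.
- by rewrite !barZ gtenZl gtenZr.
Qed.
Lemma tbarE a b : tbar (a ⊗ b) = bar GA a ⊗ bar GB b.
Proof. exact: (tliftE tbar_balanced). Qed.
Lemma tbarD x y : tbar (x + y) = tbar x + tbar y.
Proof. exact: (tliftD tbar_balanced). Qed.
Lemma tbar_0 : tbar 0 = 0. Proof. exact: (tlift0 tbar_balanced). Qed.
Lemma tbarZ k x : tbar (k *: x) = cj k *: tbar x.
Proof.
elim/gten_ind: x => [|x y IHx IHy|p q a b ap bq].
- by rewrite scaler0 tbar_0 scaler0.
- by rewrite scalerDr !tbarD scalerDr IHx IHy.
- by rewrite -gtenZl !tbarE barZ gtenZl.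
Qed.
Lemma tbarK : involutive tbar.
Proof.
elim/gten_ind => [|x y IHx IHy|p q a b ap bq]; first by rewrite !tbar_0.
- by rewrite !tbarD IHx IHy.
- by rewrite !tbarE !barK.
Qed.

Lemma homog_ten p q a b : homog GA p a -> homog GB q b ->
  homog (tgraded GA GB) (p + q) (a ⊗ b).
Proof. by move=> ap bq; rewrite /homog /= (tgpr_homog _ ap bq) eqxx. Qed.

Lemma tbar_homog p x : homog (tgraded GA GB) p x -> homog (tgraded GA GB) p (tbar x).
Proof.
elim/thomog_ind => [|{}x y IHx IHy|r s a b ar bs <-].
- by rewrite tbar_0 /homog linear0.
- by rewrite tbarD; apply: homogD.
- by rewrite tbarE; apply: homog_ten; apply: bar_homog.
Qed.

Lemma tbarM p q x y : homog (tgraded GA GB) p x -> homog (tgraded GA GB) q y ->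
  tbar (x * y) = (-1) ^+ (p * q) *: (tbar y * tbar x).
Proof.
move=> xp yq.
elim/thomog_ind: x / xp => [|x x' IH IH'|r s a b ar bs rsp].
- by rewrite tbar_0 mul0r mulr0 tbar_0 scaler0.
- by rewrite tbarD mulrDl mulrDr tbarD scalerDr IH IH'.
elim/thomog_ind: y / yq => [|y y' IH IH'|r' s' a' b' ar' bs' rsq].
- by rewrite tbar_0 mul0r mulr0 tbar_0 scaler0.
- by rewrite tbarD mulrDl mulrDr tbarD scalerDr IH IH'.
rewrite !tbarE (gtens_mulE _ _ bs ar') tbarZ cj_sign tbarE.
rewrite (gtens_mulE _ _ (bar_homog bs') (bar_homog ar)).
rewrite (barM ar ar') (barM bs bs') gtenZl gtenZr !scalerA -!exprD -rsp -rsq.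
congr (_ *: _); apply: signr_parity; rewrite !(oddD, oddM).
by case: (odd r); case: (odd s); case: (odd r'); case: (odd s').
Qed.

Definition tdif0 (a : A) (b : B) : T := dif GA a ⊗ b + gsgn GA a ⊗ dif GB b.
Definition tdif : T -> T := tlift tdif0.
Lemma tdif_balanced : balanced tdif0.
Proof.
split=> [b a a'|a b b'|k a b]; rewrite /tdif0.
- by rewrite linearD gsgnD !gtenDl addrACA.
- by rewrite linearD !gtenDr addrACA.
- by rewrite gsgnZ !linearZ !gtenZl !gtenZr.
Qed.
Lemma tdif_linear : linear tdif.
Proof.
apply: (tlift_linear tdif_balanced) => k a b.
by rewrite /tdif0 gsgnZ linearZ /= !gtenZl scalerDr.
Qed.
HB.instance Definition _ := GRing.isLinear.Build K T T _ tdif tdif_linear.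

Lemma tdifE p a b : homog GA p a ->
  tdif (a ⊗ b) = dif GA a ⊗ b + (-1) ^+ p *: (a ⊗ dif GB b).
Proof.
move=> ap; rewrite /tdif (tliftE tdif_balanced) /tdif0 (gsgn_homog ap).
by rewrite gtenZl.
Qed.

Lemma tdif_homog p x :
  homog (tgraded GA GB) p x -> homog (tgraded GA GB) p.+1 (tdif x).
Proof.
elim/thomog_ind => [|{}x y IHx IHy|r s a b ar bs <-].
- by rewrite linear0 /homog linear0.
- by rewrite linearD; apply: homogD.
rewrite (tdifE _ ar); apply: homogD; last apply: homogZ.
  by rewrite -addSn; apply: homog_ten => //; apply: dif_homog.
by rewrite -addnS; apply: homog_ten => //; apply: dif_homog.
Qed.

Lemma tdifM p x y : homog (tgraded GA GB) p x ->
  tdif (x * y) = tdif x * y + (-1) ^+ p *: (x * tdif y).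
Proof.
elim/thomog_ind => [|{}x x' IH IH'|r s a b ar bs <-].
- by rewrite linear0 !mul0r linear0 scaler0 addr0.
- by rewrite linearD !mulrDl linearD /= scalerDr addrACA IH IH'.
elim/gten_ind: y => [|y y' IH IH'|r' s' a' b' ar' bs'].
- by rewrite linear0 !mulr0 linear0 scaler0 addr0.
- by rewrite linearD !mulrDr linearD /= scalerDr addrACA IH IH'.
rewrite (gtens_mulE _ _ bs ar') linearZ /= (tdifE _ (homogM ar ar')).
rewrite (difM _ ar) (difM _ bs) (tdifE _ ar) (tdifE _ ar').
rewrite mulrDl mulrDr -!uscalerAl -!uscalerAr.
rewrite (gtens_mulE _ _ bs ar') (gtens_mulE _ _ (dif_homog bs) ar').
rewrite (gtens_mulE _ _ bs (dif_homog ar')) (gtens_mulE _ _ bs ar').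
rewrite gtenDl gtenDr gtenZl gtenZr !scalerDr !scalerA -!exprD !addrA.
rewrite -[in LHS]addrA [X in _ = X + _]addrAC -[RHS]addrA.
rewrite (@signr_parity (s * r' + r)%N (r + s + s * r'.+1)%N); last first.
  rewrite !(oddD, oddM) /=.
  by case: (odd r); case: (odd s); case: (odd r').
rewrite (@signr_parity (s * r' + (r + r'))%N (r + s.+1 * r')%N); last first.
  rewrite !(oddD, oddM) /=.
  by case: (odd r); case: (odd s); case: (odd r').
rewrite (@signr_parity (s * r' + (r + r') + s)%N (r + s + r' + s * r')%N) //.
rewrite !(oddD, oddM) /=.
by case: (odd r); case: (odd s); case: (odd r').
Qed.

Lemma tdifK x : tdif (tdif x) = 0.
Proof.
elim/gten_ind: x => [|x y IHx IHy|p q a b ap bq]; first by rewrite !linear0.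
  by rewrite !linearD /= IHx IHy addr0.
rewrite (tdifE _ ap) linearD linearZ /= (tdifE _ ap) (tdifE _ (dif_homog ap)).
rewrite !difK gten0l gten0r scaler0 add0r addr0 exprS mulN1r scaleNr.
by rewrite addNr.
Qed.

Lemma tdif_bar x : tdif (tbar x) = tbar (tdif x).
Proof.
elim/gten_ind: x => [|x y IHx IHy|p q a b ap bq].
- by rewrite linear0 tbar_0 linear0.
- by rewrite linearD !tbarD linearD /= IHx IHy.
rewrite (tdifE _ ap) tbarD tbarZ cj_sign !tbarE (tdifE _ (bar_homog ap)).
by rewrite !dif_bar.
Qed.

Definition tgida : gida T :=
  Gida tbarD tbarZ tbarK tbar_homog tbarM tdif_homog tdifM tdifK tdif_bar.
End TensorGida.

Definition gida_hom (A B : ualgebra K) (GA : gida A) (GB : gida B)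
    (f : {linear A -> B}) : Prop :=
  [/\ monoid_morphism f,
      forall p x, homog GA p x -> homog GB p (f x),
      forall x, f (bar GA x) = bar GB (f x) &
      forall x, f (dif GA x) = dif GB (f x)].
End Gida.

Section Hopf.
Variables (K : comNzRingType) (cj : {rmorphism K -> K}).

Definition hopf_axioms (A : ualgebra K) (G : graded A)
    (Delta : {linear A -> gtens G G}) (eps : {scalar A})
    (S : {linear A -> A}) : Prop :=
  [/\ monoid_morphism Delta /\
        (forall p x, homog G p x -> homog (tgraded G G) p (Delta x)),
      monoid_morphism eps,
      forall x, tassoc (tmap Delta idfun (Delta x)) = tmap idfun Delta (Delta x),
      forall x, tforml eps (Delta x) = x /\ tformr eps (Delta x) = x &
      (forall p x, homog G p x -> homog G p (S x)) /\
      forall x, tmult (tmap S idfun (Delta x)) = eps x *: (1 : A) /\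
                tmult (tmap idfun S (Delta x)) = eps x *: (1 : A)].

Definition gida_hopf (A : ualgebra K) (G : gida cj A)
    (Delta : {linear A -> gtens G G}) (eps : {scalar A})
    (S : {linear A -> A}) : Prop :=
  [/\ hopf_axioms Delta eps S,
      gida_hom G (tgida G G) Delta,
      forall x, eps (bar G x) = cj (eps x),
      forall x, eps (dif G x) = 0 &
      forall x, S (dif G x) = dif G (S x)].

Definition gida_comodule (A B : ualgebra K) (GA : gida cj A) (GB : gida cj B)
    (Delta : {linear A -> gtens GA GA}) (eps : {scalar A})
    (delta : {linear B -> gtens GA GB}) : Prop :=
  [/\ gida_hom GB (tgida GA GB) delta,
      forall x, tassoc (tmap Delta idfun (delta x)) = tmap idfun delta (delta x) &
      forall x, tforml eps (delta x) = x].
End Hopf.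

Section Quadratic.
Variables (K : comNzRingType) (X : Type) (q : X -> X -> K).

Inductive q_rel : term K X -> term K X -> Prop :=
| q_xx x y :
    q_rel (Mul (Gen x) (Gen y)) (Mul (Scal (q x y)) (Mul (Gen y) (Gen x))).

(* Generators of the differential forms: [Fn x] stands for [x] and [Df x] for
   [dx]. *)
Inductive dgen : Type := Fn of X | Df of X.

Inductive dq_rel : term K dgen -> term K dgen -> Prop :=
| dq_xx x y : dq_rel (Mul (Gen (Fn x)) (Gen (Fn y)))
    (Mul (Scal (q x y)) (Mul (Gen (Fn y)) (Gen (Fn x))))
| dq_xd x y : dq_rel (Mul (Gen (Fn x)) (Gen (Df y)))
    (Mul (Scal (q x y)) (Mul (Gen (Df y)) (Gen (Fn x))))
| dq_dd x y : dq_rel (Mul (Gen (Df x)) (Gen (Df y)))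
    (Mul (Scal (- q x y)) (Mul (Gen (Df y)) (Gen (Df x)))).

Definition q_alg : ualgebra K := presented q_rel.
Definition q_forms : ualgebra K := presented dq_rel.
End Quadratic.

(* Adjoins to the algebra presented by [rel] a central inverse [Gen None] of the
   element represented by [w]. *)
Inductive inv_rel (K : comNzRingType) (X : Type)
    (rel : term K X -> term K X -> Prop) (w : term K X) :
    term K (option X) -> term K (option X) -> Prop :=
| inv_old a b : rel a b -> inv_rel rel w (rename Some a) (rename Some b)
| inv_central x :
    inv_rel rel w (Mul (Gen None) (Gen (Some x))) (Mul (Gen (Some x)) (Gen None))
| inv_inv : inv_rel rel w (Mul (rename Some w) (Gen None)) (Scal 1).

Definition triv_pr (K : comNzRingType) (A : ualgebra K) (p : nat) :
    {linear A -> A} :=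
  if p is 0 then (idfun : {linear A -> A}) else (\0 : {linear A -> A}).

Lemma triv_pr_idem (K : comNzRingType) (A : ualgebra K) p q (x : A) :
  triv_pr A p (triv_pr A q x) = if p == q then triv_pr A q x else 0.
Proof. by case: p q => [|p] [|q] //=; rewrite if_same. Qed.
Lemma triv_pr_sum (K : comNzRingType) (A : ualgebra K) (x : A) :
  exists N, x = \sum_(p < N) triv_pr A p x.
Proof. by exists 1%N; rewrite big_ord1. Qed.
Lemma triv_pr_M (K : comNzRingType) (A : ualgebra K) p q (x y : A) :
  triv_pr A p x = x -> triv_pr A q y = y -> triv_pr A (p + q) (x * y) = x * y.
Proof.
by case: p q => [|p] [|q] //= => [_ <-|<- _|<- _]; rewrite ?mulr0 ?mul0r.
Qed.

(* An ungraded algebra, concentrated in degree [0]. For such algebras [gtens] is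
   the ordinary tensor product of algebras. *)
Definition triv_graded (K : comNzRingType) (A : ualgebra K) : graded A :=
  Graded (@triv_pr_idem K A) (@triv_pr_sum K A) erefl (@triv_pr_M K A).

(* The index set [I_m] for [m = 2 * n + b]. *)
Definition idx (n : nat) (b : bool) : finType := ('I_n + 'I_n + 'I_b)%type.

Section Theta.
Variables (R : realType) (n : nat) (theta : 'M[R]_n) (b : bool).
Local Notation C := (R[i]).
Local Notation I := (idx n b).

Definition ix (mu : 'I_n) : I := inl (inl mu).
Definition ixbar (mu : 'I_n) : I := inl (inr mu).
Definition ix0 (k : 'I_b) : I := inr k.

Definition conj_idx (i : I) : I :=
  match i with
  | inl (inl mu) => ixbar mu
  | inl (inr mu) => ix mu
  | inr k => ix0 k
  end.

(* [exp (i theta)]. *)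
Definition lam (mu nu : 'I_n) : C :=
  (cos (theta mu nu) +i* sin (theta mu nu))%C.

Definition Lam (i j : I) : C :=
  match i, j with
  | inl (inl mu), inl (inl nu) | inl (inr mu), inl (inr nu) => lam mu nu
  | inl (inl mu), inl (inr nu) | inl (inr mu), inl (inl nu) => lam nu mu
  | _, _ => 1
  end.

Definition OmegaR : ualgebra C := q_forms Lam.
Definition xi (i : I) : OmegaR := pgen _ (Fn i).
Definition dxi (i : I) : OmegaR := pgen _ (Df i).

(* The generator [(i, j)] stands for [t^i_j]. *)
Definition LamM (x y : I * I) : C := Lam x.1 y.1 * Lam y.2 x.2.

Definition Mtheta : ualgebra C := q_alg LamM.
Definition tM (i j : I) : Mtheta := pgen _ (i, j).

Definition Omega0 : OmegaR :=
  (\prod_(mu < n) (dxi (ixbar mu) * dxi (ix mu))) * \prod_(k < b) dxi (ix0 k).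

Definition is_det (D : Mtheta) : Prop :=
  exists rho : {linear OmegaR -> gtens (triv_graded Mtheta) (triv_graded OmegaR)},
  [/\ monoid_morphism rho,
      forall i, rho (xi i) = \sum_j gten _ _ (tM i j) (xi j),
      forall i, rho (dxi i) = \sum_j gten _ _ (tM i j) (dxi j) &
      rho Omega0 = gten _ _ D Omega0].

Definition det_theta : Mtheta := xget 0 [set D | is_det D].

(* A representative of [det_theta]; the algebras below do not depend on it. *)
Definition det_term : term C (I * I) :=
  repr (det_theta : pres_sort (q_rel LamM)).

Definition CGL : ualgebra C := presented (inv_rel (q_rel LamM) det_term).
Definition tC (i j : I) : CGL := pgen _ (Some (i, j)).
Definition detinvC : CGL := pgen _ None.

(* [q_forms LamM], the algebra of differential forms on [Mtheta], with the
   inverse of [det_theta] adjoined. *)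
Definition OmegaGL : ualgebra C :=
  presented (inv_rel (dq_rel LamM) (rename (@Fn _) det_term)).
Definition tGL (i j : I) : OmegaGL := pgen _ (Some (Fn (i, j))).
Definition dtGL (i j : I) : OmegaGL := pgen _ (Some (Df (i, j))).
Definition detinv : OmegaGL := pgen _ None.
Definition detGL : OmegaGL :=
  peval _ (rename Some (rename (@Fn _) det_term)).

Definition OmegaR_structure (G : gida conjc OmegaR) : Prop :=
  [/\ forall i, homog G 0 (xi i) /\ homog G 1 (dxi i),
      forall i, dif G (xi i) = dxi i,
      forall i, bar G (xi i) = xi (conj_idx i) &
      forall i, bar G (dxi i) = dxi (conj_idx i)].

Definition OmegaGL_structure (G : gida conjc OmegaGL) : Prop :=
  [/\ forall i j, homog G 0 (tGL i j) /\ homog G 1 (dtGL i j),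
      forall i j, dif G (tGL i j) = dtGL i j,
      forall i j, bar G (tGL i j) = tGL (conj_idx i) (conj_idx j),
      forall i j, bar G (dtGL i j) = dtGL (conj_idx i) (conj_idx j) &
      [/\ homog G 0 detinv,
          dif G detinv = - (detinv ^+ 2 * dif G detGL) &
          bar G detinv = detinv]].

(* A *-algebra is a [gida] concentrated in degree [0]; its differential is then
   zero. *)
Definition CGL_structure (G : gida conjc CGL) : Prop :=
  [/\ forall x, homog G 0 x,
      forall i j, bar G (tC i j) = tC (conj_idx i) (conj_idx j) &
      bar G detinvC = detinvC].

Definition CGL_hopf (G : gida conjc CGL) (Delta : {linear CGL -> gtens G G})
    (eps : {scalar CGL}) (S : {linear CGL -> CGL}) : Prop :=
  [/\ gida_hopf Delta eps S,
      forall i j, Delta (tC i j) = \sum_k gten _ _ (tC i k) (tC k j),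
      Delta detinvC = gten _ _ detinvC detinvC,
      forall i j, eps (tC i j) = (i == j)%:R &
      eps detinvC = 1].

(* [bar], [Delta], [eps] and [S] extend the *-Hopf algebra structure of [CGL]
   along the canonical homomorphism [CGL -> OmegaGL]. *)
Definition extends_CGL (G : gida conjc OmegaGL) (Delta : {linear OmegaGL -> gtens G G})
    (eps : {scalar OmegaGL}) (S : {linear OmegaGL -> OmegaGL}) : Prop :=
  exists (G0 : gida conjc CGL) (Delta0 : {linear CGL -> gtens G0 G0})
    (eps0 : {scalar CGL}) (S0 : {linear CGL -> CGL})
    (iota : {linear CGL -> OmegaGL}),
  [/\ CGL_structure G0,
      CGL_hopf Delta0 eps0 S0,
      [/\ monoid_morphism iota,
          forall i j, iota (tC i j) = tGL i j &
          iota detinvC = detinv],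
      forall x, bar G (iota x) = iota (bar G0 x) &
      forall x, [/\ Delta (iota x) = tmap iota iota (Delta0 x),
                    eps (iota x) = eps0 x &
                    S (iota x) = iota (S0 x)]].
End Theta.

(* Main.v *)
(* Every structure map is a homomorphism on generators and relations, into an
   algebra chosen for the purpose: a grading is a homomorphism to A (x) K[X], an
   antiderivation one to triangular 2 x 2 matrices over A, and the involution and
   the antipode are homomorphisms to a graded opposite algebra. Axioms then only
   need to be checked on generators.

   The relations involving the inverse of det_theta are checked on the formula
   det = sum_w s(w) t_{w0,w}, w running over the words of length m, where
   dx^w = s(w) dx^w0. For every word v one has sum_w s(w) t_{v,w} = s(v) det, since
   both sides obey the exchange rule of the products dx^v; this gives Delta det =
   det (x) det, the hermiticity of det and the inverse matrix of (t^i_j) by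
   cofactors, which is the antipode. Each cofactor commutes with the generators up
   to a scalar computed from its rows and columns, whence the relations satisfied
   by the antipode. The determinant is the one of the paper because s is the value
   on dx^w of a linear form, given by an action of the forms on functions on
   words. *)

Require Import Defs.
From HB Require Import structures.
From mathcomp Require Import all_boot all_algebra.
From mathcomp Require Import all_classical all_reals.
From mathcomp.real_closed Require Import complex.
From mathcomp Require Import ring.

Set Implicit Arguments.
Unset Strict Implicit.
Unset Printing Implicit Defensive.

Import GRing.Theory.
Local Open Scope ring_scope.

(** * Algebras given by generators and relations *)

(** The obstacle is the differential: every relation involving the determinant, its inverse or the
    cofactors must hold together with its differential. Since the graph of an antiderivation is a
    homomorphism to triangular matrices, a statement proved for all quantum matrices over all
    algebras can be applied to the pairs [(t, dt)], and its second component is the differentiated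
    statement. Determinants and cofactors are therefore studied for an arbitrary quantum matrix.

    The scalar factors disappear because the product of [Lam i j] over all [i] is [1]: conjugate
    indices contribute reciprocal factors. An element that commutes with the entries up to such
    factors commutes with the determinant, and a cofactor only keeps the inverse of the factors of
    its missing row and column.

    For [u] inverse to [y], the formula [d u = - u (d y) u] carries compatibility with the
    differential from the entries through the determinant to its inverse.

    The Hopf structure of [CGL] is not built separately: killing the [dt] retracts [OmegaGL] onto
    [CGL], and the structure is induced along this retraction. *)

Definition linear_of (K : comNzRingType) (U V : lmodType K) (f : U -> V)
    (lin_f : linear f) : {linear U -> V} :=
  HB.pack f (GRing.isLinear.Build K U V _ f lin_f).
Arguments linear_of : simpl never.

Definition scalar_of (K : comNzRingType) (U : lmodType K) (f : U -> K)
    (lin_f : scalar f) : {scalar U} :=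
  HB.pack f (GRing.isLinear.Build K U K _ f lin_f).
Arguments scalar_of : simpl never.

(** Stated as an induction principle, so that any predicate closed under the operations can be used
    without forming the subalgebra it defines. *)
Definition generates (K : comNzRingType) (X : Type) (A : ualgebra K)
    (gen : X -> A) : Prop :=
  forall P : A -> Prop,
    (forall x, P (gen x)) -> P 1 -> (forall k x, P x -> P (k *: x)) ->
    (forall x y, P x -> P y -> P (x + y)) ->
    (forall x y, P x -> P y -> P (x * y)) ->
  forall x, P x.

Section Presented.
Variables (K : comNzRingType) (X : Type) (rel : term K X -> term K X -> Prop).
Local Notation A := (presented rel).
Implicit Types a b : term K X.

Lemma pevalD a b : peval rel (Add a b) = peval rel a + peval rel b.
Proof. exact/esym/paddE. Qed.

Lemma pevalM a b : peval rel (Mul a b) = peval rel a * peval rel b.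
Proof. exact/esym/pmulE. Qed.

Lemma peval_scal k : peval rel (Scal k) = k *: (1 : A).
Proof.
rewrite [RHS](_ : _ = pscale k (pcls rel (Scal 1))) // pscaleE.
apply/pclsP/pc_sym/(pc_trans (pc_scalC _ _ _)); exact: pc_mul1.
Qed.

Lemma peval_rel a b : rel a b -> peval rel a = peval rel b.
Proof. by move=> ab; apply/pclsP/pc_rel. Qed.

Lemma pgen_generates : generates (pgen rel).
Proof.
move=> P Pgen P1 PZ PD PM; apply: presW; elim=> [x|k|a Pa b Pb|a Pa b Pb].
- exact: Pgen.
- by rewrite -[pcls _ _]/(peval rel _) peval_scal; apply: PZ.
- by rewrite -[pcls _ _]/(peval rel _) pevalD; apply: PD.
- by rewrite -[pcls _ _]/(peval rel _) pevalM; apply: PM.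
Qed.

End Presented.

Section Teval.
Variables (K : comNzRingType) (X : Type) (B : ualgebra K) (g : X -> B).

Fixpoint teval (a : term K X) : B :=
  match a with
  | Gen x => g x
  | Scal k => k *: (1 : B)
  | Add a b => teval a + teval b
  | Mul a b => teval a * teval b
  end.

Lemma teval_cong (rel : term K X -> term K X -> Prop) :
    (forall a b, rel a b -> teval a = teval b) ->
  forall a b, pres_cong rel a b -> teval a = teval b.
Proof.
move=> g_rel a b; elim=> {a b} //=.
- by move=> a b c _ -> _ ->.
- by move=> a a' b b' _ -> _ ->.
- by move=> a a' b b' _ -> _ ->.
- by move=> a b c; rewrite addrA.
- by move=> a b; rewrite addrC.
- by move=> a; rewrite scale0r add0r.
- by move=> a b c; rewrite mulrA.
- by move=> a; rewrite scale0r mul0r.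
- by move=> a; rewrite scale1r mul1r.
- by move=> a b c; rewrite mulrDl.
- by move=> a b c; rewrite mulrDr.
- by move=> k l; rewrite scalerDl.
- by move=> k l; rewrite -uscalerAl mul1r scalerA.
- by move=> k a; rewrite -uscalerAl -uscalerAr mul1r mulr1.
Qed.

(** The universal property. The map evaluates a chosen representative, and [teval_cong] makes the
    choice immaterial. *)
Lemma presented_lift (rel : term K X -> term K X -> Prop) :
    (forall a b, rel a b -> teval a = teval b) ->
  exists f : {linear presented rel -> B},
    monoid_morphism f /\ forall a, f (peval rel a) = teval a.
Proof.
move=> g_rel; pose f (x : presented rel) := teval (repr (x : pres_sort rel)).
have fE a : f (peval rel a) = teval a by apply: (teval_cong g_rel); apply: repr_pcls.
have f1 : f 1 = 1.
  by rewrite (_ : 1 = peval rel (Scal 1)) ?fE /= ?scale1r.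
have fM x y : f (x * y) = f x * f y.
  by elim/presW: x => a; elim/presW: y => b; rewrite -pevalM !fE.
have fD x y : f (x + y) = f x + f y.
  by elim/presW: x => a; elim/presW: y => b; rewrite -pevalD !fE.
have fZ k x : f (k *: x) = k *: f x.
  rewrite -[x]mul1r uscalerAl fM -peval_scal fE /=.
  by rewrite -uscalerAl !mul1r.
have f_lin : linear f by move=> k x y; rewrite fD fZ.
by exists (linear_of f_lin).
Qed.

End Teval.

Lemma teval_rename (K : comNzRingType) (X Y : Type) (B : ualgebra K)
    (f : X -> Y) (g : Y -> B) (a : term K X) :
  teval g (rename f a) = teval (g \o f) a.
Proof. by elim: a => //= a -> b ->. Qed.

Lemma eq_teval (K : comNzRingType) (X : Type) (B : ualgebra K)
    (g h : X -> B) : g =1 h -> teval g =1 teval h.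
Proof. by move=> gh; elim=> //= a -> b ->. Qed.

Lemma teval_peval (K : comNzRingType) (X : Type) rel (a : term K X) :
  teval (pgen rel) a = peval rel a.
Proof.
elim: a => //= [k|a -> b ->|a -> b ->].
- by rewrite peval_scal.
- by rewrite pevalD.
- by rewrite pevalM.
Qed.

Lemma hom_ext (K : comNzRingType) (X : Type) (A B : ualgebra K) (gen : X -> A)
    (f g : {linear A -> B}) :
    generates gen -> monoid_morphism f -> monoid_morphism g ->
    (forall x, f (gen x) = g (gen x)) -> f =1 g.
Proof.
move=> genA [f1 fM] [g1 gM] fg; apply: genA => //.
- by rewrite f1 g1.
- by move=> k x xE; rewrite !linearZ xE.
- by move=> x y xE yE; rewrite !linearD xE yE.
- by move=> x y xE yE; rewrite fM gM xE yE.
Qed.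

(* Elements with all homogeneous components in [P] form a subalgebra. *)
Lemma homog_generated_ind (K : comNzRingType) (X : Type) (A : ualgebra K)
    (G : graded A) (gen : X -> A) (deg : X -> nat) (P : A -> Prop) :
    generates gen -> (forall x, homog G (deg x) (gen x)) ->
    P 0 -> P 1 -> (forall x, P (gen x)) -> (forall k x, P x -> P (k *: x)) ->
    (forall x y, P x -> P y -> P (x + y)) ->
    (forall p q x y, homog G p x -> homog G q y -> P x -> P y -> P (x * y)) ->
  forall x, P x.
Proof.
move=> genA hgen P0 P1 Pgen PZ PD PM.
have Psum (I : finType) (F : I -> A) :
    (forall i, P (F i)) -> P (\sum_i F i).
  by move=> PF; elim/big_ind: _ => // i _.
suff Pgpr : forall x p, P (gpr G p x).
  by move=> x; have [N ->] := gpr_sum G x; apply: Psum => i; apply: Pgpr.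
apply: genA => [x p|p|k x Px p|x y Px Py p|x y Px Py p].
- by rewrite (gpr_homog p (hgen x)); case: ifP.
- by rewrite (gpr_homog p (homog1 G)); case: ifP.
- by rewrite linearZ; apply/PZ/Px.
- by rewrite linearD; apply: PD; [apply: Px|apply: Py].
have [N ->] := gpr_sum G x; have [M ->] := gpr_sum G y.
rewrite mulr_suml linear_sum /=; apply/Psum => i.
rewrite mulr_sumr linear_sum /=; apply: Psum => j.
have hi := homog_gpr G i x; have hj := homog_gpr G j y.
by rewrite (gpr_homog p (homogM hi hj)); case: ifP => // _; apply: PM hi hj _ _.
Qed.

(** * Target algebras: graded opposites, triangular matrices, polynomials *)

Definition twist (K : comNzRingType) (tau : {rmorphism K -> K})
  (V : lmodType K) : Type := V.

Section Twist.
Variables (K : comNzRingType) (tau : {rmorphism K -> K}) (V : lmodType K).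
Local Notation W := (twist tau V).
HB.instance Definition _ := GRing.Zmodule.copy W V.

Let tscale (k : K) (x : W) : W := tau k *: (x : V).
Let tscaleA k l x : tscale k (tscale l x) = tscale (k * l) x.
Proof. by rewrite /tscale scalerA rmorphM. Qed.
Let tscale1 : left_id 1 tscale.
Proof. by move=> x; rewrite /tscale rmorph1 scale1r. Qed.
Let tscaleDr : right_distributive tscale +%R.
Proof. by move=> k x y; apply: scalerDr. Qed.
Let tscaleDl x : {morph tscale^~ x : k l / k + l}.
Proof. by move=> k l; rewrite /tscale rmorphD; apply: scalerDl. Qed.
HB.instance Definition _ :=
  GRing.Zmodule_isLmodule.Build K W tscaleA tscale1 tscaleDr tscaleDl.

End Twist.

(* The graded opposite algebra, with scalars acting through [tau], so that
   graded [tau]-semilinear anti-homomorphisms to [A] are homomorphisms to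
   [gop tau G]. *)
Section GradedOpposite.
Variables (K : comNzRingType) (tau : {rmorphism K -> K}).
Variables (A : ualgebra K) (G : graded A).
Local Notation W := (twist tau (ua_mod A)).

(** The product [(-1) ^+ (p * q) *: (y * x)], written so as to make sense for inhomogeneous
    elements: the odd part of [x] picks up the sign of [y]. *)
Definition gop_mul (x y : A) : A := y * gev G x + gsgn G y * god G x.

Let gmulE p q x y : homog G p x -> homog G q y ->
  gop_mul x y = (-1) ^+ (p * q) *: (y * x).
Proof.
move=> xp yq; rewrite /gop_mul (gev_homog xp) (god_homog xp) (gsgn_homog yq).
rewrite -(signr_odd _ (p * q)) oddM -(signr_odd _ q).
case: (odd p); rewrite ?mulr0 ?add0r ?addr0 /=; first by rewrite -uscalerAl.
by rewrite expr0 scale1r.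
Qed.

Let gmulDl : left_distributive gop_mul +%R.
Proof. by move=> x y z; rewrite /gop_mul !linearD /= !mulrDr addrACA. Qed.
Let gmulDr : right_distributive gop_mul +%R.
Proof. by move=> x y z; rewrite /gop_mul !linearD /= !mulrDl addrACA. Qed.
Let gmul0l x : gop_mul 0 x = 0.
Proof. by rewrite /gop_mul !linear0 !mulr0 addr0. Qed.
Let gmul0r x : gop_mul x 0 = 0.
Proof. by rewrite /gop_mul !linear0 !mul0r addr0. Qed.
Let gmulZl k x y : k *: gop_mul x y = gop_mul (k *: x) y.
Proof. by rewrite /gop_mul !linearZ /= -!uscalerAr scalerDr. Qed.
Let gmulZr k x y : k *: gop_mul x y = gop_mul x (k *: y).
Proof. by rewrite /gop_mul linearZ /= -!uscalerAl scalerDr. Qed.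

Let gmulA : associative gop_mul.
Proof.
move=> x y z.
elim/(homog_ind (G := G)): x => [|x x' IH IH'|p x xp]; first by rewrite !gmul0l.
  by rewrite !(gmulDl x x') gmulDl IH IH'.
elim/(homog_ind (G := G)): y => [|y y' IH IH'|q y yq]; first
  by rewrite gmul0l !gmul0r gmul0l.
  rewrite (gmulDl y y') (gmulDr x (gop_mul y z) (gop_mul y' z)) (gmulDr x y y').
  by rewrite (gmulDl (gop_mul x y)) IH IH'.
elim/(homog_ind (G := G)): z => [|z z' IH IH'|r z zr]; first by rewrite !gmul0r.
  rewrite (gmulDr (gop_mul x y) z z') (gmulDr y z z').
  by rewrite (gmulDr x (gop_mul y z)) IH IH'.
rewrite (gmulE xp yq) (gmulE yq zr) -gmulZl -gmulZr.
rewrite (gmulE xp (homogM zr yq)) (gmulE (homogM yq xp) zr) !scalerA -!exprD.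
by rewrite mulrA; congr (_ ^+ _ *: _); rewrite mulnDr mulnDl addnA addnC.
Qed.

Let gmul1 : left_id 1 gop_mul.
Proof. by move=> x; rewrite /gop_mul gev1 god1 mulr1 mulr0 addr0. Qed.
Let gmulr1 : right_id 1 gop_mul.
Proof. by move=> x; rewrite /gop_mul gsgn1 !mul1r gevDod. Qed.

Definition gop : ualgebra K :=
  @UAlgebra K W (1 : A) gop_mul gmulA gmul1 gmulr1 gmulDl gmulDr
    (fun k => gmulZl (tau k)) (fun k => gmulZr (tau k)).

Lemma gop_scaleE k (x : A) : k *: (x : gop) = tau k *: x.
Proof. by []. Qed.

Lemma gop_mulE p q (x y : A) : homog G p x -> homog G q y ->
  (x : gop) * (y : gop) = (-1) ^+ (p * q) *: (y * x : A).
Proof. exact: gmulE. Qed.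

End GradedOpposite.

(* The pairs [(x, u)] stand for the matrices [[gsgn x, u], [0, x]]; the graph of
   an antiderivation is a homomorphism to this algebra. *)
Section Tri.
Variables (K : comNzRingType) (A : ualgebra K) (G : graded A).
Local Notation V := (ua_mod A * ua_mod A)%type.

Definition tri_mul (x y : V) : V :=
  ((x.1 : A) * (y.1 : A), (x.2 : A) * (y.1 : A) + gsgn G x.1 * (y.2 : A)).

Let tmulA : associative tri_mul.
Proof.
move=> [x u] [y v] [z w]; rewrite /tri_mul /=; congr pair; first exact: (@mulrA A).
by rewrite (@mulrDr A) (@mulrDl A (_ * _)) gsgnM !(@mulrA A) addrA.
Qed.
Let tmul1 : left_id ((1 : A), (0 : A)) tri_mul.
Proof. by move=> [x u]; rewrite /tri_mul /= gsgn1 !(@mul1r A) (@mul0r A) add0r. Qed.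
Let tmulr1 : right_id ((1 : A), (0 : A)) tri_mul.
Proof. by move=> [x u]; rewrite /tri_mul /= !(@mulr1 A) (@mulr0 A) addr0. Qed.
Let tmulDl : left_distributive tri_mul +%R.
Proof.
move=> [x u] [y v] [z w]; rewrite /tri_mul /=; congr pair; first exact: (@mulrDl A).
by rewrite gsgnD !mulrDl addrACA.
Qed.
Let tmulDr : right_distributive tri_mul +%R.
Proof.
move=> [x u] [y v] [z w]; rewrite /tri_mul /=; congr pair; first exact: (@mulrDr A).
by rewrite !mulrDr addrACA.
Qed.
Let tmulZl k x y : k *: tri_mul x y = tri_mul (k *: x) y.
Proof.
case: x y => [x u] [y v]; rewrite /tri_mul; congr pair; first exact: uscalerAl.
by rewrite /= gsgnZ -!uscalerAl -scalerDr.
Qed.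
Let tmulZr k x y : k *: tri_mul x y = tri_mul x (k *: y).
Proof.
case: x y => [x u] [y v]; rewrite /tri_mul; congr pair; first exact: uscalerAr.
by rewrite /= -!uscalerAr -scalerDr.
Qed.

Definition tri : ualgebra K :=
  @UAlgebra K V _ _ tmulA tmul1 tmulr1 tmulDl tmulDr tmulZl tmulZr.

Definition tr (x u : A) : tri := (x, u).

Lemma trM x u y v : tr x u * tr y v = tr (x * y) (u * y + gsgn G x * v).
Proof. by []. Qed.
Lemma tr1 : tr 1 0 = 1. Proof. by []. Qed.
Lemma trZ k x u : k *: tr x u = tr (k *: x) (k *: u). Proof. by []. Qed.
Lemma trD x u y v : tr x u + tr y v = tr (x + y) (u + v). Proof. by []. Qed.

End Tri.

Definition poly_ua (K : comNzRingType) : ualgebra K :=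
  @UAlgebra K {poly K} 1 *%R (@mulrA _) (@mul1r _) (@mulr1 _) (@mulrDl _)
    (@mulrDr _) (@scalerAl _ _) (@scalerAr _ _).

Definition scal_ua (K : comNzRingType) : ualgebra K :=
  @UAlgebra K K^o 1 *%R (@mulrA _) (@mul1r _) (@mulr1 _) (@mulrDl _)
    (@mulrDr _) (@scalerAl _ _) (@scalerAr _ _).

(** * Gradings, antiderivations and graded anti-homomorphisms *)

Lemma additive0 (U V : zmodType) (f : U -> V) :
  {morph f : x y / x + y} -> f 0 = 0.
Proof. by move=> fD; apply: (addIr (f 0)); rewrite -fD !add0r. Qed.

Section GtenSum.
Variables (K : comNzRingType) (A B : ualgebra K) (GA : graded A) (GB : graded B).
Variables (I : Type) (r : seq I) (P : pred I).

Lemma gten_suml (F : I -> A) (b : B) :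
  gten GA GB (\sum_(i <- r | P i) F i) b = \sum_(i <- r | P i) gten GA GB (F i) b.
Proof. exact: (big_morph _ (fun x y => gtenDl GA GB x y b) (gten0l GA GB b)). Qed.

Lemma gten_sumr (a : A) (F : I -> B) :
  gten GA GB a (\sum_(i <- r | P i) F i) = \sum_(i <- r | P i) gten GA GB a (F i).
Proof. exact: (big_morph _ (gtenDr GA GB a) (gten0r GA GB a)). Qed.
End GtenSum.

Section TensorForms.
Variables (K : comNzRingType) (A B : lmodType K).

Lemma tforml_linear (phi : {scalar A}) : linear (@tforml K A B phi).
Proof.
apply: tlift_linear => [|k a b]; last by rewrite linearZ scalerA.
split=> [b a a'|a b b'|k a b]; rewrite ?linearD ?scalerDl ?scalerDr //.
by rewrite [phi (_ *: _)]linearZ /= scalerA mulrC.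
Qed.

Lemma tformlE (phi : {scalar A}) a b : tforml phi (tens a b) = phi a *: b :> B.
Proof.
apply: tliftE; split=> [b' a1 a2|a1 b1 b2|k a1 b1].
- by rewrite linearD scalerDl.
- by rewrite scalerDr.
- by rewrite [phi (_ *: _)]linearZ /= scalerA mulrC.
Qed.

Lemma tformr_linear (phi : {scalar B}) : linear (@tformr K A B phi).
Proof.
apply: tlift_linear => [|k a b]; last by rewrite !scalerA mulrC.
split=> [b a a'|a b b'|k a b]; rewrite ?linearD ?scalerDl ?scalerDr //.
by rewrite [phi (_ *: _)]linearZ /= scalerA mulrC.
Qed.

Lemma tformrE (phi : {scalar B}) a b : tformr phi (tens a b) = phi b *: a :> A.
Proof.
apply: tliftE; split=> [b' a1 a2|a1 b1 b2|k a1 b1].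
- by rewrite scalerDr.
- by rewrite linearD scalerDl.
- by rewrite [phi (_ *: _)]linearZ /= scalerA mulrC.
Qed.
End TensorForms.

Lemma triv_gtenM (K : comNzRingType) (A B : ualgebra K) (a a' : A) (b b' : B) :
  gten (triv_graded A) (triv_graded B) a b * gten _ _ a' b' =
  gten _ _ (a * a') (b * b').
Proof.
have h0 (C : ualgebra K) (x : C) : homog (triv_graded C) 0 x by [].
by rewrite (gtens_mulE _ _ (h0 _ b) (h0 _ a')) expr0 scale1r.
Qed.

Section ScalarForm.
Variables (K : comNzRingType) (A B : ualgebra K) (phi : {scalar B}).
Local Notation T := (gtens (triv_graded A) (triv_graded B)).

Let tformr_linear' : linear (@tformr K A B phi : T -> A).
Proof. exact: tformr_linear. Qed.
Definition uformr : {linear T -> A} := linear_of tformr_linear'.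

Lemma uformrE a b : uformr (gten _ _ a b) = phi b *: a.
Proof. exact: tformrE. Qed.
End ScalarForm.

Lemma poly_uaM (K : comNzRingType) (q r : poly_ua K) :
  q * r = ((q : {poly K}) * (r : {poly K}))%R :> {poly K}.
Proof. by []. Qed.

(* A grading is the same thing as a coaction [rho] of [K[X]]: the component of
   degree [p] of [x] is the coefficient of ['X^p] in [rho x]. *)
Section GradedOf.
Variables (K : comNzRingType) (X : Type) (A : ualgebra K).
Variables (gen : X -> A) (deg : X -> nat).
Hypothesis genA : generates gen.
Local Notation T := (gtens (triv_graded A) (triv_graded (poly_ua K))).
Local Notation "a ⊗ q" :=
  (gten (triv_graded A) (triv_graded (poly_ua K)) a q) (at level 40).
Variable rho : {linear A -> T}.
Hypothesis rho_hom : monoid_morphism rho.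
Hypothesis rho_gen : forall x, rho (gen x) = gen x ⊗ 'X^(deg x).

Variable cf : nat -> {linear T -> A}.
Hypothesis cfE : forall p a q, cf p (a ⊗ q) = (q : {poly K})`_p *: a.
Let pr p : {linear A -> A} := cf p \o rho.

Let cfM p (x y : T) : cf p (x * y) = \sum_(i < p.+1) cf i x * cf (p - i) y.
Proof.
elim/tens_ind: x => [|x x' IH IH'|a q].
- by rewrite mul0r linear0 big1 // => i _; rewrite linear0 mul0r.
- rewrite mulrDl linearD IH IH' -big_split; apply: eq_bigr => i _ /=.
  by rewrite linearD mulrDl.
elim/tens_ind: y => [|y y' IH IH'|b r].
- by rewrite mulr0 linear0 big1 // => i _; rewrite linear0 mulr0.
- rewrite mulrDr linearD IH IH' -big_split; apply: eq_bigr => i _ /=.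
  by rewrite linearD mulrDr.
rewrite -![tens _ _]/(_ ⊗ _) triv_gtenM cfE poly_uaM coefM.
rewrite scaler_suml; apply: eq_bigr => i _.
by rewrite !cfE -uscalerAl -uscalerAr scalerA.
Qed.

(** Coassociativity of the coaction, read off at one coefficient; it makes the components orthogonal
    idempotents. *)
Let rho_pr p x : rho (pr p x) = pr p x ⊗ 'X^p.
Proof.
move: x p; apply: genA => [x|p|k x IH p|x y IHx IHy p|x y IHx IHy p].
- move=> p; rewrite /pr /= rho_gen cfE coefXn.
  case: eqP => [->|_]; first by rewrite scale1r rho_gen.
  by rewrite scale0r linear0 gten0l.
- case: rho_hom => r1 _; rewrite /pr /= r1 (cfE p 1 1) coef1.
  by case: p => [|p]; rewrite ?scale1r ?r1 ?scale0r ?linear0 ?gten0l ?expr0.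
- by rewrite [pr p _]linearZ [rho _]linearZ IH gtenZl.
- by rewrite [pr p _]linearD [rho _]linearD IHx IHy gtenDl.
have -> : pr p (x * y) = \sum_(i < p.+1) pr i x * pr (p - i) y.
  by rewrite /pr /= (snd rho_hom) cfM.
rewrite [rho _]linear_sum gten_suml.
apply: eq_bigr => i _; rewrite (snd rho_hom) IHx IHy triv_gtenM.
by rewrite poly_uaM -exprD subnKC // -ltnS.
Qed.

(** Claimed for all large bounds, so that the bounds of two summands can be replaced by their
    maximum. *)
Let cf_sum (x : T) :
  exists N, forall M, (N <= M)%N -> x = \sum_(p < M) cf p x ⊗ 'X^p.
Proof.
elim/tens_ind: x => [|x y [N xN] [M yM]|a q].
- by exists 0%N => M _; rewrite big1 // => i _; rewrite linear0 gten0l.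
- exists (maxn N M) => L; rewrite geq_max => /andP[NL ML].
  rewrite {1}(xN L NL) {1}(yM L ML) -big_split; apply: eq_bigr => i _ /=.
  by rewrite linearD gtenDl.
exists (size q) => M leqM.
transitivity (a ⊗ (\sum_(i < M) q`_i *: 'X^i)).
  rewrite -poly_def; congr (_ ⊗ _); apply/polyP => i; rewrite coef_poly.
  by case: ltnP => // leMi; rewrite nth_default // (leq_trans leqM).
rewrite [LHS]gten_sumr.
by apply: eq_bigr => i _; rewrite -[tens a q]/(a ⊗ q) cfE gtenZl gtenZr.
Qed.

Variable e : {linear T -> A}.
Hypothesis eE : forall a q, e (a ⊗ q) = (q : {poly K}).[1] *: a.

(** The counit axiom of the coaction, with [e] the evaluation of polynomials at [1]: an element is
    the sum of its components. *)
Let e_rho x : e (rho x) = x.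
Proof.
case: rho_hom => r1 rM.
move: x; apply: genA => [x||k x xE|x y xE yE|x y xE yE].
- by rewrite rho_gen eE hornerXn expr1n scale1r.
- by rewrite r1 (eE 1 1) hornerC scale1r.
- by rewrite !linearZ /= xE.
- by rewrite !linearD xE yE.
rewrite rM; have eM (u v : T) : e (u * v) = e u * e v.
  elim/tens_ind: u => [|u u' IH IH'|a q]; first by rewrite mul0r linear0 mul0r.
    by rewrite mulrDl !linearD mulrDl IH IH'.
  elim/tens_ind: v => [|v v' IH IH'|b r]; first by rewrite mulr0 linear0 mulr0.
    by rewrite mulrDr !linearD mulrDr IH IH'.
  rewrite -![tens _ _]/(_ ⊗ _) triv_gtenM !eE.
  by rewrite poly_uaM hornerM -uscalerAl -uscalerAr scalerA.
by rewrite eM xE yE.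
Qed.

Lemma graded_of_forms : exists G : graded A, forall x, homog G (deg x) (gen x).
Proof.
case: rho_hom => r1 rM.
have pr_idem p q x : pr p (pr q x) = if p == q then pr q x else 0.
  rewrite {1}/pr /= rho_pr cfE coefXn; case: eqP => _; first exact: scale1r.
  exact: scale0r.
have pr_sum x : exists N, x = \sum_(p < N) pr p x.
  have [N /(_ N (leqnn N)) xN] := cf_sum (rho x); exists N.
  rewrite -{1}(e_rho x) xN linear_sum /=; apply: eq_bigr => i _.
  by rewrite eE hornerXn expr1n scale1r.
have pr_1 : pr 0 1 = 1 by rewrite /pr /= r1 (cfE 0 1 1) coef1 scale1r.
have pr_M p q x y : pr p x = x -> pr q y = y -> pr (p + q) (x * y) = x * y.
  move=> xp yq; rewrite /pr /= rM -xp -yq !rho_pr triv_gtenM cfE.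
  by rewrite poly_uaM -exprD coefXn eqxx scale1r.
exists (Graded pr_idem pr_sum pr_1 pr_M) => x.
by rewrite /homog /= rho_gen cfE coefXn eqxx scale1r.
Qed.
End GradedOf.

Lemma graded_of (K : comNzRingType) (X : Type) (A : ualgebra K) (gen : X -> A)
    (deg : X -> nat)
    (rho : {linear A -> gtens (triv_graded A) (triv_graded (poly_ua K))}) :
    generates gen -> monoid_morphism rho ->
    (forall x, rho (gen x) =
       gten (triv_graded A) (triv_graded (poly_ua K)) (gen x) 'X^(deg x)) ->
  exists G : graded A, forall x, homog G (deg x) (gen x).
Proof.
move=> genA rho_hom rho_gen.
pose coef p : {scalar poly_ua K} := coefp p.
pose ev1 : {scalar poly_ua K} := horner_eval 1.
apply: (graded_of_forms genA rho_hom rho_gen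
  (cf := fun p => uformr A (coef p)) _ (e := uformr A ev1)) => [p|] a q;
  exact: uformrE.
Qed.

Lemma linear_scale (K : comNzRingType) (U V : lmodType K) (f : {linear U -> V}) k x :
  f (k *: x) = k *: f x.
Proof. exact: linearZ. Qed.

Lemma signr_mul2 (K : comNzRingType) n : (-1) ^+ n * (-1) ^+ n = 1 :> K.
Proof. by rewrite -exprD addnn -signr_odd odd_double. Qed.

Section GradedMaps.
Variables (K : comNzRingType) (A B : ualgebra K) (GA : graded A) (GB : graded B).

Definition graded_hom (f : A -> B) : Prop :=
  forall p x, homog GA p x -> homog GB p (f x).

Definition graded_antihom (tau : {rmorphism K -> K}) (f : A -> B) : Prop :=
  [/\ {morph f : x y / x + y}, forall k x, f (k *: x) = tau k *: f x, f 1 = 1,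
      graded_hom f &
      forall p q x y, homog GA p x -> homog GA q y ->
        f (x * y) = (-1) ^+ (p * q) *: (f y * f x)].

Definition antiderivation (d : {linear A -> A}) : Prop :=
  (forall p x, homog GA p x -> homog GA p.+1 (d x)) /\
  (forall p x y, homog GA p x -> d (x * y) = d x * y + (-1) ^+ p *: (x * d y)).

Lemma antider1 d : antiderivation d -> d 1 = 0.
Proof.
case=> _ dM; have := dM 0 1 1 (homog1 GA); rewrite !mulr1 mul1r scale1r => d1.
by apply: (addIr (d 1)); rewrite add0r -d1.
Qed.

(** Differentiate [y * u = 1] and multiply by [u] on the left. *)
Lemma antider_inv d y u : antiderivation d -> homog GA 0 y -> homog GA 0 u ->
  y * u = 1 -> u * y = 1 -> d u = - (u * d y * u).
Proof.
move=> dA hy hu yu uy; have /eqP := antider1 dA.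
rewrite -yu (dA.2 _ _ _ hy) scale1r addrC addr_eq0 => /eqP ydu.
by rewrite -[d u]mul1r -uy -mulrA ydu mulrN mulrA.
Qed.

End GradedMaps.

Section Generated.
Variables (K : comNzRingType) (X : Type) (A : ualgebra K) (GA : graded A).
Variables (gen : X -> A) (deg : X -> nat).
Hypotheses (genA : generates gen) (hgen : forall x, homog GA (deg x) (gen x)).

Section Target.
Variables (B : ualgebra K) (GB : graded B).

(** Homogeneity is not preserved by sums of different degrees, so the induction shows instead that
    [f] commutes with every projection [gpr]. *)
Lemma graded_hom_gen (f : {linear A -> B}) :
    monoid_morphism f -> (forall x, homog GB (deg x) (f (gen x))) ->
  graded_hom GA GB f.
Proof.
move=> [f1 fM] fgen; suff fgpr x : forall p, gpr GB p (f x) = f (gpr GA p x).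
  by move=> p x xp; rewrite /homog fgpr xp.
move: x; apply: (homog_generated_ind genA hgen) => [p||x p|k x IH p|x y IHx IHy p|].
- by rewrite !linear0.
- move=> p; rewrite f1 (gpr_homog p (homog1 GB)) (gpr_homog p (homog1 GA)).
  by case: ifP; rewrite ?f1 ?linear0.
- rewrite (gpr_homog p (fgen x)) (gpr_homog p (hgen x)).
  by case: ifP => // _; rewrite linear0.
- by rewrite !linearZ IH.
- by rewrite !linearD IHx IHy.
move=> r s x y xr ys IHx IHy p.
have fxr : homog GB r (f x) by rewrite /homog IHx xr.
have fys : homog GB s (f y) by rewrite /homog IHy ys.
rewrite fM (gpr_homog p (homogM fxr fys)) (gpr_homog p (homogM xr ys)).
by case: ifP; rewrite ?fM ?linear0.
Qed.

Lemma graded_antihomP (tau : {rmorphism K -> K})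
    (f : {linear A -> gop tau GB}) :
    monoid_morphism f -> (forall x, homog GB (deg x) (f (gen x))) ->
  graded_antihom GA GB tau f.
Proof.
move=> [f1 fM] fgen.
have fD : {morph (f : A -> B) : x y / x + y} by move=> x y; apply: linearD.
have f0 : (f : A -> B) 0 = 0 by apply: additive0.
have fZ k x : (f : A -> B) (k *: x) = tau k *: (f x : B) 
    by exact: (linear_scale f k x).
have fgpr x : forall p, gpr GB p (f x) = (f : A -> B) (gpr GA p x).
  move: x; apply: (homog_generated_ind genA hgen) => [p||x p|k x IH p|x y IHx IHy p|].
  - by rewrite [gpr GA p 0]linear0 f0 linear0.
  - move=> p; rewrite [f 1]f1.
    rewrite [LHS](gpr_homog p (homog1 GB)) (gpr_homog p (homog1 GA)).
    by case: ifP => _; rewrite ?f0 ?[f 1]f1.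
  - rewrite (gpr_homog p (fgen x)) (gpr_homog p (hgen x)).
    by case: ifP => // _; rewrite f0.
  - by rewrite fZ [gpr GB p _]linearZ [gpr GA p _]linearZ /= fZ IH.
  - by rewrite fD [gpr GB p _]linearD [gpr GA p _]linearD /= fD IHx IHy.
  move=> r s x y xr ys IHx IHy p.
  have fxr : homog GB r (f x) by rewrite /homog IHx xr.
  have fys : homog GB s (f y) by rewrite /homog IHy ys.
  have fxy : f (x * y) = (-1) ^+ (r * s) *: ((f y : B) * (f x : B)) :> B.
    by rewrite -(gop_mulE tau fxr fys) -fM.
  rewrite fxy linearZ /= (gpr_homog p (homogM fys fxr)).
  rewrite (gpr_homog p (homogM xr ys)) [(r + s)%N]addnC.
  by case: ifP => _; rewrite ?fxy ?f0 ?scaler0.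
have fh : graded_hom GA GB f by move=> p x xp; rewrite /homog fgpr xp.
split=> // p q x y xp yq.
by rewrite -(gop_mulE tau (fh _ _ xp) (fh _ _ yq)) -fM.
Qed.

Lemma hom_antider (f : {linear A -> B}) dA dB :
    monoid_morphism f -> graded_hom GA GB f ->
    antiderivation GA dA -> antiderivation GB dB ->
    (forall x, f (dA (gen x)) = dB (f (gen x))) ->
  forall x, f (dA x) = dB (f x).
Proof.
move=> [f1 fM] fh dAA dBB fgen.
apply: (homog_generated_ind genA hgen) => [|||k x IH|x y IHx IHy|].
- by rewrite !linear0.
- by rewrite f1 (antider1 dAA) (antider1 dBB) linear0.
- exact: fgen.
- by rewrite !linearZ /= IH.
- by rewrite !linearD /= IHx IHy.
move=> p q x y xp yq IHx IHy.
rewrite (dAA.2 _ _ _ xp) fM (dBB.2 _ _ _ (fh _ _ xp)) linearD linearZ /=.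
by rewrite !fM IHx IHy.
Qed.

(** Reversing a product moves the Leibniz sign from one factor to the other; the sign of the
    anti-homomorphism compensates for this exactly. *)
Lemma antihom_antider tau (f : A -> B) dA dB :
    graded_antihom GA GB tau f ->
    antiderivation GA dA -> antiderivation GB dB ->
    (forall x, f (dA (gen x)) = dB (f (gen x))) ->
  forall x, f (dA x) = dB (f x).
Proof.
move=> [fD fZ f1 fh fM] dAA dBB fgen.
have f0 : f 0 = 0 by apply: additive0.
apply: (homog_generated_ind genA hgen) => [|||k x IH|x y IHx IHy|].
- by rewrite linear0 f0 linear0.
- by rewrite f1 (antider1 dAA) (antider1 dBB).
- exact: fgen.
- by rewrite linearZ /= !fZ linearZ /= IH.
- by rewrite linearD /= !fD linearD /= IHx IHy.
move=> p q x y xp yq IHx IHy.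
have dxp := dAA.1 _ _ xp; have dyq := dAA.1 _ _ yq.
rewrite (dAA.2 _ _ _ xp) fD fZ (fM _ _ _ _ dxp yq) (fM _ _ _ _ xp dyq).
rewrite (fM _ _ _ _ xp yq) [dB _]linearZ /= (dBB.2 _ _ _ (fh _ _ yq)) IHx IHy.
rewrite scalerDr !scalerA rmorphXn rmorphN1 -!exprD addrC mulSn mulnS addnA.
congr (_ *: _ + _ *: _); last by rewrite addnC.
apply: signr_parity; rewrite !(oddD, oddM); by case: (odd p); case: (odd q).
Qed.

End Target.

(** The first entry of [h] is the identity because it is so on generators; multiplicativity of [h]
    is then the Leibniz rule for the second entry. *)
Lemma antider_of (h : {linear A -> tri GA}) (dg : X -> A) :
    monoid_morphism h -> (forall x, h (gen x) = tr GA (gen x) (dg x)) ->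
    (forall x, homog GA (deg x).+1 (dg x)) ->
  exists2 d : {linear A -> A}, antiderivation GA d &
    (forall x, h x = tr GA x (d x)).
Proof.
move=> [h1 hM] hgn dgh; pose d0 (x : A) : A := (h x).2.
have d_lin : linear d0 by move=> k x y; rewrite /d0 linearP.
have hE x : h x = tr GA x (d0 x).
  rewrite /d0 [LHS]surjective_pairing; congr (tr GA _ _).
  move: x; apply: genA => [x||k x xE|x y xE yE|x y xE yE].
  - by rewrite hgn.
  - by rewrite h1.
  - by rewrite linearZ -[in RHS]xE.
  - by rewrite linearD -[in RHS]xE -[in RHS]yE.
  - by rewrite hM -[in RHS]xE -[in RHS]yE.
have d0M p x y : homog GA p x -> d0 (x * y) = d0 x * y + (-1) ^+ p *: (x * d0 y).
  move=> xp; rewrite {1}/d0 hM !hE trM /= (gsgn_homog xp).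
  by rewrite -uscalerAl.
have d01 : d0 1 = 0 by rewrite /d0 h1.
pose d := linear_of d_lin; have dE x : d x = d0 x by [].
have dgpr x : forall p, gpr GA p.+1 (d x) = d (gpr GA p x).
  move: x; apply: (homog_generated_ind genA hgen) => [p||x p|k x IH p|x y IHx IHy p|].
  - by rewrite !linear0.
  - move=> p; rewrite (gpr_homog p (homog1 GA)).
    by case: ifP => _; rewrite ?linear0 dE d01 ?linear0.
  - have -> : d (gen x) = dg x by rewrite dE /d0 hgn.
    rewrite (gpr_homog p.+1 (dgh x)) (gpr_homog p (hgen x)) eqSS.
    by case: ifP => _; rewrite ?linear0 // dE /d0 hgn.
  - by rewrite !linearZ IH.
  - by rewrite !linearD IHx IHy.
  move=> r s x y xr ys IHx IHy p.
  have dxr : homog GA r.+1 (d x) by rewrite /homog IHx xr.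
  have dys : homog GA s.+1 (d y) by rewrite /homog IHy ys.
  have dxy : homog GA (r + s).+1 (d (x * y)).
    rewrite dE (d0M _ _ _ xr); apply: homogD; first exact: homogM dxr ys.
    by apply: homogZ; rewrite -addnS; apply: homogM xr dys.
  rewrite (gpr_homog _ dxy) (gpr_homog _ (homogM xr ys)) eqSS.
  by case: ifP => // _; rewrite linear0.
exists d => [|x]; last by rewrite hE.
split=> [p x xp|p x y xp]; first by rewrite /homog dgpr xp.
by rewrite !dE; apply: d0M.
Qed.

Lemma antider_sq d : antiderivation GA d ->
  (forall x, d (d (gen x)) = 0) -> forall x, d (d x) = 0.
Proof.
move=> dA ddgen; have [dh dM] := dA.
apply: (homog_generated_ind genA hgen) => [||//|k x xE|x y xE yE|].
- by rewrite !linear0.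
- by rewrite (antider1 dA) linear0.
- by rewrite !linearZ /= xE scaler0.
- by rewrite !linearD /= xE yE addr0.
move=> p q x y xp yq xE yE; rewrite (dM _ _ _ xp) [d (_ + _)]linearD.
rewrite [d (_ *: _)]linearZ /= (dM _ _ _ (dh _ _ xp)) (dM _ _ _ xp) xE yE.
by rewrite mul0r mulr0 scaler0 addr0 add0r exprS mulN1r scaleNr addNr.
Qed.

Lemma gida_of (cj : {rmorphism K -> K}) (f : A -> A) (d : {linear A -> A}) :
    involutive cj -> graded_antihom GA GA cj f ->
    (forall x, f (f (gen x)) = gen x) ->
    antiderivation GA d -> (forall x, d (d (gen x)) = 0) ->
    (forall x, f (d (gen x)) = d (f (gen x))) ->
  exists G : gida cj A, [/\ gida_gr G = GA, bar G = f & dif G = d].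
Proof.
move=> cjK fA ffgen dA ddgen fdgen.
have [fD fZ f1 fh fM] := fA; have [dh dM] := dA.
have fK : involutive f.
  apply: (homog_generated_ind genA hgen) => [||//|k x xE|x y xE yE|].
  - by rewrite !(additive0 fD).
  - by rewrite !f1.
  - by rewrite !fZ cjK xE.
  - by rewrite !fD xE yE.
  move=> p q x y xp yq xE yE; rewrite (fM _ _ _ _ xp yq) fZ.
  rewrite (fM _ _ _ _ (fh _ _ yq) (fh _ _ xp)) xE yE scalerA.
  by rewrite rmorphXn rmorphN1 mulnC signr_mul2 scale1r.
have fd x : d (f x) = f (d x) by rewrite (antihom_antider fA dA dA fdgen).
have dd := antider_sq dA ddgen.
by exists (Gida fD fZ fK fh fM dh dM dd fd).
Qed.

End Generated.

(** * Hopf algebra axioms on generators *)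

Lemma alg_hom_ext (K : comNzRingType) (X : Type) (A B : ualgebra K)
    (gen : X -> A) (f g : A -> B) :
    generates gen -> linear f -> monoid_morphism f ->
    linear g -> monoid_morphism g -> (forall x, f (gen x) = g (gen x)) ->
  f =1 g.
Proof.
move=> genA f_lin f_hom g_lin g_hom fg.
exact: (hom_ext (f := linear_of f_lin) (g := linear_of g_lin) genA).
Qed.

Lemma homog_gten (K : comNzRingType) (A B : ualgebra K) (GA : graded A)
    (GB : graded B) p q a b : homog GA p a -> homog GB q b ->
  homog (tgraded GA GB) (p + q) (gten GA GB a b).
Proof. by move=> ap bq; rewrite /homog /= (tgpr_homog _ ap bq) eqxx. Qed.

(** * Homomorphisms between graded tensor products *)

Section TensorHoms.
Variable K : comNzRingType.

Lemma tmap_graded_hom (A A' B B' : ualgebra K)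
    (GA : graded A) (GA' : graded A') (GB : graded B) (GB' : graded B')
    (f : {linear A -> A'}) (g : {linear B -> B'}) :
    monoid_morphism f -> monoid_morphism g ->
    graded_hom GA GA' f -> graded_hom GB GB' g ->
  monoid_morphism (tmap f g : gtens GA GB -> gtens GA' GB').
Proof.
move=> [f1 fM] [g1 gM] fh gh.
have F_lin : linear (tmap f g : gtens GA GB -> gtens GA' GB') by apply: tmap_linear.
pose F := linear_of F_lin; suff [F1 FM] : monoid_morphism F by [].
have FE a b : F (gten GA GB a b) = gten GA' GB' (f a) (g b) by apply: tmapE.
clearbody F; split; first by rewrite [LHS]FE f1 g1.
move=> x y; elim/gten_ind: x => [|x x' IH IH'|p q a b ap bq].
- by rewrite mul0r linear0 mul0r.
- by rewrite mulrDl !linearD mulrDl IH IH'.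
elim/gten_ind: y => [|y y' IH IH'|r s a' b' ar bs].
- by rewrite mulr0 linear0 mulr0.
- by rewrite mulrDr !linearD mulrDr IH IH'.
rewrite (gtens_mulE _ _ bq ar) linearZ /= !FE.
by rewrite (gtens_mulE _ _ (gh _ _ bq) (fh _ _ ar)) fM gM.
Qed.

Section Assoc.
Variables (A B C : ualgebra K) (GA : graded A) (GB : graded B) (GC : graded C).
Local Notation T1 := (gtens (tgraded GA GB) GC).
Local Notation T2 := (gtens GA (tgraded GB GC)).

Let assoc0 (c : C) (a : A) (b : B) : tensor A (tensor B C) := tens a (tens b c).
Let assoc0_balanced c : balanced (assoc0 c).
Proof.
split=> [b a a'|a b b'|k a b]; rewrite /assoc0 ?tens_Dl ?tens_Dr //.
by rewrite !tens_Zl tens_Zr.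
Qed.

Let assoc1_balanced : balanced (fun x c => tlift (assoc0 c) x).
Proof.
split=> [c x x'|x c c'|k x c]; first exact: (tliftD (assoc0_balanced c)).
- elim/tens_ind: x => [|x x' IH IH'|a b].
  + by rewrite !(tlift0 (assoc0_balanced _)) addr0.
  + by rewrite !(tliftD (assoc0_balanced _)) IH IH' addrACA.
  by rewrite !(tliftE (assoc0_balanced _)) /assoc0 !tens_Dr.
elim/tens_ind: x => [|x x' IH IH'|a b].
- by rewrite scaler0 !(tlift0 (assoc0_balanced _)).
- by rewrite scalerDr !(tliftD (assoc0_balanced _)) IH IH'.
by rewrite -tens_Zl !(tliftE (assoc0_balanced _)) /assoc0 tens_Zl !tens_Zr.
Qed.

Lemma tassocE (a : A) (b : B) (c : C) :
  tassoc (tens (tens a b) c) = tens a (tens b c).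
Proof.
by rewrite /tassoc (tliftE assoc1_balanced) (tliftE (assoc0_balanced c)).
Qed.

Lemma tassoc_linear : linear (tassoc : tensor (tensor A B) C -> _).
Proof.
apply: (tlift_linear assoc1_balanced) => k x c.
elim/tens_ind: x => [|x x' IH IH'|a b].
- by rewrite scaler0 !(tlift0 (assoc0_balanced _)) scaler0.
- by rewrite scalerDr !(tliftD (assoc0_balanced _)) IH IH' scalerDr.
by rewrite -tens_Zl !(tliftE (assoc0_balanced _)) /assoc0 tens_Zl.
Qed.

(** On homogeneous pure tensors both bracketings collect the sign of moving [a'] past [b] and [c],
    and [b'] past [c]. *)
Lemma tassoc_hom : monoid_morphism (tassoc : T1 -> T2).
Proof.
pose F : {linear T1 -> T2} := linear_of (tassoc_linear : linear (tassoc : T1 -> T2)).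
suff [F1 FM] : monoid_morphism F by [].
have FE a b c : F (gten (tgraded GA GB) GC (gten GA GB a b) c) =
    gten GA (tgraded GB GC) a (gten GB GC b c) by apply: tassocE.
clearbody F; split; first exact: (FE 1 1 1).
have ind (P : T1 -> Prop) : P 0 -> (forall x y, P x -> P y -> P (x + y)) ->
    (forall p q r a b c, homog GA p a -> homog GB q b -> homog GC r c ->
      P (gten (tgraded GA GB) GC (gten GA GB a b) c)) -> forall x, P x.
  move=> P0 PD Pg; elim/gten_ind => // p r z c zp cr.
  move: z zp; apply: thomog_ind => [|z z' Pz Pz'|r' s a b ar bs _].
  - by rewrite gten0l.
  - by rewrite gtenDl; apply: PD.
  - exact: Pg ar bs cr.
move=> x y; elim/ind: x => [|x x' IH IH'|p q r a b c ap bq cr].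
- by rewrite mul0r linear0 mul0r.
- by rewrite mulrDl !linearD mulrDl IH IH'.
elim/ind: y => [|y y' IH IH'|p' q' r' a' b' c' ap' bq' cr'].
- by rewrite mulr0 linear0 mulr0.
- by rewrite mulrDr !linearD mulrDr IH IH'.
rewrite (gtens_mulE _ _ cr (homog_gten ap' bq')).
rewrite (gtens_mulE _ _ bq ap') gtenZl scalerA linearZ /= !FE.
rewrite (gtens_mulE _ _ (homog_gten bq cr) ap').
rewrite (gtens_mulE _ _ cr bq') gtenZr scalerA -!exprD.
by congr (_ ^+ _ *: _); rewrite mulnDr mulnDl addnAC [(q * _ + _)%N]addnC.
Qed.
End Assoc.

Section Forms.
Variables (A B : ualgebra K) (GA : graded A) (GB : graded B).
Local Notation T := (gtens GA GB).

(** The Koszul sign is harmless: either [a'] has degree [0], or [phi] kills it and both sides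
    vanish. *)
Lemma tforml_hom (phi : {scalar A}) : monoid_morphism phi ->
    (forall p x, homog GA p.+1 x -> phi x = 0) ->
  monoid_morphism (tforml phi : T -> B).
Proof.
move=> [phi1 phiM] phi0.
have F_lin : linear (tforml phi : T -> B) by apply: tforml_linear.
pose F := linear_of F_lin.
suff [F1 FM] : monoid_morphism F by [].
have FE a b : F (gten GA GB a b) = phi a *: b by apply: tformlE.
clearbody F; split; first by rewrite [LHS]FE phi1 scale1r.
move=> x y; elim/gten_ind: x => [|x x' IH IH'|p q a b ap bq].
- by rewrite mul0r linear0 mul0r.
- by rewrite mulrDl !linearD mulrDl IH IH'.
elim/gten_ind: y => [|y y' IH IH'|r s a' b' ar bs].
- by rewrite mulr0 linear0 mulr0.
- by rewrite mulrDr !linearD mulrDr IH IH'.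
rewrite (gtens_mulE _ _ bq ar) linearZ /= !FE phiM.
rewrite -uscalerAl -uscalerAr !scalerA; case: r ar => [|r] ar.
  by rewrite muln0 mul1r.
by rewrite (phi0 _ _ ar) !mulr0 !scale0r.
Qed.

Lemma tformr_hom (phi : {scalar B}) : monoid_morphism phi ->
    (forall p x, homog GB p.+1 x -> phi x = 0) ->
  monoid_morphism (tformr phi : T -> A).
Proof.
move=> [phi1 phiM] phi0.
have F_lin : linear (tformr phi : T -> A) by apply: tformr_linear.
pose F := linear_of F_lin.
suff [F1 FM] : monoid_morphism F by [].
have FE a b : F (gten GA GB a b) = phi b *: a by apply: tformrE.
clearbody F; split; first by rewrite [LHS]FE phi1 scale1r.
move=> x y; elim/gten_ind: x => [|x x' IH IH'|p q a b ap bq].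
- by rewrite mul0r linear0 mul0r.
- by rewrite mulrDl !linearD mulrDl IH IH'.
elim/gten_ind: y => [|y y' IH IH'|r s a' b' ar bs].
- by rewrite mulr0 linear0 mulr0.
- by rewrite mulrDr !linearD mulrDr IH IH'.
rewrite (gtens_mulE _ _ bq ar) linearZ /= !FE phiM.
rewrite -uscalerAl -uscalerAr !scalerA; case: q bq => [|q] bq.
  by rewrite mul0n mul1r.
by rewrite (phi0 _ _ bq) !(mul0r, mulr0) !scale0r.
Qed.
End Forms.

Lemma comp_hom (A B C : ualgebra K) (f : B -> C) (g : A -> B) :
  monoid_morphism f -> monoid_morphism g -> monoid_morphism (f \o g).
Proof. by move=> [f1 fM] [g1 gM]; split=> [|x y] /=; rewrite ?g1 ?gM. Qed.

Lemma comp_linear (U V W : lmodType K) (f : V -> W) (g : U -> V) :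
  linear f -> linear g -> linear (f \o g).
Proof. by move=> fL gL k x y; rewrite /= gL fL. Qed.

End TensorHoms.

(** * Coassociativity, counit and antipode axioms from generators *)

Section Comodule.
Variables (K : comNzRingType) (X Y : Type) (A B : ualgebra K).
Variables (GA : graded A) (GB : graded B) (genB : Y -> B).
Hypothesis genB_gen : generates genB.
Variables (Delta : {linear A -> gtens GA GA}) (eps : {scalar A}).
Variable delta : {linear B -> gtens GA GB}.
Hypotheses (Delta_hom : monoid_morphism Delta)
  (Delta_gr : graded_hom GA (tgraded GA GA) Delta).
Hypotheses (eps_hom : monoid_morphism eps)
  (eps_pos : forall p x, homog GA p.+1 x -> eps x = 0).
Hypotheses (delta_hom : monoid_morphism delta)
  (delta_gr : graded_hom GB (tgraded GA GB) delta).

(** Both sides are algebra homomorphisms in [x]. Stated for a comodule, so that [delta := Delta]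
    also gives coassociativity of the coproduct. *)
Lemma coaction_assoc :
    (forall x, tassoc (tmap Delta idfun (delta (genB x))) =
       tmap idfun delta (delta (genB x))) ->
  forall x, tassoc (tmap Delta idfun (delta x)) = tmap idfun delta (delta x).
Proof.
move=> gens; pose T := gtens GA (tgraded GA GB).
have id_gr (C : ualgebra K) (G : graded C) : graded_hom G G idfun by [].
pose T1 := gtens (tgraded GA GA) GB.
have l1 : linear (tmap Delta idfun : gtens GA GB -> T1) by apply: tmap_linear.
have l2 : linear (tassoc : T1 -> T) by apply: tassoc_linear.
have l3 : linear (tmap idfun delta : gtens GA GB -> T) by apply: tmap_linear.
have m1 : monoid_morphism (tmap Delta idfun : gtens GA GB -> T1).
  exact: tmap_graded_hom.
have m2 : monoid_morphism (tassoc : T1 -> T) by apply: tassoc_hom.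
have m3 : monoid_morphism (tmap idfun delta : gtens GA GB -> T).
  exact: tmap_graded_hom.
have dl : linear delta by move=> k x y; apply: linearP.
exact: (alg_hom_ext (A := B) (B := T) genB_gen
  (comp_linear l2 (comp_linear l1 dl)) (comp_hom m2 (comp_hom m1 delta_hom))
  (comp_linear l3 dl) (comp_hom m3 delta_hom)).
Qed.

Lemma coaction_counit : (forall x, tforml eps (delta (genB x)) = genB x) ->
  forall x, tforml eps (delta x) = x.
Proof.
move=> gens; have l1 : linear (tforml eps : gtens GA GB -> B) by apply: tforml_linear.
have m1 : monoid_morphism (tforml eps : gtens GA GB -> B) by apply: tforml_hom.
have dl : linear delta by move=> k x y; apply: linearP.
exact: (alg_hom_ext (g := idfun) genB_gen (comp_linear l1 dl)
  (comp_hom m1 delta_hom)).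
Qed.

End Comodule.


Section Tmult.
Variables (K : comNzRingType) (A : ualgebra K).

Let mul_balanced : balanced (fun x y : A => x * y).
Proof.
split=> [y x x'|x y y'|k x y]; [exact: mulrDl|exact: mulrDr|].
by rewrite -uscalerAl -uscalerAr.
Qed.

Lemma tmult_linear : linear (@tmult K A).
Proof. by apply: (tlift_linear mul_balanced) => k x y; rewrite uscalerAl. Qed.

Lemma tmultE (a b : A) : tmult (tens a b) = a * b.
Proof. exact: (tliftE mul_balanced). Qed.
End Tmult.

Section Antipode.
Variables (K : comNzRingType) (X : Type) (A : ualgebra K) (G : graded A).
Variables (gen : X -> A) (deg : X -> nat).
Hypotheses (genA : generates gen) (hgen : forall x, homog G (deg x) (gen x)).
Variables (Delta : {linear A -> gtens G G}) (eps : {scalar A}).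
Hypotheses (Delta_hom : monoid_morphism Delta)
  (Delta_gr : graded_hom G (tgraded G G) Delta).
Hypothesis eps_hom : monoid_morphism eps.

(** The induction proves [eps x = eps (gpr G 0 x)], which, unlike vanishing in positive degree,
    makes sense for every element. *)
Lemma counit_pos : (forall x, (0 < deg x)%N -> eps (gen x) = 0) ->
  forall p x, homog G p.+1 x -> eps x = 0.
Proof.
move=> epos; case: eps_hom => e1 eM; suff e0 x : eps x = eps (gpr G 0 x).
  by move=> p x xp; rewrite e0 (gpr_homog 0 xp) linear0.
move: x; apply: (homog_generated_ind genA hgen) => [||x|k x IH|x y IHx IHy|].
- by rewrite !linear0.
- by rewrite (gpr_homog 0 (homog1 G)).
- rewrite (gpr_homog 0 (hgen x)); case: ifP => // d0.
  by rewrite epos ?linear0 // lt0n eq_sym d0.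
- by rewrite !linearZ /= IH.
- by rewrite !linearD /= IHx IHy.
move=> p q x y xp yq IHx IHy; rewrite (gpr_homog 0 (homogM xp yq)).
rewrite eM IHx IHy (gpr_homog 0 xp) (gpr_homog 0 yq).
by case: p q {xp yq} => [|p] [|q] //=; rewrite !linear0 ?mul0r ?mulr0 ?eM.
Qed.

Hypothesis eps_pos : forall p x, homog G p.+1 x -> eps x = 0.
Variable S : {linear A -> A}.
Hypothesis S_anti : graded_antihom G G idfun S.

(** The map [L] that applies [S] to the first factor and multiplies is not a homomorphism. But by
    [LM], multiplying [x] by [a ⊗ b] on the right encloses [L x] between [S a] and [b]; when
    [L (Delta x)] is a scalar it can be pulled out, so the axiom is stable under products. *)
Lemma antipode_left :
    (forall x, tmult (tmap S idfun (Delta (gen x))) = eps (gen x) *: (1 : A)) ->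
  forall x, tmult (tmap S idfun (Delta x)) = eps x *: (1 : A).
Proof.
have L_lin : linear (@tmult K A \o tmap S idfun : gtens G G -> A).
  by apply: comp_linear (@tmult_linear K A) _; apply: tmap_linear.
pose L := linear_of L_lin; rewrite -[forall x : A, _]/(forall x, L (Delta x) = _).
rewrite -[forall x : X, _]/(forall x, L (Delta (gen x)) = _).
have LE a b : L (gten G G a b) = S a * b by rewrite /L /= tmapE tmultE.
clearbody L => gens; case: S_anti => SD SZ S1 Sgr SM.
case: Delta_hom => D1 DM; case: eps_hom => e1 eM.
have LM p x q a b : homog (tgraded G G) p x -> homog G q a ->
    L (x * gten G G a b) = (-1) ^+ (p * q) *: (S a * L x * b).
  move=> xp aq; move: x xp; apply: thomog_ind => [|x x' IH IH'|r s c e cr es <-].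
  - by rewrite mul0r !linear0 mulr0 mul0r scaler0.
  - by rewrite mulrDl !linearD mulrDr mulrDl scalerDr IH IH'.
  rewrite (gtens_mulE _ _ es aq) linearZ /= !LE (SM _ _ _ _ cr aq) -uscalerAl.
  by rewrite scalerA -exprD -mulnDl addnC !mulrA.
apply: (homog_generated_ind genA hgen) => [|||k x IH|x y IHx IHy|] //.
- by rewrite !linear0 scale0r.
- by rewrite D1 (LE 1 1) S1 e1 scale1r mulr1.
- by rewrite !linearZ /= IH scalerA.
- by rewrite !linearD /= IHx IHy scalerDl.
move=> p q x y xp yq IHx IHy; rewrite DM eM.
have -> : L (Delta x * Delta y) = eps x *: L (Delta y); last first.
  by rewrite IHy scalerA.
elim/gten_ind: (Delta y) => [|u v IHu IHv|r s a b ar _].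
- by rewrite mulr0 !linear0 ?scaler0.
- by rewrite mulrDr !linearD ?scalerDr IHu IHv.
rewrite (LM p _ r) //; last exact: Delta_gr.
rewrite IHx LE -uscalerAr mulr1 -uscalerAl scalerA.
(* The sign left over is trivial for [p = 0] and multiplies [eps x = 0] otherwise. *)
case: p xp => [|p] xp; first by rewrite mul0n mul1r.
by rewrite (eps_pos xp) mulr0.
Qed.

Lemma antipode_right :
    (forall x, tmult (tmap idfun S (Delta (gen x))) = eps (gen x) *: (1 : A)) ->
  forall x, tmult (tmap idfun S (Delta x)) = eps x *: (1 : A).
Proof.
have L_lin : linear (@tmult K A \o tmap idfun S : gtens G G -> A).
  by apply: comp_linear (@tmult_linear K A) _; apply: tmap_linear.
pose L := linear_of L_lin; rewrite -[forall x : A, _]/(forall x, L (Delta x) = _).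
rewrite -[forall x : X, _]/(forall x, L (Delta (gen x)) = _).
have LE a b : L (gten G G a b) = a * S b by rewrite /L /= tmapE tmultE.
clearbody L => gens; case: S_anti => SD SZ S1 Sgr SM.
case: Delta_hom => D1 DM; case: eps_hom => e1 eM.
have LM p x q a b : homog (tgraded G G) p x -> homog G q b ->
    L (gten G G a b * x) = (-1) ^+ (p * q) *: (a * L x * S b).
  move=> xp bq; move: x xp; apply: thomog_ind => [|x x' IH IH'|r s c e cr es <-].
  - by rewrite mulr0 !linear0 mulr0 mul0r scaler0.
  - by rewrite mulrDr !linearD mulrDr mulrDl scalerDr IH IH'.
  rewrite (gtens_mulE _ _ bq cr) linearZ /= !LE (SM _ _ _ _ bq es) -uscalerAr.
  by rewrite scalerA -exprD -mulnDr mulnC !mulrA.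
apply: (homog_generated_ind genA hgen) => [|||k x IH|x y IHx IHy|] //.
- by rewrite !linear0 scale0r.
- by rewrite D1 (LE 1 1) S1 e1 scale1r mulr1.
- by rewrite !linearZ /= IH scalerA.
- by rewrite !linearD /= IHx IHy scalerDl.
move=> p q x y xp yq IHx IHy; rewrite DM eM.
have -> : L (Delta x * Delta y) = eps y *: L (Delta x); last first.
  by rewrite IHx scalerA mulrC.
elim/gten_ind: (Delta x) => [|u v IHu IHv|r s a b _ bs].
- by rewrite mul0r !linear0 ?scaler0.
- by rewrite mulrDl !linearD ?scalerDr IHu IHv.
rewrite (LM q _ s) //; last exact: Delta_gr.
rewrite IHy LE -uscalerAr mulr1 -uscalerAl scalerA.
case: q yq => [|q] yq; first by rewrite mul0n mul1r.
by rewrite (eps_pos yq) mulr0.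
Qed.

End Antipode.

Section GidaMaps.
Variables (K : comNzRingType) (cj : {rmorphism K -> K}).
Variables (A : ualgebra K) (GA : gida cj A).

Lemma gida_bar_antihom : graded_antihom GA GA cj (bar GA).
Proof.
split; [exact: barD|exact: barZ| |exact: bar_homog|exact: barM].
(* That [bar] fixes [1] is not an axiom; it results from expanding [bar (1 * bar 1)]. *)
have := barM (homog1 GA) (homog_gpr GA 0 (bar GA 1)).
have b1 : homog GA 0 (bar GA 1) by apply/bar_homog/homog1.
by rewrite b1 mul1r barK scale1r mul1r.
Qed.

Lemma gida_dif_antider : antiderivation GA (dif GA).
Proof. by split; [exact: dif_homog|exact: difM]. Qed.

End GidaMaps.

Section GidaHom.
Variables (K : comNzRingType) (cj : {rmorphism K -> K}).
Variables (X : Type) (A B : ualgebra K) (GA : gida cj A) (GB : gida cj B).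
Variables (gen : X -> A) (deg : X -> nat).
Hypotheses (genA : generates gen) (hgen : forall x, homog GA (deg x) (gen x)).

Lemma gida_hom_of (f : {linear A -> B}) :
    monoid_morphism f -> (forall x, homog GB (deg x) (f (gen x))) ->
    (forall x, f (bar GA (gen x)) = bar GB (f (gen x))) ->
    (forall x, f (dif GA (gen x)) = dif GB (f (gen x))) ->
  gida_hom GA GB f.
Proof.
move=> f_hom fh fbar fdif; have f_gr := graded_hom_gen genA hgen f_hom fh.
split=> // x; last first.
  exact: (hom_antider genA hgen _ _ (gida_dif_antider GA) (gida_dif_antider GB)).
case: f_hom => f1 fM; have [_ _ b1 _ _] := gida_bar_antihom GA.
have [_ _ b1' _ _] := gida_bar_antihom GB.
move: x; apply: (homog_generated_ind genA hgen) => [|||k x IH|x y IHx IHy|].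
- by rewrite bar0 !linear0 bar0.
- by rewrite b1 f1 b1'.
- exact: fbar.
- by rewrite barZ !linearZ /= barZ IH.
- by rewrite barD !linearD barD IHx IHy.
move=> p q x y xp yq IHx IHy.
by rewrite (barM xp yq) linearZ /= !fM (barM (f_gr _ _ xp) (f_gr _ _ yq)) IHx IHy.
Qed.
End GidaHom.

Section GidaHopf.
Variables (K : comNzRingType) (cj : {rmorphism K -> K}).
Variables (X : Type) (A : ualgebra K) (G : gida cj A).
Variables (gen : X -> A) (deg : X -> nat).
Hypotheses (genA : generates gen) (hgen : forall x, homog G (deg x) (gen x)).
Variables (Delta : {linear A -> gtens G G}) (eps : {scalar A}) (S : {linear A -> A}).

Lemma gida_hopf_of :
    gida_hom G (tgida G G) Delta ->
    monoid_morphism eps -> (forall x, (0 < deg x)%N -> eps (gen x) = 0) ->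
    (forall x, eps (bar G (gen x)) = cj (eps (gen x))) ->
    graded_antihom G G idfun S ->
    (forall x, S (dif G (gen x)) = dif G (S (gen x))) ->
    (forall x, tassoc (tmap Delta idfun (Delta (gen x))) =
       tmap idfun Delta (Delta (gen x))) ->
    (forall x, tforml eps (Delta (gen x)) = gen x /\
       tformr eps (Delta (gen x)) = gen x) ->
    (forall x, tmult (tmap S idfun (Delta (gen x))) = eps (gen x) *: (1 : A) /\
       tmult (tmap idfun S (Delta (gen x))) = eps (gen x) *: (1 : A)) ->
  gida_hopf Delta eps S.
Proof.
move=> D_gida e_hom e_gen e_bar S_anti S_dif D_assoc D_counit S_inv.
have [D_hom D_gr _ _] := D_gida; have e_pos := counit_pos genA hgen e_hom e_gen.
split=> //; first split=> //.
- by apply: (coaction_assoc genA).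
- have cl y : tforml eps (Delta (gen y)) = gen y by case: (D_counit y).
  have cr y : tformr eps (Delta (gen y)) = gen y by case: (D_counit y).
  move=> x; split; first by apply: (coaction_counit genA).
  have l1 : linear (tformr eps : gtens G G -> A) by apply: tformr_linear.
  have m1 : monoid_morphism (tformr eps : gtens G G -> A) by apply: tformr_hom.
  have dl : linear Delta by move=> k u v; apply: linearP.
  have m2 : monoid_morphism (tformr eps \o Delta) by apply: comp_hom.
  have l2 : linear (tformr eps \o Delta) by apply: comp_linear.
  exact: (alg_hom_ext (g := idfun) genA l2 m2).
- have sl y : tmult (tmap S idfun (Delta (gen y))) = eps (gen y) *: (1 : A).
    by case: (S_inv y).
  have sr y : tmult (tmap idfun S (Delta (gen y))) = eps (gen y) *: (1 : A).
    by case: (S_inv y).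
  split=> [|x]; first by case: S_anti.
  by split; [apply: (antipode_left genA hgen)|apply: (antipode_right genA hgen)].
- case: e_hom => e1 eM; have [_ _ b1 _ _] := gida_bar_antihom G.
  apply: (homog_generated_ind genA hgen) => [|||k x IH|x y IHx IHy|] //.
  + by rewrite bar0 linear0 rmorph0.
  + by rewrite b1 e1 rmorph1.
  + by rewrite barZ !linearZ /= IH rmorphM.
  + by rewrite barD !linearD /= IHx IHy rmorphD.
  move=> p q x y xp yq IHx IHy; rewrite (barM xp yq) linearZ /= !eM rmorphM IHx IHy.
  case: p q xp yq => [|p] [|q] xp yq; rewrite ?muln0 ?expr0 ?mul1r 1?mulrC //.
  by rewrite (e_pos _ _ xp) rmorph0 mul0r mulr0 mul0r.
- apply: (homog_ind (G := G)) => [|x y xE yE|p x xp].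
  + by rewrite !linear0.
  + by rewrite !linearD /= xE yE addr0.
  exact: e_pos (dif_homog xp).
exact: (antihom_antider genA hgen S_anti (gida_dif_antider G) (gida_dif_antider G)).
Qed.
End GidaHopf.

(** * Determinants and cofactors of quantum matrices *)

Section Words.
Variable I : finType.

Fixpoint words (n : nat) : seq (seq I) :=
  if n is n'.+1 then [seq i :: w | i <- enum I, w <- words n'] else [:: [::]].

Lemma mem_words n w : (w \in words n) = (size w == n).
Proof.
elim: n w => [|n IHn] [|i w] //=.
  by apply/allpairsPdep => -[i [w [_ _]]].
rewrite eqSS -IHn; apply/allpairsPdep/idP => [[j [v [_ vn [_ ->]]]] //|wn].
by exists i, w; rewrite mem_enum.
Qed.

Lemma words_uniq n : uniq (words n).
Proof.
elim: n => //= n IHn; apply: allpairs_uniq => //; first exact: enum_uniq.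
by move=> [i w] [j v] _ _ [-> ->].
Qed.

Section Sums.
Variable V : zmodType.
Implicit Type F : seq I -> V.

Lemma big_words0 F : \sum_(w <- words 0) F w = F [::].
Proof. by rewrite big_seq1. Qed.

Lemma big_wordsS n F :
  \sum_(w <- words n.+1) F w = \sum_i \sum_(w <- words n) F (i :: w).
Proof. by rewrite [words _.+1]/= big_allpairs_dep big_enum. Qed.

Lemma big_words_cat m n F :
  \sum_(w <- words (m + n)) F w =
  \sum_(u <- words m) \sum_(v <- words n) F (u ++ v).
Proof.
elim: m F => [|m IHm] F; first by rewrite big_words0.
rewrite addSn !big_wordsS; apply: eq_bigr => i _.
by rewrite (IHm (fun w => F (i :: w))).
Qed.

Lemma big_words_inj n (f : seq I -> seq I) F :
    injective f -> (forall w, size (f w) = size w) ->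
  \sum_(w <- words n) F (f w) = \sum_(w <- words n) F w.
Proof.
move=> f_inj f_size; rewrite -(big_map f xpredT F); apply: perm_big.
apply: uniq_perm; rewrite ?map_inj_uniq ?words_uniq //.
apply: (uniq_min_size _ _ _).2; rewrite ?map_inj_uniq ?words_uniq ?size_map //.
by move=> _ /mapP[w wn ->]; rewrite mem_words f_size -mem_words.
Qed.
End Sums.
End Words.

Section WordProducts.
Variables (K : comNzRingType) (I : finType) (B : ualgebra K).
Variable T : I -> I -> B.

Definition wprod (u v : seq I) : B := \prod_(p <- zip u v) T p.1 p.2.

Lemma wprod_cons i u j v : wprod (i :: u) (j :: v) = T i j * wprod u v.
Proof. by rewrite /wprod /= big_cons. Qed.

Lemma wprod_nil : wprod [::] [::] = 1.
Proof. by rewrite /wprod big_nil. Qed.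

Lemma wprod_cat u u' v v' : size u = size v ->
  wprod (u ++ u') (v ++ v') = wprod u v * wprod u' v'.
Proof. by move=> uv; rewrite /wprod zip_cat // big_cat. Qed.
End WordProducts.

(** * The exchange rule and the twisted sign of a word *)

Section Braided.
Variables (K : numFieldType) (I : finType) (L : I -> I -> K).
Hypotheses (L_diag : forall i, L i i = 1) (L_sym : forall i j, L i j * L j i = 1).

(* The exchange rule of the products [dx^w]. *)
Definition braided (V : lmodType K) (F : seq I -> V) : Prop :=
  forall x a b y,
    F (x ++ a :: b :: y) = - L a b *: F (x ++ b :: a :: y).

Lemma L_neq0 i j : L i j != 0.
Proof. by apply: contra_eq_neq (L_sym i j) => ->; rewrite mul0r eq_sym oner_eq0. Qed.

Lemma braided_move (V : lmodType K) (F : seq I -> V) x a u v : braided F ->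
  F (x ++ u ++ a :: v) = (\prod_(b <- u) - L b a) *: F (x ++ a :: u ++ v).
Proof.
move=> bF; elim: u x => [|b u IHu] x; first by rewrite big_nil scale1r.
rewrite big_cons /= -cat_rcons IHu cat_rcons bF scalerA mulrC.
by [].
Qed.

(** The constant depends on the two words alone, not on the function or the prefix; this is what
    allows two braided functions to be compared in [braided_sign]. *)
Lemma braided_perm w w' : perm_eq w w' ->
  exists c : K, forall (V : lmodType K) (F : seq I -> V) x, braided F ->
    F (x ++ w) = c *: F (x ++ w').
Proof.
elim: w w' => [|a w IHw] w'.
  rewrite perm_sym => /perm_nilP ->; exists 1 => V F x _.
  by rewrite scale1r.
move=> ww'; have aw' : a \in w' by rewrite -(perm_mem ww') mem_head.
case/splitPr: aw' ww' => u v; rewrite perm_sym perm_catC /= perm_cons perm_catC.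
rewrite perm_sym => /IHw[c cE].
have d0 : \prod_(b <- u) - L b a != 0.
  by rewrite prodf_seq_neq0; apply/allP => b _; rewrite oppr_eq0 L_neq0.
exists (c * (\prod_(b <- u) - L b a)^-1) => V F x bF.
rewrite (braided_move _ _ _ _ bF) scalerA divfK //.
by rewrite -cat_rcons (cE V F) // cat_rcons.
Qed.

(** Bring two equal letters side by side. Exchanging them gives [F = - F] because [L a a = 1], and
    [2] is invertible. *)
Lemma braided_dup (V : lmodType K) (F : seq I -> V) w : braided F ->
  ~~ uniq w -> F w = 0.
Proof.
move=> bF; have dup x a y : F (x ++ a :: a :: y) = 0.
  have /eqP := bF x a a y; rewrite L_diag scaleN1r -addr_eq0 -mulr2n.
  by rewrite -scaler_nat scaler_eq0 Num.Theory.pnatr_eq0 => /eqP.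
suff nuniq x : ~~ uniq w -> F (x ++ w) = 0 by exact: (nuniq [::]).
elim: w x => [|a w IHw] x //=; rewrite negb_and negbK => /orP[|nw]; last first.
  by rewrite -cat_rcons IHw.
case/splitPr => u v; rewrite -cat_rcons (braided_move _ _ _ _ bF) cat_rcons dup.
by rewrite scaler0.
Qed.

(* The sign of [w], twisted by [- L a b] for each inversion [a, b]. *)
Fixpoint wsign0 (w : seq I) : K :=
  if w is a :: w' then
    (if a \in w' then 0
     else \prod_(b <- w' | (enum_rank b < enum_rank a)%N) - L a b) * wsign0 w'
  else 1.

(** The exchange creates or removes exactly the inversion between [a] and [b]; the two cases agree
    because [L a b * L b a = 1]. *)
Lemma wsign0_braided : @braided K^o wsign0.
Proof.
elim=> [|c x IHx] a b y /=; last first.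
  rewrite IHx /GRing.scale /= mulrCA; congr (_ * (_ * _)).
  have e : perm_eq (x ++ a :: b :: y) (x ++ b :: a :: y).
    by rewrite perm_cat2l (perm_catCA [:: a] [:: b]).
  by rewrite (perm_mem e) (perm_big _ e).
rewrite !in_cons !big_cons /GRing.scale /=.
have [->|neq_ab] := eqVneq a b; first by rewrite /= !mul0r mulr0.
rewrite /=.
case: (a \in y); first by rewrite !mul0r !mulr0.
case: (b \in y); first by rewrite !mul0r !mulr0.
have : enum_rank a != enum_rank b by rewrite (inj_eq enum_rank_inj).
rewrite -val_eqE /= neq_ltn => /orP[] ltab; rewrite ltab ltnNge (ltnW ltab) /=.
  by rewrite !mulrA mulrNN L_sym mul1r [_ * \prod_(_ <- _ | _) _]mulrC.
by rewrite -!mulrA; congr (_ * _); rewrite mulrCA.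
Qed.

Lemma wsign0_uniq w : uniq w -> wsign0 w != 0.
Proof.
elim: w => [|a w IHw] /=; first by rewrite oner_eq0.
move=> /andP[/negbTE-> /IHw w0]; rewrite mulf_neq0 // prodf_seq_neq0.
by apply/allP => b _; rewrite oppr_eq0 L_neq0 implybT.
Qed.

Lemma braided_sign_exists w0 : uniq w0 ->
  exists2 s : seq I -> K, @braided K^o s & s w0 = 1.
Proof.
move=> /wsign0_uniq w0n; exists (fun w => (wsign0 w0)^-1 * wsign0 w); last first.
  by rewrite mulVf.
by move=> x a b y; rewrite wsign0_braided /GRing.scale /= mulrCA.
Qed.

Section Sign.
Variables (s : seq I -> K) (w0 : seq I).
Hypotheses (s_br : @braided K^o s) (s_w0 : s w0 = 1).
Hypotheses (w0_uniq : uniq w0) (w0_full : forall i, i \in w0).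

Lemma uniq_perm_w0 w : uniq w -> size w = size w0 -> perm_eq w w0.
Proof.
move=> wU wS; apply: uniq_perm => //.
apply: (uniq_min_size wU _ _).2; last by rewrite wS.
by move=> i _; apply: w0_full.
Qed.

Lemma sign_neq0 w : uniq w -> size w = size w0 -> s w != 0.
Proof.
move=> wU wS; have := uniq_perm_w0 wU wS; rewrite perm_sym => /braided_perm[c].
move=> /(_ K^o s [::] s_br) /=; rewrite s_w0 => /eqP; apply: contraTneq => ->.
by rewrite scaler0 oner_eq0.
Qed.

Lemma sign_eq0 w : ~~ uniq w -> s w = 0.
Proof. exact: (braided_dup s_br). Qed.

(** The space of forms of top degree has dimension one: a word of this length either repeats a
    letter, where both sides vanish, or is a rearrangement of [w0]. *)
Lemma braided_sign (V : lmodType K) (F : seq I -> V) w : braided F ->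
  size w = size w0 -> F w = s w *: F w0.
Proof.
move=> bF wS; have [wU|wN] := boolP (uniq w); last first.
  by rewrite sign_eq0 // scale0r braided_dup.
have [c cE] := braided_perm (uniq_perm_w0 wU wS).
by rewrite (cE V F [::] bF) (cE K^o s [::] s_br) /= s_w0 [c *: 1]mulr1.
Qed.
End Sign.

End Braided.

Definition quantum_matrix (K : comNzRingType) (I : finType) (L : I -> I -> K)
    (B : ualgebra K) (T : I -> I -> B) : Prop :=
  forall i j k l, T i j * T k l = (L i k * L l j) *: (T k l * T i j).

(** Exchanging two factors exchanges their rows and their columns. The column factor [L d c] cancels
    the [L c d] coming from [s], so only the sign and the row factor survive. *)
Lemma row_braided (K : numFieldType) (I : finType) (L : I -> I -> K)
    (s : seq I -> K) (B : ualgebra K) (T : I -> I -> B) :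
    (forall i j, L i j * L j i = 1) -> @braided K I L K^o s ->
    quantum_matrix L T ->
  braided L (fun v => \sum_(w <- words I (size v)) s w *: wprod T v w).
Proof.
move=> L_sym s_br qT x a b y; rewrite !size_cat /= !big_words_cat scaler_sumr.
apply: eq_big_seq => u; rewrite mem_words => /eqP uS.
rewrite !big_wordsS scaler_sumr (eq_bigr _ (fun i _ => big_wordsS _ _)).
rewrite exchange_big; apply: eq_bigr => d _ /=.
rewrite big_wordsS scaler_sumr; apply: eq_bigr => c _.
rewrite scaler_sumr; apply: eq_bigr => v _.
have sE : s (u ++ c :: d :: v) = - L c d * s (u ++ d :: c :: v) by apply: s_br.
rewrite !wprod_cat // !wprod_cons sE scalerA.
rewrite [T a c * _]mulrA qT -!uscalerAl -uscalerAr !scalerA -!mulrA.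
congr (_ *: _).
by rewrite mulrCA [- L c d * _]mulrCA mulNr L_sym mulrN1 mulrC.
Qed.

(** * Determinant, cofactors and their commutation rules *)

Section Det.
Variables (K : numFieldType) (I : finType) (L : I -> I -> K).
Hypotheses (L_diag : forall i, L i i = 1) (L_sym : forall i j, L i j * L j i = 1).
Variables (s : seq I -> K) (w0 : seq I).
Hypotheses (s_br : @braided K I L K^o s) (s_w0 : s w0 = 1).
Hypotheses (w0_uniq : uniq w0) (w0_full : forall i, i \in w0).

(* In the determinant [s w] is the coefficient of [dx^w] with respect to
   [dx^w0]. *)
Definition qdet (B : ualgebra K) (T : I -> I -> B) : B :=
  \sum_(w <- words I (size w0)) s w *: wprod T w0 w.

(** The [(i, j)] entry of the adjugate matrix. Row [j] is removed explicitly, whereas column [i]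
    disappears because [s (i :: w)] vanishes when [i] occurs in [w]. The scalar in front undoes the
    sign of bringing [j] to the front of [w0]. *)
Definition qcof (B : ualgebra K) (T : I -> I -> B) (i j : I) : B :=
  (s (j :: rem j w0))^-1 *:
    \sum_(w <- words I (size w0).-1) s (i :: w) *: wprod T (rem j w0) w.

Lemma qdet_row (B : ualgebra K) (T : I -> I -> B) v :
    quantum_matrix L T -> size v = size w0 ->
  \sum_(w <- words I (size w0)) s w *: wprod T v w = s v *: qdet T.
Proof.
move=> qT vS; have bF := row_braided L_sym s_br qT.
by rewrite -(braided_sign L_diag L_sym s_br s_w0 w0_uniq w0_full bF vS) vS.
Qed.

Lemma size_rem_w0 j : (size (rem j w0)).+1 = size w0.
Proof. by rewrite size_rem // prednK //; case: w0 (w0_full j). Qed.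

Lemma uniq_cons_rem k j : uniq (k :: rem j w0) = (k == j).
Proof.
by rewrite /= rem_uniq // andbT mem_rem_uniq // inE w0_full andbT negbK.
Qed.

Lemma sign_cons_rem k j :
  (s (j :: rem j w0))^-1 * s (k :: rem j w0) = (k == j)%:R.
Proof.
have [->|neq] := eqVneq k j.
  rewrite mulVf // (sign_neq0 L_sym s_br s_w0) ?uniq_cons_rem //.
  exact: size_rem_w0.
by rewrite (sign_eq0 L_diag s_br (w := k :: _)) ?uniq_cons_rem // mulr0.
Qed.

(** Laplace expansion: the sum is the row sum of the word [k :: rem j w0], which repeats a letter
    unless [k = j]. *)
Lemma qcof_right (B : ualgebra K) (T : I -> I -> B) k j :
  quantum_matrix L T ->
  \sum_i T k i * qcof T i j = (k == j)%:R *: qdet T.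
Proof.
move=> qT; rewrite -sign_cons_rem -scalerA.
have := qdet_row (v := k :: rem j w0) qT (size_rem_w0 j) => <-.
rewrite -(size_rem_w0 j) big_wordsS scaler_sumr; apply: eq_bigr => i _.
rewrite /qcof -uscalerAr -(size_rem_w0 j) mulr_sumr; congr (_ *: _).
by apply: eq_bigr => w _; rewrite wprod_cons uscalerAr.
Qed.

Section QCommute.
Variables (B : ualgebra K) (T : I -> I -> B) (x : B) (a b : I -> K).
Hypothesis xT : forall k l, x * T k l = (a k * b l) *: (T k l * x).

Lemma wprod_qcomm u v : size u = size v ->
  x * wprod T u v = ((\prod_(k <- u) a k) * \prod_(l <- v) b l) *: (wprod T u v * x).
Proof.
elim: u v => [|k u IHu] [|l v] //=.
  by rewrite wprod_nil !big_nil !mulr1 mul1r scale1r.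
move=> [uv]; rewrite wprod_cons !big_cons mulrA xT -uscalerAl -mulrA IHu //.
by rewrite -uscalerAr scalerA mulrA mulrACA.
Qed.

Hypotheses (a_prod : \prod_i a i = 1) (b_prod : \prod_i b i = 1).

Lemma prod_word (c : I -> K) w : uniq w -> size w = size w0 ->
  \prod_(i <- w) c i = \prod_i c i.
Proof.
move=> wU wS; rewrite -big_enum; apply: perm_big; apply: uniq_perm => //.
  exact: enum_uniq.
move=> i; rewrite mem_enum (perm_mem (uniq_perm_w0 w0_uniq w0_full wU wS)).
by rewrite w0_full.
Qed.

(** Only words without repetition contribute. Each meets every column once, as [w0] meets every row
    once, so the total factor is the product of all [a] and all [b]. *)
Lemma qdet_qcomm : x * qdet T = qdet T * x.
Proof.
rewrite /qdet mulr_sumr mulr_suml; apply: eq_big_seq => w.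
rewrite mem_words => /eqP wS; have [wU|wN] := boolP (uniq w); last first.
  by rewrite (sign_eq0 L_diag s_br) // scale0r mulr0 mul0r.
rewrite -uscalerAr -uscalerAl wprod_qcomm // !prod_word // a_prod b_prod.
by rewrite mulr1 scale1r.
Qed.

(** As for the determinant, except that row [j] and column [i] are missing; the remaining factors
    multiply to the inverses of [a j] and [b i]. *)
Lemma qcof_qcomm i j : x * qcof T i j = (a j * b i)^-1 *: (qcof T i j * x).
Proof.
have remP (c : I -> K) k w : \prod_i c i = 1 -> uniq (k :: w) ->
    size (k :: w) = size w0 -> \prod_(l <- w) c l = (c k)^-1.
  move=> c1 kwU kwS; have := prod_word c kwU kwS; rewrite c1 big_cons => ck1.
  have ck0 : c k != 0.
    by apply: contra_eq_neq ck1 => ->; rewrite mul0r eq_sym oner_eq0.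
  by apply: (mulfI ck0); rewrite ck1 mulfV.
rewrite /qcof -uscalerAr -uscalerAl scalerA mulrC -scalerA; congr (_ *: _).
rewrite mulr_sumr mulr_suml scaler_sumr; apply: eq_big_seq => w.
rewrite mem_words => /eqP wS; have wS' : size (i :: w) = size w0.
  by rewrite /= wS -(size_rem_w0 j).
have [wU|wN] := boolP (uniq (i :: w)); last first.
  by rewrite (sign_eq0 L_diag s_br) // scale0r mulr0 mul0r scaler0.
rewrite -uscalerAr -uscalerAl scalerA mulrC -scalerA wprod_qcomm; last first.
  by rewrite wS -(size_rem_w0 j).
rewrite (remP b i) // (remP a j) ?uniq_cons_rem ?size_rem_w0 //.
  by rewrite -invfM.
by rewrite /= size_rem_w0.
Qed.
End QCommute.

End Det.

Lemma wprod_tr (K : comNzRingType) (I : finType) (B : ualgebra K)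
    (T : I -> I -> B) u v : size u = size v ->
  wprod (fun i j => T j i) u v = wprod T v u.
Proof.
elim: u v => [|i u IHu] [|j v] //=; first by rewrite !wprod_nil.
by move=> [uv]; rewrite !wprod_cons IHu.
Qed.

Lemma sum_delta (K : comNzRingType) (I : finType) (V : lmodType K) (F : I -> V) j :
  \sum_i (i == j)%:R *: F i = F j.
Proof.
rewrite (bigD1 j) //= eqxx scale1r big1 ?addr0 // => i /negbTE->.
by rewrite scale0r.
Qed.

(** * Transposition and the inverse matrix *)

Section Inverse.
Variables (K : numFieldType) (I : finType) (L : I -> I -> K).
Hypotheses (L_diag : forall i, L i i = 1) (L_sym : forall i j, L i j * L j i = 1).
Variables (s : seq I -> K) (w0 : seq I).
Hypotheses (s_br : @braided K I L K^o s) (s_w0 : s w0 = 1).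
Hypotheses (w0_uniq : uniq w0) (w0_full : forall i, i \in w0).
Variables (B : ualgebra K) (T : I -> I -> B).
Hypothesis qT : quantum_matrix L T.

Local Notation Lt := (fun a b => L b a).
Local Notation Tt := (fun i j => T j i).
Local Notation st := (fun w => (s w)^-1).

(** The transposed matrix is a quantum matrix for the transposed [L], with sign function the inverse
    of [s]. On words with repetition both signs vanish, by the convention that the inverse of [0] is
    [0]. *)
Let st_br : @braided K I Lt K^o st.
Proof.
move=> x a b y; have -> : s (x ++ a :: b :: y) = - L a b * s (x ++ b :: a :: y).
  exact: s_br.
rewrite invfM invrN; congr (- _ * _).
by rewrite -[LHS]mulr1 -(L_sym a b) mulKf // (L_neq0 L_sym).
Qed.

Let Lt_sym i j : Lt i j * Lt j i = 1.
Proof. exact: L_sym. Qed.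

Let qTt : quantum_matrix Lt Tt.
Proof. by move=> i j k l; rewrite qT mulrC. Qed.

Let st_w0 : st w0 = 1.
Proof. by rewrite /= s_w0 invr1. Qed.

Let qdett_row v : size v = size w0 ->
  \sum_(w <- words I (size w0)) (s w)^-1 *: wprod T w v = (s v)^-1 *: qdet st w0 Tt.
Proof.
move=> vS; have := qdet_row L_diag Lt_sym st_br st_w0 w0_uniq w0_full qTt vS => <-.
apply: eq_big_seq => w; rewrite mem_words => /eqP wS.
by rewrite wprod_tr // vS wS.
Qed.

(* Both sides, multiplied by the number of words without repetition, are the
   sum of [(s v)^-1 * s w *: wprod T v w] over all words [v] and [w]. *)
Lemma qdet_tr : qdet st w0 Tt = qdet s w0 T.
Proof.
pose N : K := \sum_(v <- words I (size w0)) (s v)^-1 * s v.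
(* Each term is [1] or [0], the term of [w0] is [1], and the characteristic is zero. *)
have N0 : N != 0.
  have NE : N = (\sum_(v <- words I (size w0)) (s v != 0%R))%N%:R.
    rewrite natr_sum; apply: eq_bigr => v _.
    by have [->|sv] := eqVneq (s v) 0; rewrite ?mulr0 ?mulVf.
  rewrite NE Num.Theory.pnatr_eq0 sum_nat_seq_eq0 -has_predC.
  by apply/hasP; exists w0; rewrite ?mem_words ?eqxx //= s_w0 oner_eq0.
apply: (scalerI N0).
pose D := \sum_(v <- words I (size w0)) \sum_(w <- words I (size w0))
  ((s v)^-1 * s w) *: wprod T v w.
transitivity D.
  rewrite /D exchange_big /N scaler_suml; apply: eq_big_seq => w.
  rewrite mem_words => /eqP wS.
  rewrite mulrC -scalerA -qdett_row // scaler_sumr; apply: eq_bigr => v _.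
  by rewrite scalerA mulrC.
rewrite /D /N scaler_suml; apply: eq_big_seq => v; rewrite mem_words => /eqP vS.
have row := qdet_row L_diag L_sym s_br s_w0 w0_uniq w0_full qT vS.
rewrite -scalerA -row scaler_sumr; apply: eq_bigr => w _.
by rewrite scalerA.
Qed.

(** The adjugate by column expansion. The distinguished column is placed last rather than first, so
    that its entry becomes the right-hand factor and the expansion yields a left inverse. *)
Let qcofl (j k : I) : B := (st (rem j w0 ++ [:: j]))^-1 *:
  \sum_(w <- words I (size w0).-1) st (w ++ [:: k]) *: wprod Tt (rem j w0) w.

Let size_rem j : (size (rem j w0) + 1)%N = size w0.
Proof. by rewrite addn1 size_rem_w0. Qed.

Let qcofl_left j l : \sum_k qcofl j k * T k l = (j == l)%:R *: qdet s w0 T.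
Proof.
have -> : (j == l)%:R = (st (rem j w0 ++ [:: j]))^-1 * st (rem j w0 ++ [:: l]).
  have uE k : uniq (rem j w0 ++ [:: k]) = (k == j).
    by rewrite -(uniq_cons_rem w0_uniq w0_full) uniq_catC.
  have [<-|neq] := eqVneq j l.
    rewrite mulVf // invr_eq0 (sign_neq0 L_sym s_br s_w0) ?uE //.
    by rewrite size_cat size_rem.
  by rewrite [s (_ ++ [:: l])](sign_eq0 L_diag s_br) ?invr0 ?mulr0 // uE eq_sym.
have vS : size (rem j w0 ++ [:: l]) = size w0 by rewrite size_cat size_rem.
rewrite -scalerA -qdet_tr.
have := qdet_row L_diag Lt_sym st_br st_w0 w0_uniq w0_full qTt vS => <-.
rewrite -[in words I _](size_rem j) big_words_cat exchange_big big_wordsS scaler_sumr.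
apply: eq_bigr => k _; rewrite big_words0 /qcofl -uscalerAl; congr (_ *: _).
rewrite -(size_rem j) addn1 mulr_suml; apply: eq_big_seq => w.
rewrite mem_words => /eqP wS; rewrite wprod_cat // wprod_cons wprod_nil mulr1.
by rewrite -uscalerAl.
Qed.

Variable dinv : B.
Hypotheses (det_dinv : qdet s w0 T * dinv = 1) (dinv_det : dinv * qdet s w0 T = 1).

Definition qinv (i j : I) : B := qcof s w0 T i j * dinv.

Lemma qinv_right k j : \sum_i T k i * qinv i j = (k == j)%:R *: (1 : B).
Proof.
rewrite -det_dinv uscalerAl.
rewrite -(qcof_right L_diag L_sym s_br s_w0 w0_uniq w0_full _ _ qT) mulr_suml.
by apply: eq_bigr => i _; rewrite mulrA.
Qed.

(** The column cofactors give a left inverse [U], and by associativity a left inverse equals the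
    right inverse [qinv]; row and column cofactors need not be compared directly. *)
Lemma qinv_left k j : \sum_i qinv k i * T i j = (k == j)%:R *: (1 : B).
Proof.
pose U j k := dinv * qcofl j k.
have U_left i l : \sum_m U i m * T m l = (i == l)%:R *: (1 : B).
  rewrite -dinv_det uscalerAr -qcofl_left mulr_sumr.
  by apply: eq_bigr => m _; rewrite mulrA.
suff UE m : qinv k m = U k m by rewrite -U_left; apply: eq_bigr => m _; rewrite UE.
transitivity (\sum_l (\sum_i U k i * T i l) * qinv l m).
  under eq_bigr do rewrite U_left eq_sym -uscalerAl mul1r.
  by rewrite sum_delta.
under eq_bigr do rewrite mulr_suml.
rewrite exchange_big -[RHS](sum_delta (fun i => U k i)); apply: eq_bigr => i _ /=.
under eq_bigr do rewrite -mulrA.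
by rewrite -mulr_sumr qinv_right -uscalerAr mulr1.
Qed.

(** Because of the reversal the two products meet in a pair [qinv i k * T k j], and the sum
    collapses from the middle outwards. *)
Lemma wprod_qinv u v : size u = size v ->
  \sum_(w <- words I (size u)) wprod qinv (rev u) (rev w) * wprod T w v =
  (u == v)%:R *: (1 : B).
Proof.
elim: u v => [|i u IHu] [|j v] //=.
  by rewrite big_seq1 !wprod_nil mulr1 scale1r.
move=> [uv]; rewrite big_wordsS exchange_big.
transitivity (\sum_(w <- words I (size u))
    (i == j)%:R *: (wprod qinv (rev u) (rev w) * wprod T w v)).
  apply: eq_big_seq => w; rewrite mem_words => /eqP wS.
  rewrite -[_ * wprod T w v]mulr1.
  transitivity (wprod qinv (rev u) (rev w) * (\sum_k qinv i k * T k j) * wprod T w v).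
    rewrite mulr_sumr mulr_suml; apply: eq_bigr => k _.
    rewrite !rev_cons -!cats1 wprod_cat ?size_rev // !wprod_cons wprod_nil mulr1.
    by rewrite !mulrA.
  by rewrite qinv_left -uscalerAr -uscalerAl !mulr1.
rewrite -scaler_sumr IHu // scalerA eqseq_cons -natrM mulnb.
by [].
Qed.

(** Write [s w *: qdet s w0 T] as the row sum of [w]; by [wprod_qinv] the double sum keeps only the
    column word [w0]. *)
Lemma qdet_qinv :
  (\sum_(w <- words I (size w0)) s w *: wprod qinv (rev w0) (rev w)) * qdet s w0 T = 1.
Proof.
have row := qdet_row L_diag L_sym s_br s_w0 w0_uniq w0_full qT.
transitivity (\sum_(w <- words I (size w0)) \sum_(v <- words I (size w0))
   s v *: (wprod qinv (rev w0) (rev w) * wprod T w v)).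
  rewrite mulr_suml; apply: eq_big_seq => w; rewrite mem_words => /eqP wS.
  rewrite -uscalerAl uscalerAr -row // mulr_sumr.
  by apply: eq_bigr => v _; rewrite -uscalerAr.
rewrite exchange_big.
transitivity (\sum_(v <- words I (size w0)) (w0 == v)%:R *: (s v *: (1 : B))).
  apply: eq_big_seq => v; rewrite mem_words => /eqP vS.
  by rewrite -scaler_sumr wprod_qinv // scalerA mulrC -scalerA.
rewrite (bigD1_seq w0) ?words_uniq ?mem_words ?eqxx //= s_w0 !scale1r.
by rewrite big1 ?addr0 // => v; rewrite eq_sym => /negbTE->; rewrite scale0r.
Qed.

Variables (x : B) (a b : I -> K).
Hypothesis xT : forall k l, x * T k l = (a k * b l) *: (T k l * x).
Hypotheses (a_prod : \prod_i a i = 1) (b_prod : \prod_i b i = 1).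

Lemma qinv_qcomm i j : x * qinv i j = (a j * b i)^-1 *: (qinv i j * x).
Proof.
have xdet := qdet_qcomm L_diag s_br w0_uniq w0_full xT a_prod b_prod.
have xd : x * dinv = dinv * x.
  by rewrite -[x * _]mul1r -dinv_det -!mulrA [_ * (x * _)]mulrA -xdet
    -!mulrA det_dinv mulr1.
rewrite /qinv mulrA (qcof_qcomm L_diag s_br w0_uniq w0_full xT a_prod b_prod).
by rewrite -uscalerAl -!mulrA xd.
Qed.

End Inverse.

(** * Determinants under homomorphisms, coproducts and conjugation *)

Section QdetMaps.
Variables (K : numFieldType) (I : finType) (s : seq I -> K) (w0 : seq I).

Lemma wprod_hom (A B : ualgebra K) (f : {linear A -> B}) (T : I -> I -> A) u v :
  monoid_morphism f -> f (wprod T u v) = wprod (fun i j => f (T i j)) u v.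
Proof. by move=> [f1 fM]; rewrite /wprod (big_morph f fM f1). Qed.

Lemma qdet_hom (A B : ualgebra K) (f : {linear A -> B}) (T : I -> I -> A) :
  monoid_morphism f -> f (qdet s w0 T) = qdet s w0 (fun i j => f (T i j)).
Proof.
move=> f_hom; rewrite /qdet linear_sum; apply: eq_bigr => w _.
by rewrite linearZ wprod_hom.
Qed.

Lemma eq_qdet (A : ualgebra K) (T U : I -> I -> A) :
  (forall i j, T i j = U i j) -> qdet s w0 T = qdet s w0 U.
Proof.
move=> TU; apply: eq_bigr => w _; congr (_ *: _).
by apply: eq_bigr => p _; rewrite TU.
Qed.

Lemma qcof_hom (A B : ualgebra K) (f : {linear A -> B}) (T : I -> I -> A) i j :
  monoid_morphism f -> f (qcof s w0 T i j) = qcof s w0 (fun i j => f (T i j)) i j.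
Proof.
move=> f_hom; rewrite /qcof linearZ linear_sum; congr (_ *: _).
by apply: eq_bigr => w _; rewrite linearZ wprod_hom.
Qed.

Lemma qinv_hom (A B : ualgebra K) (f : {linear A -> B}) (T : I -> I -> A) d i j :
  monoid_morphism f ->
  f (qinv s w0 T d i j) = qinv s w0 (fun i j => f (T i j)) (f d) i j.
Proof. by move=> f_hom; rewrite /qinv f_hom.2 qcof_hom. Qed.

Section Closed.
Variables (A : ualgebra K) (P : A -> Prop).
Hypotheses (P0 : P 0) (P1 : P 1) (PD : forall x y, P x -> P y -> P (x + y)).
Hypotheses (PZ : forall k x, P x -> P (k *: x)).
Hypothesis PM : forall x y, P x -> P y -> P (x * y).
Variable T : I -> I -> A.
Hypothesis PT : forall i j, P (T i j).

Lemma wprod_closed u v : P (wprod T u v).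
Proof. by rewrite /wprod; elim/big_ind: _. Qed.

(** Used for homogeneity and for compatibility with differentials, both of which pass in this way
    from the entries to the determinant. *)
Lemma qdet_closed : P (qdet s w0 T).
Proof.
rewrite /qdet; elim/big_ind: _ => // w _; apply: PZ; exact: wprod_closed.
Qed.

Lemma qinv_closed d i j : P d -> P (qinv s w0 T d i j).
Proof.
move=> Pd; apply: PM => //; apply: PZ; elim/big_ind: _ => // w _.
apply: PZ; exact: wprod_closed.
Qed.
End Closed.

Section Homog0.
Variables (A : ualgebra K) (G : graded A).

Let homog00 : homog G 0 0.
Proof. exact: linear0. Qed.
Let homog0M x y : homog G 0 x -> homog G 0 y -> homog G 0 (x * y).
Proof. exact: homogM. Qed.

Variable T : I -> I -> A.
Hypothesis T0 : forall i j, homog G 0 (T i j).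

Lemma wprod_homog0 u v : homog G 0 (wprod T u v).
Proof. exact: (wprod_closed (homog1 G) homog0M T0). Qed.

Lemma qdet_homog0 : homog G 0 (qdet s w0 T).
Proof.
apply: (@qdet_closed _ (homog G 0)) => //; first exact: homog1.
- exact: homogD.
- exact: homogZ.
Qed.

Lemma qinv_homog0 d i j : homog G 0 d -> homog G 0 (qinv s w0 T d i j).
Proof.
apply: (@qinv_closed _ (homog G 0)) => //; first exact: homog1.
- exact: homogD.
- exact: homogZ.
Qed.

Lemma wprod_gop tau u v : size u = size v ->
  wprod (T : I -> I -> gop tau G) u v = wprod T (rev u) (rev v).
Proof.
elim: u v => [|i u IHu] [|j v] //=; first by rewrite !wprod_nil.
move=> [uv]; rewrite wprod_cons !rev_cons -!cats1 wprod_cat ?size_rev //.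
rewrite wprod_cons wprod_nil mulr1 IHu //.
by rewrite (gop_mulE tau (T0 i j) (wprod_homog0 _ _)) expr0 scale1r.
Qed.

(** Expresses in the original algebra what a graded anti-homomorphism makes of the determinant. The
    sum is then evaluated by [qdet_conj] for the involution and by [qdet_qinv] for the antipode. *)
Lemma qdet_gop tau : qdet s w0 (T : I -> I -> gop tau G) =
  \sum_(w <- words I (size w0)) tau (s w) *: wprod T (rev w0) (rev w).
Proof.
apply: eq_big_seq => w; rewrite mem_words => /eqP wS.
by rewrite gop_scaleE wprod_gop // wS.
Qed.
End Homog0.

Lemma wprod_gten (A B : ualgebra K) (GA : graded A) (GB : graded B)
    (t : I -> I -> A) (u : I -> I -> B) v w :
    (forall i j, homog GA 0 (t i j)) -> (forall i j, homog GB 0 (u i j)) ->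
    size v = size w ->
  wprod (fun i j => \sum_k gten GA GB (t i k) (u k j)) v w =
  \sum_(z <- words I (size v)) gten GA GB (wprod t v z) (wprod u z w).
Proof.
move=> t0 u0; elim: v w => [|i v IHv] [|j w] //=.
  by rewrite big_seq1 !wprod_nil.
move=> [vw]; rewrite wprod_cons IHv // big_wordsS mulr_suml; apply: eq_bigr => k _.
rewrite mulr_sumr; apply: eq_bigr => z _.
rewrite (gtens_mulE _ _ (u0 k j) (wprod_homog0 t0 v z)) expr0 scale1r.
by rewrite !wprod_cons.
Qed.
End QdetMaps.

Section QdetSigned.
Variables (K : numFieldType) (I : finType) (L : I -> I -> K).
Hypotheses (L_diag : forall i, L i i = 1) (L_sym : forall i j, L i j * L j i = 1).
Variables (s : seq I -> K) (w0 : seq I).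
Hypotheses (s_br : @braided K I L K^o s) (s_w0 : s w0 = 1).
Hypotheses (w0_uniq : uniq w0) (w0_full : forall i, i \in w0).

Lemma qdet_grouplike (A B : ualgebra K) (GA : graded A) (GB : graded B)
    (t : I -> I -> A) (u : I -> I -> B) :
    (forall i j, homog GA 0 (t i j)) -> (forall i j, homog GB 0 (u i j)) ->
    quantum_matrix L u ->
  qdet s w0 (fun i j => \sum_k gten GA GB (t i k) (u k j)) =
  gten GA GB (qdet s w0 t) (qdet s w0 u).
Proof.
move=> t0 u0 qu; rewrite /qdet [in RHS]gten_suml.
transitivity (\sum_(w <- words I (size w0)) \sum_(z <- words I (size w0))
    gten GA GB (wprod t w0 z) (s w *: wprod u z w)).
  apply: eq_big_seq => w; rewrite mem_words => /eqP wS.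
  rewrite wprod_gten // scaler_sumr; apply: eq_bigr => z _.
  by rewrite gtenZr.
rewrite exchange_big; apply: eq_big_seq => z; rewrite mem_words => /eqP zS.
rewrite -gten_sumr (qdet_row L_diag L_sym s_br s_w0 w0_uniq w0_full qu zS).
by rewrite gtenZl gtenZr.
Qed.

(** The map [f] reverses and conjugates a word. Conjugating [s] along it gives a braided function
    [g], since [cj] inverts [L], so [g] is [s] up to the factor [g w0]. Reindexing by [f] turns the
    sum into the row sum of [f w0], and the scalar left over, [g w0 * s (f w0) = g (f w0)], is [1]
    because [f] is an involution. *)
Lemma qdet_conj (cj : {rmorphism K -> K}) (c : I -> I) (A : ualgebra K)
    (t : I -> I -> A) :
    involutive c -> (forall i j, L (c i) (c j) = L i j) ->
    (forall i j, cj (L i j) = L j i) -> involutive cj -> quantum_matrix L t ->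
  \sum_(w <- words I (size w0))
    cj (s w) *: wprod (fun i j => t (c i) (c j)) (rev w0) (rev w) = qdet s w0 t.
Proof.
move=> cK Lc Lcj cjK qt; pose f w := rev (map c w).
have fK : involutive f.
  by move=> w; rewrite /f map_rev revK -map_comp map_id_in // => i _; apply: cK.
have fS w : size (f w) = size w by rewrite size_rev size_map.
pose g w : K := cj (s (f w)).
have g_br : @braided K I L K^o g.
  move=> x a b y; rewrite /g /f !map_cat !rev_cat /= !rev_cons -!cats1 -!catA /=.
  have -> : s (rev (map c y) ++ c b :: c a :: rev (map c x)) =
      - L (c b) (c a) * s (rev (map c y) ++ c a :: c b :: rev (map c x)).
    exact: s_br.
  by rewrite rmorphM rmorphN /= Lcj Lc.
have gE w : size w = size w0 -> g w = s w * g w0.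
  exact: (braided_sign L_diag L_sym s_br s_w0 w0_uniq w0_full g_br).
have wprodE u v : wprod (fun i j => t (c i) (c j)) u v = wprod t (map c u) (map c v).
  elim: u v => [|i u IHu] [|j v]; rewrite ?wprod_nil //; last first.
  - by rewrite /= !wprod_cons IHu.
  - by rewrite /wprod /= !big_nil.
  - by rewrite /wprod /= !big_nil.
transitivity (\sum_(w <- words I (size w0)) (g (f w)) *: wprod t (f w0) (f w)).
  apply: eq_big_seq => w _; rewrite wprodE /g fK; congr (_ *: _).
  by rewrite /f !map_rev.
rewrite (big_words_inj _ (fun w => g w *: wprod t (f w0) w)) //; last exact: inv_inj.
transitivity (g w0 *: \sum_(w <- words I (size w0)) s w *: wprod t (f w0) w).
  rewrite scaler_sumr; apply: eq_big_seq => w; rewrite mem_words => /eqP wS.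
  by rewrite gE // mulrC scalerA.
rewrite (qdet_row L_diag L_sym s_br s_w0 w0_uniq w0_full qt (fS w0)) scalerA.
have -> : g w0 * s (f w0) = 1; last by rewrite scale1r.
by rewrite mulrC -gE // /g fK s_w0 rmorph1.
Qed.

End QdetSigned.

Section QcommSum.
Variables (K : comNzRingType) (I : finType) (L : I -> I -> K).
Hypothesis L_sym : forall i j, L i j * L j i = 1.
Variables (A B : ualgebra K) (GA : graded A) (GB : graded B).

(** The contracted indices enter as [L b a] on the left and [L a b] on the right and cancel, so the
    relation passes to the contracted sums. The degrees and the factors [e], [e'] are left free so
    that all relations between functions and one-forms are instances. *)
Lemma qcomm_sum p p' q q' (t t' : I -> A) (r r' : I -> B) (e e' c d : K) :
    (forall a, homog GA p (t a)) -> (forall a, homog GA p' (t' a)) ->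
    (forall a, homog GB q (r a)) -> (forall a, homog GB q' (r' a)) ->
    (forall a b, t a * t' b = (e * c * L b a) *: (t' b * t a)) ->
    (forall a b, r a * r' b = (e' * L a b * d) *: (r' b * r a)) ->
  (\sum_a gten GA GB (t a) (r a)) * (\sum_b gten GA GB (t' b) (r' b)) =
  ((-1) ^+ (q * p' + q' * p) * e * e' * c * d) *:
    ((\sum_b gten GA GB (t' b) (r' b)) * (\sum_a gten GA GB (t a) (r a))).
Proof.
move=> tp tp' rq rq' tt rr; rewrite [in RHS]mulr_suml.
under [in RHS]eq_bigr do rewrite mulr_sumr.
rewrite exchange_big scaler_sumr mulr_suml; apply: eq_bigr => a _.
rewrite mulr_sumr scaler_sumr; apply: eq_bigr => b _.
rewrite (gtens_mulE _ _ (rq a) (tp' b)) (gtens_mulE _ _ (rq' b) (tp a)).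
rewrite tt rr gtenZl gtenZr !scalerA; congr (_ *: _).
set x := _ ^+ (q' * p); have xx : x * x = 1 by apply: signr_mul2.
rewrite exprD -/x; move: ((-1) ^+ (q * p')) (L_sym a b) xx => y Lab xx.
ring: Lab xx.
Qed.
End QcommSum.

(** * Universal properties of the presented algebras *)

Section Lifts.
Variables (K : comNzRingType).

Lemma q_alg_lift (X : Type) (q : X -> X -> K) (B : ualgebra K) (T : X -> B) :
    (forall x y, T x * T y = q x y *: (T y * T x)) ->
  exists f : {linear q_alg q -> B},
    monoid_morphism f /\ forall a, f (peval _ a) = teval T a.
Proof.
move=> TT; apply: presented_lift => a b [x y] /=.
by rewrite -uscalerAl mul1r TT.
Qed.

Definition forms_rel (X : Type) (q : X -> X -> K) (B : ualgebra K)
    (T dT : X -> B) : Prop :=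
  [/\ forall x y, T x * T y = q x y *: (T y * T x),
      forall x y, T x * dT y = q x y *: (dT y * T x) &
      forall x y, dT x * dT y = - q x y *: (dT y * dT x)].

Definition forms_gen (X : Type) (B : Type) (T dT : X -> B) (x : dgen X) : B :=
  match x with Fn y => T y | Df y => dT y end.

Lemma forms_rel_teval (X : Type) (q : X -> X -> K) (B : ualgebra K)
    (T dT : X -> B) : forms_rel q T dT ->
  forall a b, dq_rel q a b -> teval (forms_gen T dT) a = teval (forms_gen T dT) b.
Proof.
move=> [TT TD DD] a b [] x y /=; rewrite -uscalerAl mul1r.
- by rewrite TT.
- by rewrite TD.
- by rewrite DD.
Qed.

Lemma q_forms_lift (X : Type) (q : X -> X -> K) (B : ualgebra K)
    (T dT : X -> B) : forms_rel q T dT ->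
  exists f : {linear q_forms q -> B},
    monoid_morphism f /\ forall x, f (pgen _ x) = forms_gen T dT x.
Proof.
move=> /forms_rel_teval/presented_lift[f [f_hom fE]]; exists f; split=> // x.
exact: (fE (Gen x)).
Qed.

Lemma inv_lift (X : Type) rel (w : term K X) (B : ualgebra K) (g : X -> B)
    (D : B) :
    (forall a b, rel a b -> teval g a = teval g b) ->
    (forall x, D * g x = g x * D) -> teval g w * D = 1 ->
  exists f : {linear presented (inv_rel rel w) -> B},
    [/\ monoid_morphism f, forall x, f (pgen _ (Some x)) = g x &
        f (pgen _ None) = D].
Proof.
move=> grel gD wD; pose h := oapp g D.
have hE a : teval h (rename Some a) = teval g a by rewrite teval_rename.
have [a b [a' b'||]|f [f_hom fE]] := @presented_lift _ _ B h (inv_rel rel w).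
- by move=> ab; rewrite !hE; apply: grel.
- by move=> x /=; apply: gD.
- by rewrite /= hE scale1r.
exists f; split=> // [x|]; first exact: (fE (Gen (Some x))).
exact: (fE (Gen None)).
Qed.

Lemma presented_central (X : Type) (A : ualgebra K) (gen : X -> A) z :
  generates gen -> (forall x, z * gen x = gen x * z) -> forall x, z * x = x * z.
Proof.
move=> genA zgen; apply: genA => //.
- by rewrite mulr1 mul1r.
- by move=> k x zx; rewrite -uscalerAl -uscalerAr zx.
- by move=> x y zx zy; rewrite mulrDl mulrDr zx zy.
- by move=> x y zx zy; rewrite mulrA zx -mulrA zy mulrA.
Qed.
End Lifts.

(* [act a F] is the action of the form [a] on functions on words, with [dx^i]
   appending [i] to the argument and [x^i] acting by [0]. *)
Section WordAction.
Variables (K : numFieldType) (I : finType) (L : I -> I -> K).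

Fixpoint act (a : term K (dgen I)) (F : seq I -> K^o) : seq I -> K^o :=
  match a with
  | Gen (Fn _) => fun _ => 0
  | Gen (Df i) => fun w => F (w ++ [:: i])
  | Scal k => fun w => k * F w
  | Add a b => fun w => act a F w + act b F w
  | Mul a b => act a (act b F)
  end.

Lemma act_braided a F : braided L F -> braided L (act a F).
Proof.
elim: a F => [[i|i]|k|a IHa b IHb|a IHa b IHb] F bF x c d y /=.
- by rewrite scaler0.
- by rewrite -!catA; apply: bF.
- by rewrite bF /GRing.scale /= mulrCA.
- by rewrite (IHa _ bF) (IHb _ bF) -scalerDr.
- exact/IHa/IHb.
Qed.

Lemma act_lin a k F G w :
  act a (fun v => k * F v + G v) w = k * act a F w + act a G w.
Proof.
elim: a w F G => [[i|i]|l|a IHa b IHb|a IHa b IHb] w F G //=.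
- by rewrite mulr0 addr0.
- by rewrite mulrDr mulrCA.
- by rewrite IHa IHb mulrDr addrACA.
rewrite -IHa; congr (act a _ w); apply/funext => v; exact: IHb.
Qed.

Lemma actD a F G w : act a (fun v => F v + G v) w = act a F w + act a G w.
Proof.
rewrite -[act a F w]mul1r -act_lin; congr (act a _ w); apply/funext => v.
by rewrite mul1r.
Qed.

Lemma act0 a w : act a (fun=> 0) w = 0.
Proof.
elim: a w => [[i|i]|k|a IHa b IHb|a IHa b IHb] w //=.
- by rewrite mulr0.
- by rewrite IHa IHb addr0.
by rewrite (_ : act b _ = fun=> 0) ?IHa //; apply/funext.
Qed.

Lemma actZ a k F w : act a (fun v => k * F v) w = k * act a F w.
Proof.
rewrite -[RHS]addr0 -(act0 a w) -act_lin; congr (act a _ w); apply/funext => v.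
by rewrite addr0.
Qed.

(** The two sides of a relation between one-forms append two letters in opposite orders, hence agree
    on braided functions; [act_braided] keeps the action inside that space. *)
Lemma act_cong a b : pres_cong (dq_rel L) a b ->
  forall F, braided L F -> act a F = act b F.
Proof.
elim=> {a b} /=.
- move=> a b [] i j F bF /=; apply/funext => w; rewrite ?mulr0 ?act0 //.
  by rewrite -!catA bF.
- by [].
- by move=> a b _ IH F bF; rewrite IH.
- by move=> a b c _ IH _ IH' F bF; rewrite IH // IH'.
- by move=> a a' b b' _ IH _ IH' F bF; rewrite IH // IH'.
- move=> a a' b b' _ IH _ IH' F bF; rewrite IH' // IH //; exact: act_braided.
- by move=> a b c F _; apply/funext => w; rewrite addrA.
- by move=> a b F _; apply/funext => w; rewrite addrC.
- by move=> a F _; apply/funext => w; rewrite mul0r add0r.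
- by [].
- by move=> a F _; apply/funext => w; rewrite !mul0r.
- by move=> a F _; apply/funext => w; rewrite mul1r.
- by [].
- by move=> a b c F _; apply/funext => w; rewrite actD.
- by move=> k l F _; apply/funext => w; rewrite mulrDl.
- by move=> k l F _; apply/funext => w; rewrite mulrA.
- by move=> k a F _; apply/funext => w; rewrite actZ.
Qed.

(** The functional lets a form act on [s] and evaluates at the empty word; a product of [dx^i]
    appends its letters in order, so [s] is evaluated at the word itself. *)
Lemma sign_functional (s : seq I -> K^o) : braided L s ->
  exists phi : {scalar q_forms L},
    forall w, phi (\prod_(i <- w) pgen (dq_rel L) (Df i)) = s w.
Proof.
move=> s_br.
pose Phi (x : q_forms L) F := act (repr (x : pres_sort (dq_rel L))) F.
have PhiE a F : braided L F -> Phi (peval _ a) F = act a F.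
  by move=> bF; apply: act_cong bF; apply: repr_pcls.
have PhiM x y F : braided L F -> Phi (x * y) F = Phi x (Phi y F).
  move=> bF; elim/presW: x => a; elim/presW: y => b.
  rewrite -pevalM (PhiE _ _ bF) (PhiE b _ bF) PhiE //; exact: act_braided.
have PhiD x y F : braided L F -> Phi (x + y) F = fun w => Phi x F w + Phi y F w.
  move=> bF; elim/presW: x => a; elim/presW: y => b.
  by rewrite -pevalD !(PhiE _ _ bF).
have PhiZ k x F : braided L F -> Phi (k *: x) F = fun w => k * Phi x F w.
  move=> bF; rewrite -[x in LHS]mul1r uscalerAl PhiM // -peval_scal PhiE //.
  exact: act_braided.
have phi_lin : scalar (fun x => Phi x s [::]).
  by move=> k x y; rewrite PhiD // PhiZ.
exists (scalar_of phi_lin) => w.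
suff PhiP v : Phi (\prod_(i <- w) pgen (dq_rel L) (Df i)) s v = s (v ++ w).
  exact: PhiP.
elim: w v => [|i w IHw] v.
  by rewrite big_nil -[1]scale1r -peval_scal PhiE //= mul1r cats0.
rewrite big_cons PhiM // PhiE; last exact: act_braided.
by rewrite /= IHw -catA.
Qed.
End WordAction.

(** * The determinant of the theta-deformed matrices *)

Section ThetaFacts.
Variables (R : realType) (n : nat) (theta : 'M[R]_n) (b : bool).
Hypothesis theta_anti : theta^T = - theta.
Local Notation I := (idx n b).
Local Notation L := (@Lam R n theta b).
Local Notation conjI := (@conj_idx n b).

Let thetaE mu nu : theta nu mu = - theta mu nu.
Proof. by have /matrixP/(_ mu nu) := theta_anti; rewrite !mxE. Qed.

Let lam_conj mu nu : conjc (lam theta mu nu) = lam theta nu mu.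
Proof. by rewrite /lam (thetaE mu nu) trigo.cosN trigo.sinN. Qed.

Let lam_sym mu nu : lam theta mu nu * lam theta nu mu = 1.
Proof.
rewrite -(lam_conj mu nu) /lam; have := trigo.cos2Dsin2 (theta mu nu).
move: (trigo.cos _) (trigo.sin _) => c s cs; apply/eqP; rewrite eq_complex /=.
by rewrite mulrN opprK -!expr2 cs eqxx mulrN [s * c]mulrC addNr eqxx.
Qed.

Let lam_diag mu : lam theta mu mu = 1.
Proof.
have th0 : theta mu mu = 0.
  have /eqP := thetaE mu mu; rewrite -subr_eq0 opprK -mulr2n -mulr_natr mulf_eq0.
  by rewrite Num.Theory.pnatr_eq0 orbF => /eqP.
by rewrite /lam th0 trigo.cos0 trigo.sin0.
Qed.

Lemma Lam_diag i : L i i = 1.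
Proof. by case: i => [[mu|mu]|k] //=; apply: lam_diag. Qed.

Lemma Lam_sym i j : L i j * L j i = 1.
Proof.
by case: i j => [[mu|mu]|k] [[nu|nu]|l] /=; rewrite ?mulr1 ?lam_sym.
Qed.

Lemma conj_idxK : involutive conjI.
Proof. by case=> [[mu|mu]|k]. Qed.

Lemma Lam_conj_idx i j : L (conjI i) (conjI j) = L i j.
Proof. by case: i j => [[mu|mu]|k] [[nu|nu]|l]. Qed.

Lemma conjc_Lam i j : conjc (L i j) = L j i.
Proof.
by case: i j => [[mu|mu]|k] [[nu|nu]|l]; first [exact: lam_conj|exact: rmorph1].
Qed.

(** An index and its conjugate contribute reciprocal factors, and the index [0] contributes [1].
    Hence [qdet_qcomm] applies with the factors coming from the generators. *)
Lemma Lam_prodl j : \prod_i L i j = 1.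
Proof.
rewrite big_sumType /= big_sumType /= -big_split /=.
rewrite [X in _ * X]big1 ?mulr1; last by case: j => [[nu|nu]|l].
rewrite big1 // => mu _.
by case: j => [[nu|nu]|l] /=; rewrite ?lam_sym ?mulr1.
Qed.

Lemma Lam_prodr i : \prod_j L i j = 1.
Proof.
have LV j : L i j = (L j i)^-1.
  by apply: (mulIf (L_neq0 Lam_sym j i)); rewrite Lam_sym mulVf // (L_neq0 Lam_sym).
under eq_bigr do rewrite LV.
by rewrite prodfV Lam_prodl invr1.
Qed.

(* The order of the factors of [Omega0]. *)
Definition top_word : seq I :=
  flatten [seq [:: ixbar b mu; ix b mu] | mu <- index_enum 'I_n] ++
  [seq ix0 n k | k <- index_enum 'I_b].

Lemma top_word_full i : i \in top_word.
Proof.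
rewrite mem_cat; case: i => [[mu|mu]|k].
- apply/orP; left; apply/flatten_mapP; exists mu; rewrite ?mem_index_enum //.
  by rewrite !inE eqxx orbT.
- apply/orP; left; apply/flatten_mapP; exists mu; rewrite ?mem_index_enum //.
  by rewrite !inE eqxx.
by apply/orP; right; apply/mapP; exists k; rewrite ?mem_index_enum.
Qed.

Lemma top_word_uniq : uniq top_word.
Proof.
apply: (leq_size_uniq (enum_uniq I)) => [i _|]; first exact: top_word_full.
have sizeE (T : finType) : size (index_enum T) = #|T|.
  by rewrite cardE enumT [index_enum T]unlock.
rewrite size_cat size_flatten /shape -map_comp size_map sizeE -cardE.
rewrite !card_sum !card_ord sumnE big_map /=.
by rewrite sum_nat_const card_ord muln2 addnn.
Qed.

Lemma Omega0E : Omega0 theta b = \prod_(i <- top_word) dxi theta i.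
Proof.
rewrite /Omega0 /top_word big_cat big_flatten !big_map.
congr (_ * _); apply: eq_bigr => mu _.
by rewrite !big_cons big_nil /= mulr1.
Qed.
End ThetaFacts.

Section PresentedRelations.
Variables (K : comNzRingType) (X : Type).

Lemma pgen_q_rel (q : X -> X -> K) x y :
  pgen (q_rel q) x * pgen (q_rel q) y = q x y *: (pgen _ y * pgen _ x).
Proof.
have := peval_rel (q_xx q x y).
by rewrite !pevalM peval_scal -uscalerAl mul1r.
Qed.

Lemma pgen_dq_rel (q : X -> X -> K) :
  forms_rel q (fun x => pgen (dq_rel q) (Fn x)) (fun x => pgen (dq_rel q) (Df x)).
Proof.
split=> x y.
- by have := peval_rel (dq_xx q x y); rewrite !pevalM peval_scal -uscalerAl mul1r.
- by have := peval_rel (dq_xd q x y); rewrite !pevalM peval_scal -uscalerAl mul1r.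
- by have := peval_rel (dq_dd q x y); rewrite !pevalM peval_scal -uscalerAl mul1r.
Qed.

Variables (rel : term K X -> term K X -> Prop) (w : term K X).
Local Notation irel := (inv_rel rel w).
Local Notation old := (fun x => pgen irel (Some x)).

Lemma peval_rename_Some a : peval irel (rename Some a) = teval old a.
Proof. by rewrite -teval_peval teval_rename. Qed.

Lemma inv_pgen_rel a c : rel a c -> teval old a = teval old c.
Proof. by move=> ac; rewrite -!peval_rename_Some; apply/peval_rel/inv_old. Qed.

Lemma inv_pgen_central y : pgen irel None * y = y * pgen irel None.
Proof.
apply: (presented_central (@pgen_generates _ _ irel)) => -[x|] //.
by have := peval_rel (inv_central rel w x); rewrite !pevalM.
Qed.

Lemma inv_pgen_mul : teval old w * pgen irel None = 1.
Proof.
rewrite -peval_rename_Some; have := peval_rel (inv_inv rel w).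
by rewrite pevalM peval_scal scale1r.
Qed.
End PresentedRelations.

Lemma inv_pgen_forms_rel (K : comNzRingType) (X : Type) (q : X -> X -> K) w :
  forms_rel q (fun x => pgen (inv_rel (dq_rel q) w) (Some (Fn x)))
    (fun x => pgen (inv_rel (dq_rel q) w) (Some (Df x))).
Proof.
split=> x y.
- by have := inv_pgen_rel w (dq_xx q x y); rewrite /= -uscalerAl mul1r.
- by have := inv_pgen_rel w (dq_xd q x y); rewrite /= -uscalerAl mul1r.
- by have := inv_pgen_rel w (dq_dd q x y); rewrite /= -uscalerAl mul1r.
Qed.

(** * Identification of [det_theta] *)

Section Determinant.
Variables (R : realType) (n : nat) (theta : 'M[R]_n) (b : bool).
Hypothesis theta_anti : theta^T = - theta.
Local Notation C := (R[i]).
Local Notation I := (idx n b).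
Local Notation L := (@Lam R n theta b).
Local Notation w0 := (top_word n b).
Variable s : seq I -> C.
Hypotheses (s_br : @braided C I L C^o s) (s_w0 : s w0 = 1).

Let L_diag := @Lam_diag R n theta b theta_anti.
Let L_sym := @Lam_sym R n theta b theta_anti.
Let w0U := top_word_uniq n b.
Let w0F := @top_word_full n b.

Lemma tM_quantum : quantum_matrix L (tM theta (b := b)).
Proof. by move=> i j k l; rewrite /tM pgen_q_rel. Qed.

(** The coaction sends [dx^v] to the sum of [t_{v,z} ⊗ dx^z] over words [z]; for [v = w0],
    [braided_sign] replaces [dx^z] by [s z] times [Omega0]. *)
Lemma is_det_qdet : is_det (qdet s w0 (tM theta (b := b))).
Proof.
set M := Mtheta theta b; set O := OmegaR theta b.
pose T (i : I) : gtens (triv_graded M) (triv_graded O) :=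
  \sum_j gten _ _ (tM theta i j) (xi theta j).
pose dT (i : I) : gtens (triv_graded M) (triv_graded O) :=
  \sum_j gten _ _ (tM theta i j) (dxi theta j).
have [xx xd dd] := pgen_dq_rel L.
have tt i k a c : tM theta i a * tM theta k c =
    (1 * L i k * L c a) *: (tM theta k c * tM theta i a).
  by rewrite mul1r tM_quantum.
have sumP (r r' : I -> O) e i k :
    (forall a c, r a * r' c = (e * L a c) *: (r' c * r a)) ->
  (\sum_j gten (triv_graded M) (triv_graded O) (tM theta i j) (r j)) *
  (\sum_j gten (triv_graded M) (triv_graded O) (tM theta k j) (r' j)) =
  (e * L i k) *: ((\sum_j gten _ _ (tM theta k j) (r' j)) *
    \sum_j gten _ _ (tM theta i j) (r j)).
  move=> rr; rewrite (@qcomm_sum _ _ L L_sym _ _ _ _ 0 0 0 0 _ _ _ _ 1 e (L i k) 1) //.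
    by congr (_ *: _); rewrite expr0 !mul1r mulr1.
  by move=> a c; rewrite mulr1.
have TdT : forms_rel L T dT.
  split=> i k; rewrite /T /dT.
  - by rewrite (sumP _ _ 1) ?mul1r // => a c; rewrite mul1r; apply: xx.
  - by rewrite (sumP _ _ 1) ?mul1r // => a c; rewrite mul1r; apply: xd.
  - by rewrite (sumP _ _ (-1)) ?mulN1r // => a c; rewrite mulN1r; apply: dd.
have [rho [rho_hom rhoE]] := q_forms_lift TdT.
exists rho; split=> // [i|i|]; [exact: (rhoE (Fn i))|exact: (rhoE (Df i))|].
have rho_word v : rho (\prod_(i <- v) dxi theta i) =
    \sum_(z <- words I (size v)) gten (triv_graded M) (triv_graded O)
      (wprod (tM theta (b := b)) v z) (\prod_(i <- z) dxi theta i).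
  elim: v => [|i v IHv] /=.
    by rewrite big_seq1 wprod_nil !big_nil (fst rho_hom).
  rewrite big_cons (snd rho_hom) IHv (rhoE (Df i)) /= /dT big_wordsS mulr_suml.
  apply: eq_bigr => k _; rewrite mulr_sumr; apply: eq_bigr => z _.
  by rewrite triv_gtenM wprod_cons big_cons.
have dxi_br : braided L (fun v => \prod_(i <- v) dxi theta i).
  move=> x a c y; rewrite !big_cat !big_cons /= [dxi _ a * _]mulrA.
  by rewrite [dxi _ a * _]dd -uscalerAl -uscalerAr -!mulrA.
rewrite Omega0E rho_word /qdet gten_suml; apply: eq_big_seq => z.
rewrite mem_words => /eqP zS.
rewrite (braided_sign L_diag L_sym s_br s_w0 w0U w0F dxi_br zS).
by rewrite gtenZl gtenZr.
Qed.

(** As [det_theta] is selected by [xget], uniqueness is needed as well: the coaction is fixed by its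
    values on generators, and a linear form with value [1] on [Omega0], applied to the second
    factor, extracts [D]. *)
Lemma det_thetaE : det_theta theta b = qdet s w0 (tM theta (b := b)).
Proof.
have det_unique D D' : is_det (theta := theta) (b := b) D -> is_det D' -> D = D'.
  move=> [rho [r_hom rx rd rO]] [rho' [r_hom' rx' rd' rO']].
  have rr' : rho =1 rho'.
    apply: (hom_ext (@pgen_generates _ _ _) r_hom r_hom') => -[i|i].
      by rewrite [LHS]rx [RHS]rx'.
    by rewrite [LHS]rd [RHS]rd'.
  have [phi phiE] := sign_functional s_br.
  have phiO : phi (Omega0 theta b) = 1 by rewrite Omega0E phiE.
  have := congr1 (uformr (Mtheta theta b) phi) rO.
  by rewrite rr' rO' !uformrE phiO !scale1r.
have := @xgetPex _ 0 [set D : Mtheta theta b | is_det D]%classic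
  (ex_intro _ _ is_det_qdet).
by move=> /det_unique; apply; apply: is_det_qdet.
Qed.

(** The representative [det_term] is arbitrary, but its value at a quantum matrix factors through
    [Mtheta], where it represents [det_theta]. *)
Lemma teval_det_term (B : ualgebra C) (T : I -> I -> B) : quantum_matrix L T ->
  teval (fun x => T x.1 x.2) (det_term theta b) = qdet s w0 T.
Proof.
move=> qT; have [|f [f_hom fE]] := @q_alg_lift _ _ (LamM theta (b := b)) B
  (fun x => T x.1 x.2).
  by move=> x y; apply: qT.
rewrite -fE [peval _ _]pcls_repr -/(det_theta theta b) det_thetaE qdet_hom //.
by apply: eq_qdet => i j; apply: (fE (Gen (i, j))).
Qed.
End Determinant.

(** * The Hopf algebra of forms on the theta-deformed general linear group *)

Section FormsRel.
Variables (K : comNzRingType) (X : Type) (q : X -> X -> K).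
Variables (A : ualgebra K) (t dt : X -> A).

Lemma poly_forms_rel : forms_rel q t dt ->
  forms_rel q
    (fun x => gten (triv_graded A) (triv_graded (poly_ua K)) (t x) 'X^0)
    (fun x => gten (triv_graded A) (triv_graded (poly_ua K)) (dt x) 'X^1).
Proof.
move=> [tt td dd]; split=> x y.
- by rewrite !triv_gtenM tt gtenZl.
- rewrite !triv_gtenM td gtenZl; congr (_ *: gten _ _ _ _).
  by rewrite !poly_uaM mulrC.
- by rewrite !triv_gtenM dd gtenZl.
Qed.

Variable G : graded A.
Hypotheses (t0 : forall x, homog G 0 (t x)) (dt1 : forall x, homog G 1 (dt x)).

(** The second entries are the differentiated relations; [q_sym] supplies the rule for [dt x * t y]
    from the one for [t y * dt x]. *)
Lemma tri_forms_rel : (forall x y, q x y * q y x = 1) -> forms_rel q t dt ->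
  forms_rel q (fun x => tr G (t x) (dt x)) (fun x => tr G (dt x) 0).
Proof.
move=> q_sym [tt td dd].
have dtE x y : dt x * t y = q x y *: (t y * dt x).
  by rewrite td scalerA q_sym scale1r.
have gt x : gsgn G (t x) = t x by rewrite (gsgn_homog (t0 x)) expr0 scale1r.
have gdt x : gsgn G (dt x) = - dt x by rewrite (gsgn_homog (dt1 x)) expr1 scaleN1r.
split=> x y; rewrite !trM trZ ?gt ?gdt; congr (tr G _ _) => //.
- by rewrite scalerDr dtE -td addrC.
- rewrite mul0r add0r mulr0 addr0.
  by rewrite dd mulNr scalerN scaleNr.
- by rewrite !mul0r !mulr0 addr0 scaler0.
Qed.

Lemma gop_forms_rel (tau : {rmorphism K -> K}) :
    (forall x y, t y * t x = tau (q x y) *: (t x * t y)) ->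
    (forall x y, dt y * t x = tau (q x y) *: (t x * dt y)) ->
    (forall x y, dt y * dt x = - tau (q x y) *: (dt x * dt y)) ->
  forms_rel q (t : X -> gop tau G) dt.
Proof.
move=> tt td dd; split=> x y; rewrite gop_scaleE.
- rewrite (gop_mulE tau (t0 x) (t0 y)) (gop_mulE tau (t0 y) (t0 x)).
  by rewrite !scale1r tt.
- rewrite (gop_mulE tau (t0 x) (dt1 y)) (gop_mulE tau (dt1 y) (t0 x)).
  by rewrite !scale1r td.
rewrite (gop_mulE tau (dt1 x) (dt1 y)) (gop_mulE tau (dt1 y) (dt1 x)).
by rewrite rmorphN dd !scalerA mulrC.
Qed.
End FormsRel.

(** * Differentials of products and inverses *)

Section Intertwining.
Variables (K : comNzRingType) (A B : ualgebra K) (GA : graded A) (GB : graded B).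
Variables (dA : {linear A -> A}) (dB : {linear B -> B}).
Hypotheses (dAA : antiderivation GA dA) (dBB : antiderivation GB dB).

Section Square.
Let P (y : A) := homog GA 0 y /\ dA (dA y) = 0.

Lemma antider_sqM x y : P x -> P y -> P (x * y).
Proof.
move=> [x0 ddx] [y0 ddy]; have [dh dM] := dAA; split; first exact: (homogM x0 y0).
rewrite (dM _ _ _ x0) scale1r linearD (dM _ _ _ (dh _ _ x0)) (dM _ _ _ x0).
by rewrite ddx ddy mul0r mulr0 scaler0 addr0 add0r expr1 scaleN1r addNr.
Qed.

(** In the second differential of [y * u = 1] the two terms with [dA y * dA u] cancel, which leaves
    [y * dA (dA u) = 0]. *)
Lemma antider_sqV y u : P y -> homog GA 0 u -> y * u = 1 -> u * y = 1 ->
  dA (dA u) = 0.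
Proof.
move=> [y0 ddy] u0 yu uy; have [dh dM] := dAA.
have : dA (dA (y * u)) = 0 by rewrite yu (antider1 dAA) linear0.
rewrite (dM _ _ _ y0) scale1r linearD (dM _ _ _ (dh _ _ y0)) (dM _ _ _ y0) ddy.
rewrite mul0r add0r expr1 scaleN1r scale1r addrA addNr add0r => yddu.
by rewrite -[LHS]mul1r -uy -mulrA yddu mulr0.
Qed.

Lemma antider_sqD x y : P x -> P y -> P (x + y).
Proof.
move=> [x0 ddx] [y0 ddy]; split; first exact: homogD.
by rewrite !linearD /= ddx ddy addr0.
Qed.
Lemma antider_sqZ k x : P x -> P (k *: x).
Proof.
by move=> [x0 ddx]; split; [exact: homogZ|rewrite !linearZ /= ddx scaler0].
Qed.
Lemma antider_sq0 : P 0.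
Proof. by split; [exact: linear0|rewrite !linear0]. Qed.
Lemma antider_sq1 : P 1.
Proof. by split; [exact: homog1|rewrite (antider1 dAA) linear0]. Qed.
End Square.

Section Hom.
Variable f : {linear A -> B}.
Hypotheses (f_hom : monoid_morphism f) (f_gr : graded_hom GA GB f).
Let P (y : A) := homog GA 0 y /\ f (dA y) = dB (f y).

Lemma hom_difM x y : P x -> P y -> P (x * y).
Proof.
move=> [x0 fx] [y0 fy]; split; first exact: (homogM x0 y0).
case: f_hom => f1 fM; rewrite (dAA.2 _ _ _ x0) linearD linearZ /= !fM fx fy.
by rewrite (dBB.2 _ _ _ (f_gr x0)).
Qed.

(** Both sides are given by [antider_inv], so compatibility at the determinant passes to its
    inverse. *)
Lemma hom_difV y u : P y -> homog GA 0 u -> y * u = 1 -> u * y = 1 ->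
  f (dA u) = dB (f u).
Proof.
move=> [y0 fy] u0 yu uy; case: f_hom => f1 fM.
rewrite (antider_inv dAA y0 u0 yu uy) linearN /= !fM fy.
by rewrite -(antider_inv dBB (f_gr y0) (f_gr u0)) // -fM ?yu ?uy f1.
Qed.

Lemma hom_difD x y : P x -> P y -> P (x + y).
Proof.
by move=> [x0 fx] [y0 fy]; split; [exact: homogD|rewrite !linearD /= fx fy].
Qed.
Lemma hom_difZ k x : P x -> P (k *: x).
Proof.
by move=> [x0 fx]; split; [exact: homogZ|rewrite !linearZ /= fx].
Qed.
Lemma hom_dif0 : P 0.
Proof. by split; [exact: linear0|rewrite !linear0]. Qed.
Lemma hom_dif1 : P 1.
Proof.
case: f_hom => f1 _; split; first exact: homog1.
by rewrite f1 (antider1 dAA) (antider1 dBB) linear0.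
Qed.
End Hom.

Section Antihom.
Variables (tau : {rmorphism K -> K}) (f : A -> B).
Hypothesis f_anti : graded_antihom GA GB tau f.
Let P (y : A) := homog GA 0 y /\ f (dA y) = dB (f y).

Lemma antihom_difM x y : P x -> P y -> P (x * y).
Proof.
move=> [x0 fx] [y0 fy]; split; first exact: (homogM x0 y0).
case: f_anti => fD fZ f1 fh fM; rewrite (dAA.2 _ _ _ x0) scale1r fD.
rewrite (fM _ _ _ _ (dAA.1 _ _ x0) y0) (fM _ _ _ _ x0 (dAA.1 _ _ y0)).
rewrite (fM _ _ _ _ x0 y0) !scale1r (dBB.2 _ _ _ (fh _ _ y0)) fx fy.
by rewrite scale1r addrC.
Qed.

Lemma antihom_difV y u : P y -> homog GA 0 u -> y * u = 1 -> u * y = 1 ->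
  f (dA u) = dB (f u).
Proof.
move=> [y0 fy] u0 yu uy; case: f_anti => fD fZ f1 fh fM.
have dy1 := dAA.1 _ _ y0.
have fM0 a c : homog GA 0 a -> homog GA 0 c -> f (a * c) = f c * f a.
  by move=> a0 c0; rewrite (fM _ _ _ _ a0 c0) scale1r.
have fN a : f (- a) = - f a by rewrite -scaleN1r fZ rmorphN1 scaleN1r.
rewrite (antider_inv dAA y0 u0 yu uy) fN (fM _ _ _ _ (homogM u0 dy1) u0).
rewrite (fM _ _ _ _ u0 dy1) muln0 mul0n !scale1r mulrA fy.
by rewrite -(antider_inv dBB (fh _ _ y0) (fh _ _ u0)) // -fM0 // ?yu ?uy.
Qed.

Lemma antihom_difD x y : P x -> P y -> P (x + y).
Proof.
case: f_anti => fD _ _ _ _ [x0 fx] [y0 fy]; split; first exact: homogD.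
by rewrite !(linearD dA, linearD dB, fD) fx fy.
Qed.
Lemma antihom_difZ k x : P x -> P (k *: x).
Proof.
case: f_anti => _ fZ _ _ _ [x0 fx]; split; first exact: homogZ.
by rewrite linearZ /= !fZ linearZ /= fx.
Qed.
Lemma antihom_dif0 : P 0.
Proof.
case: f_anti => fD _ _ _ _; split; first exact: linear0.
by rewrite linear0 (additive0 fD) linear0.
Qed.
Lemma antihom_dif1 : P 1.
Proof.
case: f_anti => fD _ f1 _ _; split; first exact: homog1.
by rewrite f1 (antider1 dAA) (antider1 dBB) (additive0 fD).
Qed.
End Antihom.
End Intertwining.

(** * Universal property and grading of the forms *)

Section OmegaGL.
Variables (R : realType) (n : nat) (theta : 'M[R]_n) (b : bool).
Hypothesis theta_anti : theta^T = - theta.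
Local Notation C := (R[i]).
Local Notation I := (idx n b).
Local Notation L := (@Lam R n theta b).
Local Notation LM := (LamM theta (b := b)).
Local Notation w0 := (top_word n b).
Local Notation t := (tGL theta (b := b)).
Local Notation dt := (dtGL theta (b := b)).
Local Notation dinv := (detinv theta b).
Local Notation uncurry T := (fun x => T x.1 x.2).
Variable s : seq I -> C.
Hypotheses (s_br : @braided C I L C^o s) (s_w0 : s w0 = 1).

Let L_sym := @Lam_sym R n theta b theta_anti.
Let detE := teval_det_term theta_anti s_br s_w0.

Lemma LamM_sym x y : LM x y * LM y x = 1.
Proof. by rewrite /LamM mulrACA L_sym mul1r mulrC L_sym. Qed.

(** The inverse relation of the presentation involves an unspecified term; by [teval_det_term] it
    becomes a condition on [qdet]. *)
Lemma OmegaGL_lift (B : ualgebra C) (T dT : I -> I -> B) (D : B) :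
    forms_rel LM (uncurry T) (uncurry dT) ->
    (forall i j, D * T i j = T i j * D) -> (forall i j, D * dT i j = dT i j * D) ->
    qdet s w0 T * D = 1 ->
  exists f : {linear OmegaGL theta b -> B},
    [/\ monoid_morphism f, forall i j, f (t i j) = T i j,
        forall i j, f (dt i j) = dT i j & f dinv = D].
Proof.
move=> TdT DT DdT TD; have [TT _ _] := TdT.
have [|[[i j]|[i j]]||f [f_hom fS fN]] := @inv_lift _ _ (dq_rel LM)
   (rename (@Fn _) (det_term theta b)) B (forms_gen (uncurry T) (uncurry dT)) D.
- exact: forms_rel_teval.
- exact: DT.
- exact: DdT.
- rewrite teval_rename -[RHS]TD -(detE (T := T)) //.
  by move=> i j k l; apply: (TT (i, j) (k, l)).
by exists f; split=> // i j; rewrite [LHS]fS.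
Qed.

Lemma CGL_lift (B : ualgebra C) (T : I -> I -> B) (D : B) :
    quantum_matrix L T -> (forall i j, D * T i j = T i j * D) ->
    qdet s w0 T * D = 1 ->
  exists f : {linear CGL theta b -> B},
    [/\ monoid_morphism f, forall i j, f (tC theta i j) = T i j &
        f (detinvC theta b) = D].
Proof.
move=> TT DT TD.
have [x y [x' y']|[i j]||f [f_hom fS fN]] := @inv_lift _ _ (q_rel LM)
   (det_term theta b) B (uncurry T) D.
- by rewrite /= -uscalerAl mul1r; apply: TT.
- exact: DT.
- by rewrite -[RHS]TD -(detE (T := T)).
by exists f; split=> // i j; rewrite [LHS]fS.
Qed.

Lemma GL_forms_rel : forms_rel LM (uncurry t) (uncurry dt).
Proof.
have [tt td dd] := inv_pgen_forms_rel LM (rename (@Fn _) (det_term theta b)).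
by split=> -[i j] [k l]; [apply: tt|apply: td|apply: dd].
Qed.

Lemma tGL_quantum : quantum_matrix L t.
Proof. by move=> i j k l; have [tt _ _] := GL_forms_rel; apply: (tt (i, j) (k, l)). Qed.

Lemma tC_quantum : quantum_matrix L (tC theta (b := b)).
Proof.
move=> i j k l; have := inv_pgen_rel (det_term theta b) (q_xx LM (i, j) (k, l)).
by rewrite /= -uscalerAl mul1r.
Qed.

Lemma detinv_central x : dinv * x = x * dinv.
Proof. exact: inv_pgen_central. Qed.

Lemma detinvC_central x : detinvC theta b * x = x * detinvC theta b.
Proof. exact: inv_pgen_central. Qed.

Lemma detGLE : detGL theta b = qdet s w0 t.
Proof.
rewrite /detGL peval_rename_Some teval_rename -(detE tGL_quantum).
by apply: eq_teval => -[i j].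
Qed.

Lemma qdet_detinv : qdet s w0 t * dinv = 1.
Proof.
rewrite -detGLE /detGL peval_rename_Some.
exact: (inv_pgen_mul (dq_rel LM) (rename (@Fn _) (det_term theta b))).
Qed.

Lemma detinv_qdet : dinv * qdet s w0 t = 1.
Proof. by rewrite detinv_central qdet_detinv. Qed.

Lemma qdetC_detinv : qdet s w0 (tC theta (b := b)) * detinvC theta b = 1.
Proof.
have := inv_pgen_mul (q_rel LM) (det_term theta b) => <-.
congr (_ * _); rewrite -(detE tC_quantum).
by apply: eq_teval => -[i j].
Qed.

Definition degGL (x : option (dgen (I * I))) : nat :=
  if x is Some (Df _) then 1 else 0.

Local Notation genGL :=
  (pgen (inv_rel (dq_rel LM) (rename (@Fn _) (det_term theta b)))).

Lemma genGL_generates : generates (genGL : _ -> OmegaGL theta b).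
Proof. exact: pgen_generates. Qed.

Lemma OmegaGL_graded :
  exists G : graded (OmegaGL theta b), forall x, homog G (degGL x) (genGL x).
Proof.
pose P := poly_ua C; pose A := OmegaGL theta b.
pose e (p : nat) (a : A) := gten (triv_graded A) (triv_graded P) a 'X^p.
have e0_lin : linear (e 0%N) by move=> k x y; rewrite /e gtenDl gtenZl.
(* Tensoring with [1] on the right is a homomorphism, so it carries over the relation between the
   determinant and its inverse. *)
have e0_hom : monoid_morphism (linear_of e0_lin).
  split; first by rewrite /= /e expr0.
  move=> x y; change (e 0%N (x * y) = e 0%N x * e 0%N y).
  by rewrite /e triv_gtenM poly_uaM expr0 mulr1.
have ecomm p a : e 0%N dinv * e p a = e p a * e 0%N dinv.
  by rewrite /e !triv_gtenM detinv_central !poly_uaM mulrC.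
have [||||rho [r_hom rt rdt rd]] := @OmegaGL_lift _
  (fun i j => e 0%N (t i j)) (fun i j => e 1%N (dt i j)) (e 0%N dinv).
- exact: (poly_forms_rel GL_forms_rel).
- by move=> i j; apply: ecomm.
- by move=> i j; apply: ecomm.
- have := qdet_hom s w0 t e0_hom => /esym ->.
  rewrite -[e 0%N dinv]/(linear_of e0_lin dinv) -(snd e0_hom) qdet_detinv.
  exact: (fst e0_hom).
apply: (graded_of (rho := rho) genGL_generates r_hom) => -[[[i j]|[i j]]|].
- exact: rt.
- exact: rdt.
- exact: rd.
Qed.
End OmegaGL.

Lemma antider_gsgn (K : comNzRingType) (A : ualgebra K) (G : graded A) d x y :
  antiderivation G d -> d (x * y) = d x * y + gsgn G x * d y.
Proof.
move=> [dh dM]; move: x; apply: (homog_ind (G := G)) => [|x x' IH IH'|p x xp].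
- by rewrite mul0r gsgn0 linear0 !mul0r addr0.
- rewrite mulrDl gsgnD !(linearD d) (mulrDl (d x)) (mulrDl (gsgn G x)).
  by rewrite addrACA IH IH'.
by rewrite (dM _ _ _ xp) (gsgn_homog xp) -uscalerAl.
Qed.

(** Converse of [antider_of]: once a differential exists, facts on quantum matrices can be applied
    to the pairs [(x, d x)] and thereby differentiated. *)
Lemma antider_graph (K : comNzRingType) (A : ualgebra K) (G : graded A) d :
    antiderivation G d ->
  exists2 h : {linear A -> tri G}, monoid_morphism h & forall x, h x = tr G x (d x).
Proof.
move=> dA; have h_lin : linear (fun x => tr G x (d x)).
  by move=> k x y; rewrite trZ trD linearP.
exists (linear_of h_lin) => //; split=> [|x y] /=.
  by rewrite (antider1 dA) tr1.
change (tr G (x * y) (d (x * y)) = tr G x (d x) * tr G y (d y)).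
by rewrite trM (antider_gsgn _ _ dA).
Qed.

(** * Differential and involution *)

Section OmegaGLGida.
Variables (R : realType) (n : nat) (theta : 'M[R]_n) (b : bool).
Hypothesis theta_anti : theta^T = - theta.
Local Notation C := (R[i]).
Local Notation I := (idx n b).
Local Notation L := (@Lam R n theta b).
Local Notation LM := (LamM theta (b := b)).
Local Notation w0 := (top_word n b).
Local Notation c := (@conj_idx n b).
Local Notation t := (tGL theta (b := b)).
Local Notation dt := (dtGL theta (b := b)).
Local Notation dinv := (detinv theta b).
Local Notation uncurry T := (fun x => T x.1 x.2).
Local Notation genGL :=
  (pgen (inv_rel (dq_rel LM) (rename (@Fn _) (det_term theta b)))).
Local Notation A := (OmegaGL theta b).
Variable s : seq I -> C.
Hypotheses (s_br : @braided C I L C^o s) (s_w0 : s w0 = 1).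

Let L_diag := @Lam_diag R n theta b theta_anti.
Let L_sym := @Lam_sym R n theta b theta_anti.
Let w0U := top_word_uniq n b.
Let w0F := @top_word_full n b.
Let lift := OmegaGL_lift theta_anti s_br s_w0.

Variable G : graded A.
Hypothesis hG : forall x, homog G (degGL x) (genGL x).

Lemma tGL_homog i j : homog G 0 (t i j).
Proof. exact: (hG (Some (Fn (i, j)))). Qed.
Lemma dtGL_homog i j : homog G 1 (dt i j).
Proof. exact: (hG (Some (Df (i, j)))). Qed.
Lemma detinv_homog : homog G 0 dinv.
Proof. exact: (hG None). Qed.
Let det_homog : homog G 0 (qdet s w0 t).
Proof. exact: (qdet_homog0 s w0 tGL_homog). Qed.

Let detL := qdet_detinv theta_anti s_br s_w0.
Let detR := detinv_qdet theta_anti s_br s_w0.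

(** The differential of the determinant is needed before [d] exists. It is obtained as the second
    entry [ddet] of the determinant of the pairs [(t, dt)]. *)
Lemma OmegaGL_antider : exists d : {linear A -> A},
  [/\ antiderivation G d, forall i j, d (t i j) = dt i j,
      d dinv = - (dinv ^+ 2 * d (qdet s w0 t)) & forall x, d (d x) = 0].
Proof.
pose T i j := tr G (t i j) (dt i j); pose dT i j := tr G (dt i j) 0.
pose DT := qdet s w0 T; pose ddet : A := DT.2.
have TdT : forms_rel LM (uncurry T) (uncurry dT).
  apply: tri_forms_rel (GL_forms_rel theta b).
  - by move=> x; apply: tGL_homog.
  - by move=> x; apply: dtGL_homog.
  - exact: (LamM_sym theta_anti).
have DTE : DT = tr G (qdet s w0 t) ddet.
  have pr_lin : linear (fun x : tri G => x.1 : A) by [].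
  have pr_hom : monoid_morphism (linear_of pr_lin) by [].
  by rewrite [LHS]surjective_pairing -[DT.1]/(linear_of pr_lin DT) /DT qdet_hom.
have gs0 x : homog G 0 x -> gsgn G x = x.
  by move=> x0; rewrite (gsgn_homog x0) expr0 scale1r.
have gs1 x : homog G 1 x -> gsgn G x = - x.
  by move=> x1; rewrite (gsgn_homog x1) expr1 scaleN1r.
(* Apply [qdet_qcomm] in [tri G] to [tr G x 0] and read the second entry. *)
have DTcomm p i j x : homog G p x ->
    (forall k l, tr G x 0 * T k l = (L i k * L l j) *: (T k l * tr G x 0)) ->
  gsgn G x * ddet = ddet * x.
  move=> xp xT; have := qdet_qcomm L_diag s_br w0U w0F xT
    (@Lam_prodr R n theta b theta_anti i) (@Lam_prodl R n theta b theta_anti j).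
  rewrite -/DT DTE !trM => /(congr1 (fun z : tri G => z.2 : A)) /=.
  by rewrite mul0r add0r mulr0 addr0.
have [tt td dd] := GL_forms_rel theta b.
have ddet_t i j : ddet * t i j = t i j * ddet.
  rewrite -(DTcomm 0%N i j _ (tGL_homog i j)) ?gs0 //; first exact: tGL_homog.
  move=> k l; rewrite !trM trZ (gs0 _ (tGL_homog i j)) mulr0 addr0 mul0r add0r.
  by congr (tr G _ _); [apply: (tt (i, j) (k, l))|apply: (td (i, j) (k, l))].
have ddet_dt i j : ddet * dt i j = - (dt i j * ddet).
  rewrite -(DTcomm 1%N i j _ (dtGL_homog i j)) ?gs1 ?mulNr //; first exact: dtGL_homog.
  move=> k l; rewrite !trM trZ (gs1 _ (dtGL_homog i j)) mulr0 addr0 mul0r add0r.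
  congr (tr G _ _).
    apply/esym; rewrite [t k l * _](td (k, l) (i, j)) scalerA.
    by rewrite [X in X *: _](LamM_sym theta_anti (i, j) (k, l)) scale1r.
  by rewrite mulNr [dt i j * _](dd (i, j) (k, l)) scaleNr opprK.
have dinvC := @detinv_central R n theta b.
have dinv2C x : dinv ^+ 2 * x = x * dinv ^+ 2.
  by rewrite expr2 -mulrA dinvC [dinv * x]dinvC -mulrA.
(* The inverse of [DT] in [tri G]; its second entry is the prescribed differential of [detinv]. *)
pose D := tr G dinv (- (dinv ^+ 2 * ddet)).
have [||||h [h_hom ht hdt hd]] := @lift _ T dT D => //.
- move=> i j; rewrite !trM (gs0 _ detinv_homog) (gs0 _ (tGL_homog i j)) dinvC.
  congr (tr G _ _); rewrite mulrN mulNr -mulrA ddet_t.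
  have -> : t i j * (dinv ^+ 2 * ddet) = dinv ^+ 2 * (t i j * ddet).
    by rewrite mulrA -dinv2C -mulrA.
  by rewrite addrC dinvC.
- move=> i j; rewrite !trM (gs0 _ detinv_homog) (gs1 _ (dtGL_homog i j)) dinvC.
  congr (tr G _ _); rewrite mulr0 mul0r addr0 add0r mulrNN mulNr -mulrA ddet_dt.
  rewrite mulrN opprK !mulrA; congr (_ * _).
  by rewrite dinv2C expr2 mulrA.
- rewrite -/DT DTE trM detL (gs0 _ det_homog); congr (tr G _ _).
  by rewrite mulrN expr2 -!mulrA [qdet s w0 t * _]mulrA detL mul1r dinvC addrN.
have [d dA hE] : exists2 d : {linear A -> A}, antiderivation G d &
    (forall x, h x = tr G x (d x)).
  pose dg x : A := match x with
    | Some (Fn x) => dt x.1 x.2 | Some (Df x) => 0 | None => - (dinv ^+ 2 * ddet) end.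
  apply: (@antider_of _ _ _ _ genGL (@degGL n b) _ hG h dg) => //.
  - exact: genGL_generates.
  - by move=> [[[i j]|[i j]]|]; [apply: ht|apply: hdt|apply: hd].
  move=> [[[i j]|[i j]]|] /=; [exact: dtGL_homog|exact: linear0|].
  rewrite -scaleN1r; apply: homogZ; rewrite expr2 -mulrA -[1%N]/(0 + (0 + 1))%N.
  apply: homogM; first exact: detinv_homog.
  apply: homogM; first exact: detinv_homog.
  (* Pairs with entries of degrees [0] and [1] form a subalgebra containing the entries of [T], so
     [ddet] has degree [1]. *)
  pose P (z : tri G) := homog G 0 (z.1 : A) /\ homog G 1 (z.2 : A).
  suff [] : P DT by [].
  apply: qdet_closed => [|||k z|y z|i j].
  - by split; apply: linear0.
  - by split; [exact: homog1|exact: linear0].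
  - by move=> y z [y0 y1] [z0 z1]; split; apply: homogD.
  - by move=> [z0 z1]; split; apply: homogZ.
  - case: y z => [y u] [z v] [/= y0 u1] [/= z0 v1]; split; first exact: (homogM y0 z0).
    by rewrite /= gs0 //; apply: homogD; [exact: (homogM u1 z0)|exact: (homogM y0 v1)].
  - by split; [exact: tGL_homog|exact: dtGL_homog].
have dE x : d x = (h x).2 by rewrite hE.
have d_det : d (qdet s w0 t) = ddet by rewrite dE qdet_hom // (eq_qdet _ _ ht).
have dtE i j : d (t i j) = dt i j by rewrite dE ht.
exists d; split=> //; first by rewrite dE hd d_det.
have ddt i j : d (dt i j) = 0 by rewrite dE hdt.
apply: (antider_sq (@genGL_generates R n theta b) hG) => // -[[[i j]|[i j]]|].
- by rewrite -[genGL _]/(t i j) dtE ddt.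
- by rewrite -[genGL _]/(dt i j) ddt linear0.
apply: (antider_sqV dA _ detinv_homog detL detR).
apply: (@qdet_closed _ _ s w0 _ (fun y => homog G 0 y /\ d (d y) = 0)).
- exact: antider_sq0.
- exact: (antider_sq1 dA).
- exact: antider_sqD.
- exact: antider_sqZ.
- exact: (antider_sqM dA).
by move=> i j; split; [exact: tGL_homog|rewrite dtE ddt].
Qed.

Lemma OmegaGL_bar : exists f : A -> A,
  [/\ graded_antihom G G conjc f, forall i j, f (t i j) = t (c i) (c j),
      forall i j, f (dt i j) = dt (c i) (c j) & f dinv = dinv].
Proof.
have [tt td dd] := GL_forms_rel theta b.
pose T i j : gop conjc G := t (c i) (c j).
pose dT i j : gop conjc G := dt (c i) (c j).
have LMc i j k l : conjc (LM (i, j) (k, l)) = LM (c k, c l) (c i, c j).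
  rewrite /LamM /= rmorphM !Lam_conj_idx.
  by congr (_ * _); apply: (@conjc_Lam R n theta b theta_anti).
have TdT : forms_rel LM (uncurry T) (uncurry dT).
  apply: gop_forms_rel => [x|x|[i j] [k l]|[i j] [k l]|[i j] [k l]].
  - exact: tGL_homog.
  - exact: dtGL_homog.
  - by rewrite [X in X *: _]LMc; apply: (tt (c k, c l) (c i, c j)).
  - rewrite [X in X *: _]LMc [X in _ *: X](td (c i, c j) (c k, c l)) scalerA.
    by rewrite (LamM_sym theta_anti) scale1r.
  - by rewrite [X in - X *: _]LMc; apply: (dd (c k, c l) (c i, c j)).
have central p x : homog G p x -> (dinv : gop conjc G) * x = (x : gop conjc G) * dinv.
  move=> xp; rewrite (gop_mulE conjc detinv_homog xp) (gop_mulE conjc xp detinv_homog).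
  by rewrite detinv_central muln0 mul0n.
have detT : qdet s w0 T = qdet s w0 t.
  rewrite /T (qdet_gop s w0 (G := G) (fun i j => tGL_homog (c i) (c j)) conjc).
  exact: (qdet_conj L_diag L_sym s_br s_w0 w0U w0F (@conj_idxK n b)
    (@Lam_conj_idx R n theta b) (@conjc_Lam R n theta b theta_anti) (@conjcK _)
    (@tGL_quantum R n theta b)).
have [|||f [f_hom ft fdt fd]] := lift TdT (D := (dinv : gop conjc G)).
- by move=> i j; apply: (central 0%N); apply: tGL_homog.
- by move=> i j; apply: (central 1%N); apply: dtGL_homog.
- by rewrite detT (gop_mulE conjc det_homog detinv_homog) scale1r detR.
exists f; split=> //.
apply: (graded_antihomP (@genGL_generates R n theta b) hG f_hom) => -[[[i j]|[i j]]|].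
- by rewrite [f _]ft; apply: tGL_homog.
- by rewrite [f _]fdt; apply: dtGL_homog.
- by rewrite [f _]fd; apply: detinv_homog.
Qed.

Lemma OmegaGL_gida : exists GL : gida conjc A,
  gida_gr GL = G /\ OmegaGL_structure GL.
Proof.
have [d [dA dt_ ddinv dd]] := OmegaGL_antider.
have [f [fA ft fdt fd]] := OmegaGL_bar.
have ddt i j : d (dt i j) = 0 by rewrite -dt_ dd.
have fdet_d : forall i j, f (d (t i j)) = d (f (t i j)).
  by move=> i j; rewrite dt_ fdt ft dt_.
have f_d x : f (d (genGL x)) = d (f (genGL x)).
  case: x => [[[i j]|[i j]]|]; first exact: fdet_d.
    rewrite -[genGL _]/(dt i j) ddt fdt ddt.
    by case: fA => fD _ _ _ _; apply: additive0.
  apply: (antihom_difV dA dA fA _ detinv_homog detL detR).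
  apply: (@qdet_closed _ _ s w0 _ (fun y => homog G 0 y /\ f (d y) = d (f y))).
  - exact: (antihom_dif0 _ _ fA).
  - exact: (antihom_dif1 dA dA fA).
  - exact: (antihom_difD fA).
  - exact: (antihom_difZ fA).
  - exact: (antihom_difM dA dA fA).
  by move=> i j; split; [exact: tGL_homog|exact: fdet_d].
have [|GL [GLG GLb GLd]] := gida_of (@genGL_generates R n theta b) hG
  (@conjcK _) fA _ dA (fun x => dd _) f_d.
  move=> [[[i j]|[i j]]|].
  - by rewrite -[genGL _]/(t i j) !ft !conj_idxK.
  - by rewrite -[genGL _]/(dt i j) !fdt !conj_idxK.
  - by rewrite -[genGL _]/dinv !fd.
exists GL; split=> //; rewrite /OmegaGL_structure GLG GLb GLd.
split=> // [i j|]; first by split; [exact: tGL_homog|exact: dtGL_homog].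
split=> //; first exact: detinv_homog.
by rewrite (detGLE theta_anti s_br s_w0) ddinv.
Qed.
End OmegaGLGida.

(** * Contracting a matrix with coordinates *)

Section Coaction.
Variables (K : comNzRingType) (cj : {rmorphism K -> K}) (I : finType).
Variable L : I -> I -> K.
Variables (J : Type) (m : J -> J -> K).
Hypotheses (L_sym : forall i j, L i j * L j i = 1)
  (m_sym : forall u v, m u v * m v u = 1).
Variables (A B : ualgebra K) (GA : gida cj A) (GB : gida cj B).
Variables (t : I -> I -> A) (r : J -> I -> B).
Hypotheses (t0 : forall i j, homog GA 0 (t i j)) (r0 : forall u a, homog GB 0 (r u a)).
Hypothesis tdt : forms_rel (fun x y => L x.1 y.1 * L y.2 x.2)
  (fun x => t x.1 x.2) (fun x => dif GA (t x.1 x.2)).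
Hypothesis rdr : forms_rel (fun x y => L x.2 y.2 * m x.1 y.1)
  (fun x => r x.1 x.2) (fun x => dif GB (r x.1 x.2)).

(** Two cases are covered: the coproduct, where [r] consists of the columns of [t] and [m] is the
    transposed [L], and the coaction on the space, where [J] is [unit] and [m] is [1]. *)
Definition coaction (x : I * J) : gtens GA GB :=
  \sum_k gten GA GB (t x.1 k) (r x.2 k).

Lemma coaction_dif x : dif (tgida GA GB) (coaction x) =
  (\sum_k gten GA GB (dif GA (t x.1 k)) (r x.2 k)) +
  \sum_k gten GA GB (t x.1 k) (dif GB (r x.2 k)).
Proof.
rewrite /coaction linear_sum -big_split; apply: eq_bigr => k _.
by rewrite [LHS](tdifE _ _ (t0 _ _)) scale1r.
Qed.

Lemma coaction_homog x : homog (tgraded GA GB) 0 (coaction x).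
Proof.
rewrite /coaction; elim/big_ind: _ => [|y z|k _]; first exact: linear0.
  exact: homogD.
exact: (homog_gten (t0 _ _) (r0 _ _)).
Qed.

(** Each term is an instance of [qcomm_sum]. In the relation between differentials four terms arise:
    the minus sign comes from the one-forms themselves in the two unmixed terms, and from the Koszul
    rule in the two mixed ones. *)
Lemma coaction_forms_rel :
  forms_rel (fun x y => L x.1 y.1 * m x.2 y.2) coaction
    (fun x => dif (tgida GA GB) (coaction x)).
Proof.
have [tt td dd] := tdt; have [rr rd ee] := rdr.
have d1 i k : homog GA 1 (dif GA (t i k)) by apply: dif_homog.
have e1 u k : homog GB 1 (dif GB (r u k)) by apply: dif_homog.
have q_sym (a c : I) (i k : I) : L i k * L c a * (L k i * L a c) = 1.
  by rewrite mulrACA !L_sym mulr1.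
have dt_t i k a c : dif GA (t i a) * t k c =
    (L i k * L c a) *: (t k c * dif GA (t i a)).
  by rewrite (td (k, c) (i, a)) scalerA q_sym scale1r.
have dr_r u v a c : dif GB (r u a) * r v c =
    (L a c * m u v) *: (r v c * dif GB (r u a)).
  by rewrite (rd (v, c) (u, a)) scalerA mulrACA L_sym m_sym mulr1 scale1r.
have comm p p' q q' (e e' : K) (x x' : I -> I -> A) (y y' : J -> I -> B) i k u v :
    (forall i j, homog GA p (x i j)) -> (forall i j, homog GA p' (x' i j)) ->
    (forall u j, homog GB q (y u j)) -> (forall u j, homog GB q' (y' u j)) ->
    (forall a c, x i a * x' k c = (e * (L i k * L c a)) *: (x' k c * x i a)) ->
    (forall a c, y u a * y' v c = (e' * (L a c * m u v)) *: (y' v c * y u a)) ->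
  (\sum_a gten GA GB (x i a) (y u a)) * (\sum_a gten GA GB (x' k a) (y' v a)) =
  ((-1) ^+ (q * p' + q' * p) * e * e' * (L i k * m u v)) *:
    ((\sum_a gten GA GB (x' k a) (y' v a)) * (\sum_a gten GA GB (x i a) (y u a))).
  move=> xp xp' yq yq' xx yy.
  rewrite (@qcomm_sum _ _ L L_sym _ _ GA GB p p' q q' _ _ _ _ e e' (L i k) (m u v)) //.
  - by rewrite !mulrA.
  - by move=> a c; rewrite xx mulrA.
  - by move=> a c; rewrite yy mulrA.
have pos (V : lmodType K) (k : K) (z : V) : (1 * k) *: z = k *: z by rewrite mul1r.
have neg (V : lmodType K) (k : K) (z : V) : (- 1 * k) *: z = - k *: z.
  by rewrite mulN1r.
split=> -[i u] [k v]; rewrite ?coaction_dif /coaction /=.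
- rewrite (comm 0%N 0%N 0%N 0%N 1 1 t t r r) //.
  + by rewrite expr0 !mul1r.
  + by move=> a c; rewrite pos; apply: (tt (i, a) (k, c)).
  + by move=> a c; rewrite pos; apply: (rr (u, a) (v, c)).
- rewrite mulrDr mulrDl scalerDr; congr (_ + _).
  + rewrite (comm 0%N 1%N 0%N 0%N 1 1 t (fun i j => dif GA (t i j)) r r) //.
    * by rewrite expr0 !mul1r.
    * by move=> a c; rewrite pos; apply: (td (i, a) (k, c)).
    * by move=> a c; rewrite pos; apply: (rr (u, a) (v, c)).
  + rewrite (comm 0%N 0%N 0%N 1%N 1 1 t t r (fun i j => dif GB (r i j))) //.
    * by rewrite expr0 !mul1r.
    * by move=> a c; rewrite pos; apply: (tt (i, a) (k, c)).
    * by move=> a c; rewrite pos; apply: (rd (u, a) (v, c)).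
rewrite mulrDr !mulrDl !mulrDr !scalerDr; congr (_ + _ + (_ + _)).
- rewrite (comm 1%N 1%N 0%N 0%N (-1) 1 (fun i j => dif GA (t i j))
    (fun i j => dif GA (t i j)) r r) //.
  + by rewrite expr0 mul1r mulr1 mulN1r.
  + by move=> a c; rewrite neg; apply: (dd (i, a) (k, c)).
  + by move=> a c; rewrite pos; apply: (rr (u, a) (v, c)).
- rewrite (comm 0%N 1%N 1%N 0%N 1 1 t (fun i j => dif GA (t i j))
    (fun i j => dif GB (r i j)) r) //.
  + by rewrite expr1 !mulr1 mulN1r.
  + by move=> a c; rewrite pos; apply: (td (i, a) (k, c)).
  + by move=> a c; rewrite pos; apply: dr_r.
- rewrite (comm 1%N 0%N 0%N 1%N 1 1 (fun i j => dif GA (t i j)) t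
    r (fun i j => dif GB (r i j))) //.
  + by rewrite expr1 !mulr1 mulN1r.
  + by move=> a c; rewrite pos; apply: dt_t.
  + by move=> a c; rewrite pos; apply: (rd (u, a) (v, c)).
rewrite (comm 0%N 0%N 1%N 1%N 1 (-1) t t
    (fun i j => dif GB (r i j)) (fun i j => dif GB (r i j))) //.
- by rewrite expr0 !mul1r mulN1r.
- by move=> a c; rewrite pos; apply: (tt (i, a) (k, c)).
- by move=> a c; rewrite neg; apply: (ee (u, a) (v, c)).
Qed.
End Coaction.

Section MatrixCoaction.
Variables (K : comNzRingType) (I : finType) (A B : ualgebra K).
Variables (GA : graded A) (GB : graded B).
Variables (Delta : {linear A -> gtens GA GA}) (eps : {scalar A}).
Variables (delta : {linear B -> gtens GA GB}).

Lemma tassoc_sum (x : I -> A) (y : I -> I -> A) (z : I -> B) :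
  tassoc (\sum_k gten (tgraded GA GA) GB (\sum_l gten GA GA (x l) (y l k)) (z k)) =
  \sum_l gten GA (tgraded GA GB) (x l) (\sum_k gten GA GB (y l k) (z k))
    :> gtens GA (tgraded GA GB).
Proof.
have F_lin : linear (tassoc : gtens (tgraded GA GA) GB -> gtens GA (tgraded GA GB)).
  exact: tassoc_linear.
rewrite -[LHS]/(linear_of F_lin _) linear_sum.
under eq_bigr do rewrite gten_suml linear_sum.
rewrite exchange_big; apply: eq_bigr => l _; rewrite gten_sumr.
by apply: eq_bigr => k _; apply: tassocE.
Qed.

Lemma tmapl_sum (x : I -> A) (z : I -> B) :
  tmap Delta idfun (\sum_k gten GA GB (x k) (z k)) =
  \sum_k gten (tgraded GA GA) GB (Delta (x k)) (z k) :> gtens (tgraded GA GA) GB.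
Proof.
have F_lin : linear (tmap Delta idfun : gtens GA GB -> gtens (tgraded GA GA) GB).
  exact: tmap_linear.
rewrite -[LHS]/(linear_of F_lin _) linear_sum.
by apply: eq_bigr => k _; apply: tmapE.
Qed.

Lemma tmapr_sum (x : I -> A) (z : I -> B) :
  tmap idfun delta (\sum_k gten GA GB (x k) (z k)) =
  \sum_k gten GA (tgraded GA GB) (x k) (delta (z k)) :> gtens GA (tgraded GA GB).
Proof.
have F_lin : linear (tmap idfun delta : gtens GA GB -> gtens GA (tgraded GA GB)).
  exact: tmap_linear.
rewrite -[LHS]/(linear_of F_lin _) linear_sum.
by apply: eq_bigr => k _; apply: tmapE.
Qed.

Lemma tforml_sum (x : I -> A) (z : I -> B) :
  tforml eps (\sum_k gten GA GB (x k) (z k)) = \sum_k eps (x k) *: z k :> B.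
Proof.
have F_lin : linear (tforml eps : gtens GA GB -> B) by apply: tforml_linear.
rewrite -[LHS]/(linear_of F_lin _) linear_sum.
by apply: eq_bigr => k _; apply: tformlE.
Qed.

Lemma tformr_sum (phi : {scalar B}) (x : I -> A) (z : I -> B) :
  tformr phi (\sum_k gten GA GB (x k) (z k)) = \sum_k phi (z k) *: x k :> A.
Proof.
have F_lin : linear (tformr phi : gtens GA GB -> A) by apply: tformr_linear.
rewrite -[LHS]/(linear_of F_lin _) linear_sum.
by apply: eq_bigr => k _; apply: tformrE.
Qed.

Lemma tmult_sum (f g : {linear A -> A}) (x z : I -> A) :
  tmult (tmap f g (\sum_k gten GA GA (x k) (z k))) = \sum_k f (x k) * g (z k) :> A.
Proof.
have F_lin : linear (@tmult K A \o tmap f g : gtens GA GA -> A).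
  by apply: comp_linear (@tmult_linear K A) _; apply: tmap_linear.
rewrite -[LHS]/(linear_of F_lin _) linear_sum.
by apply: eq_bigr => k _; rewrite /= tmapE tmultE.
Qed.

End MatrixCoaction.

Lemma gten_unit_central (K : comNzRingType) (A B : ualgebra K)
    (GA : graded A) (GB : graded B) (u : A) (v : B) (z : gtens GA GB) :
    homog GA 0 u -> homog GB 0 v -> (forall x, u * x = x * u) ->
    (forall x, v * x = x * v) ->
  gten GA GB u v * z = z * gten GA GB u v.
Proof.
move=> u0 v0 uC vC; elim/gten_ind: z => [|x y IHx IHy|p q a b ap bq].
- by rewrite mulr0 mul0r.
- by rewrite mulrDr mulrDl IHx IHy.
by rewrite (gtens_mulE _ _ v0 ap) (gtens_mulE _ _ bq u0) muln0 uC vC.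
Qed.

Section QuantumDelta.
Variables (K : numFieldType) (I : finType) (L : I -> I -> K).
Hypothesis L_sym : forall i j, L i j * L j i = 1.

Definition qid (i j : I) : scal_ua K := (i == j)%:R.

(** When both entries are nonzero, [i = j] and [k = l], so the factor is [L i k * L k i = 1]. *)
Lemma qid_quantum : quantum_matrix L qid.
Proof.
move=> i j k l; rewrite /qid; have [->|_] := eqVneq i j; last first.
  by rewrite mul0r mulr0 scaler0.
have [->|_] := eqVneq k l; last by rewrite mulr0 mul0r scaler0.
by rewrite L_sym scale1r.
Qed.

Lemma wprod_qid u v : size u = size v -> wprod qid u v = (u == v)%:R.
Proof.
elim: u v => [|i u IHu] [|j v] //=; first by rewrite wprod_nil.
move=> [uv]; rewrite wprod_cons IHu // eqseq_cons /qid.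
by case: eqP; case: eqP; rewrite ?mulr1 ?mulr0 ?mul0r.
Qed.

Lemma qdet_qid (s : seq I -> K) w0 : s w0 = 1 -> qdet s w0 qid = 1.
Proof.
move=> s1; rewrite /qdet (bigD1_seq w0) ?words_uniq ?mem_words ?eqxx //=.
rewrite wprod_qid // eqxx s1 scale1r big_seq_cond big1 ?addr0 // => w.
rewrite mem_words => /andP[/eqP wS]; rewrite eq_sym wprod_qid // => /negbTE->.
by rewrite scaler0.
Qed.
End QuantumDelta.

(** * Coproduct and counit *)

Section HopfGL.
Variables (R : realType) (n : nat) (theta : 'M[R]_n) (b : bool).
Hypothesis theta_anti : theta^T = - theta.
Local Notation C := (R[i]).
Local Notation I := (idx n b).
Local Notation L := (@Lam R n theta b).
Local Notation LM := (LamM theta (b := b)).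
Local Notation w0 := (top_word n b).
Local Notation t := (tGL theta (b := b)).
Local Notation dt := (dtGL theta (b := b)).
Local Notation dinv := (detinv theta b).
Local Notation uncurry T := (fun x => T x.1 x.2).
Local Notation genGL :=
  (pgen (inv_rel (dq_rel LM) (rename (@Fn _) (det_term theta b)))).
Local Notation A := (OmegaGL theta b).
Variable s : seq I -> C.
Hypotheses (s_br : @braided C I L C^o s) (s_w0 : s w0 = 1).

Let L_diag := @Lam_diag R n theta b theta_anti.
Let L_sym := @Lam_sym R n theta b theta_anti.
Let w0U := top_word_uniq n b.
Let w0F := @top_word_full n b.
Let lift := OmegaGL_lift theta_anti s_br s_w0.
Let genA := @genGL_generates R n theta b.

Variable GL : gida conjc A.
Hypothesis GL_str : OmegaGL_structure GL.

Lemma genGL_homog x : homog GL (degGL x) (genGL x).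
Proof.
have [th _ _ _ [dh _ _]] := GL_str.
case: x => [[[i j]|[i j]]|]; [exact: (th i j).1|exact: (th i j).2|exact: dh].
Qed.
Let hG := genGL_homog.

Let t0 : forall i j, homog GL 0 (t i j) := tGL_homog hG.
Let dinv0 : homog GL 0 dinv := detinv_homog hG.
Let detL := qdet_detinv theta_anti s_br s_w0.
Let detR := detinv_qdet theta_anti s_br s_w0.
Let det0 : homog GL 0 (qdet s w0 t) := qdet_homog0 s w0 t0.

Let dtE i j : dif GL (t i j) = dt i j.
Proof. by case: GL_str. Qed.
Let ddtE i j : dif GL (dt i j) = 0.
Proof. by rewrite -dtE difK. Qed.
Let dA := gida_dif_antider GL.

Lemma GL_dif_rel : forms_rel (fun x y => L x.1 y.1 * L y.2 x.2)
  (uncurry t) (fun x => dif GL (t x.1 x.2)).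
Proof.
have [tt td dd] := GL_forms_rel theta b.
by split=> x y; rewrite ?dtE; [apply: tt|apply: td|apply: dd].
Qed.

Lemma GL_coproduct : exists Delta : {linear A -> gtens GL GL},
  [/\ gida_hom GL (tgida GL GL) Delta,
      forall i j, Delta (t i j) = \sum_k gten GL GL (t i k) (t k j) &
      Delta dinv = gten GL GL dinv dinv].
Proof.
(* The second factor is indexed by its column first, so that each column of [t] plays the role of
   the coordinates. *)
pose r j k := t k j.
have rdr : forms_rel (fun x y => L x.2 y.2 * L y.1 x.1)
    (fun x => r x.1 x.2) (fun x => dif GL (r x.1 x.2)).
  have [tt td dd] := GL_dif_rel.
  by split=> -[u a] [v e]; [apply: (tt (a, u) (e, v))|apply: (td (a, u) (e, v))|
    apply: (dd (a, u) (e, v))].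
have r0 u a : homog GL 0 (r u a) by apply: t0.
have m_sym (u v : I) : L v u * L u v = 1 by apply: L_sym.
pose T i j := coaction GL GL t r (i, j).
pose dT i j := dif (tgida GL GL) (T i j).
have TdT : forms_rel LM (uncurry T) (uncurry dT).
  have [tt td dd] := coaction_forms_rel (m := fun u v => L v u) L_sym m_sym t0 r0
    GL_dif_rel rdr.
  by split=> -[i j] [k l]; [apply: (tt (i, j) (k, l))|apply: (td (i, j) (k, l))|
    apply: (dd (i, j) (k, l))].
have dinvC := @detinv_central R n theta b.
have DC z : gten GL GL dinv dinv * z = z * gten GL GL dinv dinv.
  exact: gten_unit_central.
have detT : qdet s w0 T = gten GL GL (qdet s w0 t) (qdet s w0 t).
  have qt : quantum_matrix L t by apply: tGL_quantum.
  have := qdet_grouplike L_diag L_sym s_br s_w0 w0U w0F t0 t0 qt.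
  by rewrite -[X in X = _ -> _]/(qdet s w0 T).
have detD : gten GL GL (qdet s w0 t) (qdet s w0 t) * gten GL GL dinv dinv = 1.
  by rewrite (gtens_mulE _ _ det0 dinv0) scale1r detL.
have [|||f [f_hom ft fdt fd]] := lift TdT (D := gten GL GL dinv dinv) => //.
  by rewrite detT.
have fh x : homog (tgida GL GL) (degGL x) (f (genGL x)).
  have T0 i j : homog (tgida GL GL) 0 (T i j) by apply: coaction_homog.
  case: x => [[[i j]|[i j]]|].
  - by rewrite [f _]ft; apply: T0.
  - by rewrite [f _]fdt; apply: (dif_homog (T0 i j)).
  - by rewrite [f _]fd; apply: (homog_gten dinv0 dinv0).
have f_gr := graded_hom_gen genA hG f_hom fh.
have dB := gida_dif_antider (tgida GL GL).
have f_dt i j : f (dif GL (t i j)) = dif (tgida GL GL) (f (t i j)).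
  by rewrite dtE fdt ft.
have [_ _ bt _ [_ _ bd]] := GL_str.
have f_bt i j : f (bar GL (t i j)) = bar (tgida GL GL) (f (t i j)).
  rewrite bt !ft.
  transitivity (\sum_k bar (tgida GL GL) (gten GL GL (t i k) (t k j))).
    rewrite /T /coaction (reindex_inj (inv_inj (@conj_idxK n b))).
    apply: eq_bigr => k _.
    by rewrite [RHS]tbarE !bt.
  by rewrite /T /coaction (big_morph _ (barD (tgida GL GL)) (bar0 (tgida GL GL))).
exists f; split=> //.
apply: (gida_hom_of genA hG) => // -[[[i j]|[i j]]|].
- exact: f_bt.
(* Since [dt] is the differential of [t], and the involutions commute with the differentials, the
   case of [t] suffices. *)
- rewrite -[genGL _]/(dt i j) -dtE -dif_bar f_dt -dif_bar -f_bt.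
  by rewrite bt f_dt.
- by rewrite [genGL _]/dinv bd fd [RHS]tbarE bd.
- exact: f_dt.
- by rewrite -[genGL _]/(dt i j) ddtE linear0 fdt difK.
apply: (hom_difV dA dB f_hom f_gr _ dinv0 detL detR).
apply: (@qdet_closed _ _ s w0 _
  (fun y => homog GL 0 y /\ f (dif GL y) = dif (tgida GL GL) (f y))) => //.
- exact: hom_dif0.
- exact: (hom_dif1 dA dB f_hom).
- exact: hom_difD.
- exact: hom_difZ.
- exact: (hom_difM dA dB f_hom f_gr).
Qed.

Lemma GL_counit : exists eps : {scalar A},
  [/\ monoid_morphism eps, forall i j, eps (t i j) = (i == j)%:R,
      forall i j, eps (dt i j) = 0 & eps dinv = 1].
Proof.
have [||||f [f_hom ft fdt fd]] := @lift (scal_ua C) (@qid C I) (fun _ _ => 0) 1.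
- split=> [x y|x y|x y].
  + exact: (qid_quantum L_sym).
  + by rewrite mul0r mulr0 scaler0.
  + by rewrite mul0r scaler0.
- by move=> i j; rewrite mul1r mulr1.
- by move=> i j; rewrite mul1r mulr1.
- by rewrite (qdet_qid s_w0) mulr1.
have f_lin : scalar (f : A -> C) by move=> k x y; apply: linearP.
by exists (scalar_of f_lin).
Qed.
End HopfGL.

(** * Antipode *)

Section AntipodeGL.
Variables (R : realType) (n : nat) (theta : 'M[R]_n) (b : bool).
Hypothesis theta_anti : theta^T = - theta.
Local Notation C := (R[i]).
Local Notation I := (idx n b).
Local Notation L := (@Lam R n theta b).
Local Notation LM := (LamM theta (b := b)).
Local Notation w0 := (top_word n b).
Local Notation t := (tGL theta (b := b)).
Local Notation dt := (dtGL theta (b := b)).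
Local Notation dinv := (detinv theta b).
Local Notation uncurry T := (fun x => T x.1 x.2).
Local Notation genGL :=
  (pgen (inv_rel (dq_rel LM) (rename (@Fn _) (det_term theta b)))).
Local Notation A := (OmegaGL theta b).
Variable s : seq I -> C.
Hypotheses (s_br : @braided C I L C^o s) (s_w0 : s w0 = 1).

Let L_diag := @Lam_diag R n theta b theta_anti.
Let L_sym := @Lam_sym R n theta b theta_anti.
Let w0U := top_word_uniq n b.
Let w0F := @top_word_full n b.
Let lift := OmegaGL_lift theta_anti s_br s_w0.
Let genA := @genGL_generates R n theta b.

Variable GL : gida conjc A.
Hypothesis GL_str : OmegaGL_structure GL.

Let hG := genGL_homog GL_str.

Let t0 : forall i j, homog GL 0 (t i j) := tGL_homog hG.
Let dt1 : forall i j, homog GL 1 (dt i j) := dtGL_homog hG.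
Let dinv0 : homog GL 0 dinv := detinv_homog hG.
Let detL := qdet_detinv theta_anti s_br s_w0.
Let detR := detinv_qdet theta_anti s_br s_w0.
Let det0 : homog GL 0 (qdet s w0 t) := qdet_homog0 s w0 t0.

Let dtE i j : dif GL (t i j) = dt i j.
Proof. by case: GL_str. Qed.
Let ddtE i j : dif GL (dt i j) = 0.
Proof. by rewrite -dtE difK. Qed.
Let dA := gida_dif_antider GL.


Definition qantipode (i j : I) : A := qinv s w0 t dinv i j.
Local Notation sm := qantipode.

Let sm0 i j : homog GL 0 (sm i j).
Proof. exact: (qinv_homog0 s w0 t0 i j dinv0). Qed.

(* The commutation rule for [dif GL (sm i j)] is the second component of the one
   for [(sm i j, dif GL (sm i j))] in [tri GL], which is a cofactor matrix entry
   because the graph of [dif GL] is a homomorphism. *)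
Lemma qantipode_qcomm p x (a e : I -> C) i j : homog GL p x ->
    \prod_i a i = 1 -> \prod_i e i = 1 ->
    (forall k l, x * t k l = (a k * e l) *: (t k l * x)) ->
    (forall k l, x * dt k l = ((-1) ^+ p * (a k * e l)) *: (dt k l * x)) ->
  x * sm i j = (a j * e i)^-1 *: (sm i j * x) /\
  x * dif GL (sm i j) = ((-1) ^+ p * (a j * e i)^-1) *: (dif GL (sm i j) * x).
Proof.
move=> xp a1 e1 xt xdt; have [h h_hom hE] := antider_graph dA.
have gx : gsgn GL x = (-1) ^+ p *: x by rewrite (gsgn_homog xp).
pose T i j := h (t i j).
have xT k l : tr GL x 0 * T k l = (a k * e l) *: (T k l * tr GL x 0).
  rewrite /T hE dtE !trM trZ gx mul0r add0r mulr0 addr0 xt -uscalerAl xdt scalerA.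
  by rewrite mulrA signr_mul2 mul1r.
have qT : quantum_matrix L T.
  move=> k l k' l'; rewrite /T -!(snd h_hom) (@tGL_quantum R n theta b).
  by rewrite linearZ.
have dT1 : qdet s w0 T * h dinv = 1.
  by rewrite -(qdet_hom s w0 _ h_hom) -(snd h_hom) detL (fst h_hom).
have dT2 : h dinv * qdet s w0 T = 1.
  by rewrite -(qdet_hom s w0 _ h_hom) -(snd h_hom) detR (fst h_hom).
have := qinv_qcomm L_diag s_br w0U w0F dT1 dT2 xT a1 e1 i j.
rewrite -(qinv_hom s w0 t dinv i j h_hom) -/(sm i j) hE !trM trZ => xs.
have /= := congr1 (fun z : tri GL => (z.1 : A)) xs; split=> //.
have /= := congr1 (fun z : tri GL => (z.2 : A)) xs.
rewrite gx mul0r add0r mulr0 addr0 -uscalerAl.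
move=> /(congr1 (fun z : A => (-1) ^+ p *: z)).
by rewrite !scalerA signr_mul2 scale1r.
Qed.

Let L_inv i j : (L i j)^-1 = L j i.
Proof. by rewrite -[LHS]mul1r -(L_sym j i) mulfK // (L_neq0 L_sym). Qed.

Let flip (x y : A) (k k' : C) : x * y = k *: (y * x) -> k * k' = 1 ->
  y * x = k' *: (x * y).
Proof. by move=> ->; rewrite scalerA mulrC => ->; rewrite scale1r. Qed.

(** Apply [qantipode_qcomm] to [t k l] and to [dt k l]; by [Lam_prodr] and [Lam_prodl] the products
    of their row and of their column factors are [1]. *)
Lemma qantipode_t i j k l :
  [/\ sm i j * t k l = (L k j * L i l) *: (t k l * sm i j),
      dif GL (sm i j) * t k l = (L k j * L i l) *: (t k l * dif GL (sm i j)),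
      sm i j * dt k l = (L k j * L i l) *: (dt k l * sm i j) &
      dif GL (sm i j) * dt k l = - (L k j * L i l) *: (dt k l * dif GL (sm i j))].
Proof.
have [tt td dd] := GL_forms_rel theta b.
have Lk1 := @Lam_prodr R n theta b theta_anti k.
have Ll1 := @Lam_prodl R n theta b theta_anti l.
have [] := @qantipode_qcomm 0 (t k l) (L k) (L^~ l) i j (t0 k l) Lk1 Ll1.
- by move=> k' l'; apply: (tt (k, l) (k', l')).
- by move=> k' l'; rewrite mul1r; apply: (td (k, l) (k', l')).
have inv1 : (L k j * L i l)^-1 * (L k j * L i l) = 1.
  by rewrite invfM !L_inv mulrACA !L_sym mulr1.
rewrite mul1r => ts tds.
have [] := @qantipode_qcomm 1 (dt k l) (L k) (L^~ l) i j (dt1 k l) Lk1 Ll1.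
- move=> k' l'; apply: (flip (td (k', l') (k, l))).
  exact: (LamM_sym theta_anti (k', l') (k, l)).
- by move=> k' l'; rewrite expr1 mulN1r; apply: (dd (k, l) (k', l')).
rewrite expr1 mulN1r => ds dds; split.
- exact: flip ts inv1.
- exact: flip tds inv1.
- exact: flip ds inv1.
by apply: (flip dds); rewrite mulrNN inv1.
Qed.

(** By [qantipode_t] the entry [sm i j] and its differential pass the generators up to scalars, so
    [qantipode_qcomm] applies a second time with these as [x]. *)
Lemma qantipode_rel i j k l :
  [/\ sm i j * sm k l = (L j l * L k i) *: (sm k l * sm i j),
      sm i j * dif GL (sm k l) = (L j l * L k i) *: (dif GL (sm k l) * sm i j),
      dif GL (sm i j) * sm k l = (L j l * L k i) *: (sm k l * dif GL (sm i j)) &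
      dif GL (sm i j) * dif GL (sm k l) =
        - (L j l * L k i) *: (dif GL (sm k l) * dif GL (sm i j))].
Proof.
have inv1 : (L l j * L i k)^-1 = L j l * L k i by rewrite invfM !L_inv.
have Lj1 := @Lam_prodl R n theta b theta_anti j.
have Li1 := @Lam_prodr R n theta b theta_anti i.
have [] := @qantipode_qcomm 0 (sm i j) (L^~ j) (L i) k l (sm0 i j) Lj1 Li1.
- by move=> k' l'; have [] := qantipode_t i j k' l'.
- by move=> k' l'; rewrite mul1r; have [] := qantipode_t i j k' l'.
rewrite mul1r inv1 => ss sds.
have [] := @qantipode_qcomm 1 (dif GL (sm i j)) (L^~ j) (L i) k l
  (dif_homog (sm0 i j)) Lj1 Li1.
- by move=> k' l'; have [] := qantipode_t i j k' l'.
- by move=> k' l'; rewrite expr1 mulN1r; have [] := qantipode_t i j k' l'.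
by rewrite expr1 mulN1r inv1.
Qed.

Lemma qantipode_left i j : \sum_k sm i k * t k j = (i == j)%:R *: (1 : A).
Proof.
exact: (qinv_left L_diag L_sym s_br s_w0 w0U w0F (@tGL_quantum R n theta b) detL detR).
Qed.

Lemma qantipode_right i j : \sum_k t i k * sm k j = (i == j)%:R *: (1 : A).
Proof.
exact: (qinv_right L_diag L_sym s_br s_w0 w0U w0F (@tGL_quantum R n theta b) detL).
Qed.

(** The presentation imposes centrality on [detinv]; the inverse of a central element is central. *)
Lemma det_central x : qdet s w0 t * x = x * qdet s w0 t.
Proof.
rewrite -[LHS]mulr1 -detR mulrA -[_ * x * dinv]mulrA -(@detinv_central R n theta b).
by rewrite mulrA detL mul1r.
Qed.

Lemma GL_antipode : exists S : {linear A -> A},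
  [/\ graded_antihom GL GL idfun S, forall i j, S (t i j) = sm i j,
      S dinv = qdet s w0 t & forall x, S (dif GL x) = dif GL (S x)].
Proof.
pose T i j : gop idfun GL := sm i j; pose dT i j : gop idfun GL := dif GL (sm i j).
have ds1 i j : homog GL 1 (dif GL (sm i j)) by apply: dif_homog.
have TdT : forms_rel LM (uncurry T) (uncurry dT).
  have LMC i j k l : LM (i, j) (k, l) = L l j * L i k by rewrite /LamM mulrC.
  apply: gop_forms_rel => [x|x|[i j] [k l]|[i j] [k l]|[i j] [k l]].
  - exact: sm0.
  - exact: ds1.
  - by rewrite [X in X *: _]LMC; have [] := qantipode_rel k l i j.
  - by rewrite [X in X *: _]LMC; have [] := qantipode_rel k l i j.
  - by rewrite [X in - X *: _]LMC; have [] := qantipode_rel k l i j.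
have central p x : homog GL p x ->
    (qdet s w0 t : gop idfun GL) * x = (x : gop idfun GL) * qdet s w0 t.
  move=> xp; rewrite (gop_mulE idfun det0 xp) (gop_mulE idfun xp det0).
  by rewrite det_central muln0 mul0n.
have [|||f [f_hom ft fdt fd]] := lift TdT (D := (qdet s w0 t : gop idfun GL)).
- by move=> i j; apply: (central 0%N); apply: sm0.
- by move=> i j; apply: (central 1%N); apply: ds1.
- have T0 : homog GL 0 (qdet s w0 T : A).
    rewrite (qdet_gop s w0 sm0); elim/big_ind: _ => [|y z|w _].
    + exact: linear0.
    + exact: homogD.
    by apply: homogZ; apply: wprod_homog0.
  rewrite (gop_mulE idfun T0 det0) scale1r det_central (qdet_gop s w0 sm0).
  exact: (qdet_qinv L_diag L_sym s_br s_w0 w0U w0F (@tGL_quantum R n theta b)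
    detL detR).
have f_lin : linear (f : A -> A).
  by move=> k x y; rewrite linearP.
have fA : graded_antihom GL GL idfun (f : A -> A).
  apply: (graded_antihomP genA hG f_hom) => -[[[i j]|[i j]]|].
  - by rewrite [f _]ft; apply: sm0.
  - by rewrite [f _]fdt; apply: ds1.
  - by rewrite [f _]fd; apply: det0.
exists (linear_of f_lin); split=> //.
apply: (antihom_antider genA hG fA dA dA) => -[[[i j]|[i j]]|].
- by rewrite -[genGL _]/(t i j) dtE [LHS]fdt [f _]ft.
- rewrite -[genGL _]/(dt i j) ddtE [f (dt i j)]fdt /dT difK.
  by case: fA => fD _ _ _ _; apply: additive0.
apply: (antihom_difV dA dA fA _ dinv0 detL detR).
apply: (@qdet_closed _ _ s w0 _ (fun y => homog GL 0 y /\
  (f : A -> A) (dif GL y) = dif GL (f y : A))).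
- exact: (antihom_dif0 _ _ fA).
- exact: (antihom_dif1 dA dA fA).
- exact: (antihom_difD fA).
- exact: (antihom_difZ fA).
- exact: (antihom_difM dA dA fA).
by move=> i j; split; rewrite ?dtE; [exact: t0|rewrite [LHS]fdt [f _]ft].
Qed.
End AntipodeGL.

(** * Comodule and Hopf identities on matrix generators *)

Section MatrixComodule.
Variables (K : comNzRingType) (I : finType) (A B : ualgebra K).
Variables (GA : graded A) (GB : graded B).
Variables (Delta : {linear A -> gtens GA GA}) (eps : {scalar A}).
Variables (delta : {linear B -> gtens GA GB}).
Variables (t dt : I -> I -> A) (z dz : I -> B).
Hypotheses (Delta_t : forall i j, Delta (t i j) = \sum_k gten GA GA (t i k) (t k j))
  (Delta_dt : forall i j, Delta (dt i j) =
     \sum_k gten GA GA (dt i k) (t k j) + \sum_k gten GA GA (t i k) (dt k j)).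
Hypotheses (delta_z : forall i, delta (z i) = \sum_k gten GA GB (t i k) (z k))
  (delta_dz : forall i, delta (dz i) =
     \sum_k gten GA GB (dt i k) (z k) + \sum_k gten GA GB (t i k) (dz k)).
Hypotheses (eps_t : forall i j, eps (t i j) = (i == j)%:R)
  (eps_dt : forall i j, eps (dt i j) = 0).
Local Notation T := (gtens GA (tgraded GA GB)).
Local Notation T1 := (gtens (tgraded GA GA) GB).

(** Serves for the coordinates of the space and, with a column of [t] as [z], for the coproduct
    itself. *)
Lemma matrix_coassoc i :
  tassoc (tmap Delta idfun (delta (z i))) = tmap idfun delta (delta (z i)).
Proof.
rewrite delta_z tmapl_sum tmapr_sum.
under eq_bigr do rewrite Delta_t.
under [RHS]eq_bigr do rewrite delta_z.
exact: tassoc_sum.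
Qed.

Lemma matrix_coassoc_d i :
  tassoc (tmap Delta idfun (delta (dz i))) = tmap idfun delta (delta (dz i)).
Proof.
have l1 : linear (tmap Delta idfun : gtens GA GB -> T1) by apply: tmap_linear.
have l2 : linear (tassoc : T1 -> T) by apply: tassoc_linear.
have l3 : linear (tmap idfun delta : gtens GA GB -> T) by apply: tmap_linear.
have D1 x y : tmap Delta idfun (x + y) = tmap Delta idfun x + tmap Delta idfun y :> T1.
  exact: (linearD (linear_of l1)).
have D2 x y : tassoc (x + y : T1) = tassoc x + tassoc y :> T.
  exact: (linearD (linear_of l2)).
have D3 x y : tmap idfun delta (x + y) = tmap idfun delta x + tmap idfun delta y :> T.
  exact: (linearD (linear_of l3)).
rewrite delta_dz D1 D2 D3 !tmapl_sum !tmapr_sum.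
have -> : \sum_k gten (tgraded GA GA) GB (Delta (dt i k)) (z k) =
    \sum_k gten (tgraded GA GA) GB (\sum_l gten GA GA (dt i l) (t l k)) (z k) +
    \sum_k gten (tgraded GA GA) GB (\sum_l gten GA GA (t i l) (dt l k)) (z k).
  by rewrite -big_split; apply: eq_bigr => k _; rewrite Delta_dt gtenDl.
have -> : \sum_k gten (tgraded GA GA) GB (Delta (t i k)) (dz k) =
    \sum_k gten (tgraded GA GA) GB (\sum_l gten GA GA (t i l) (t l k)) (dz k).
  by apply: eq_bigr => k _; rewrite Delta_t.
rewrite D2 !tassoc_sum -addrA; congr (_ + _).
  by apply: eq_bigr => k _; rewrite delta_z.
by rewrite -big_split; apply: eq_bigr => k _; rewrite delta_dz gtenDr.
Qed.

Lemma matrix_counit i : tforml eps (delta (z i)) = z i.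
Proof.
rewrite delta_z tforml_sum; under eq_bigr do rewrite eps_t eq_sym.
by rewrite sum_delta.
Qed.

Lemma matrix_counit_d i : tforml eps (delta (dz i)) = dz i.
Proof.
have l1 : linear (tforml eps : gtens GA GB -> B) by apply: tforml_linear.
have D1 x y : tforml eps (x + y) = tforml eps x + tforml eps y :> B.
  exact: (linearD (linear_of l1)).
rewrite delta_dz D1 !tforml_sum.
rewrite big1 ?add0r => [|k _]; last by rewrite eps_dt scale0r.
by under eq_bigr do rewrite eps_t eq_sym; rewrite sum_delta.
Qed.
End MatrixComodule.

Section MatrixHopf.
Variables (K : comNzRingType) (I : finType) (A : ualgebra K) (G : graded A).
Variables (Delta : {linear A -> gtens G G}) (eps : {scalar A}) (S : {linear A -> A}).
Variables (t dt sm dsm : I -> I -> A) (u v : A).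
Hypotheses (Delta_t : forall i j, Delta (t i j) = \sum_k gten G G (t i k) (t k j))
  (Delta_dt : forall i j, Delta (dt i j) =
     \sum_k gten G G (dt i k) (t k j) + \sum_k gten G G (t i k) (dt k j))
  (Delta_u : Delta u = gten G G u u).
Hypotheses (eps_t : forall i j, eps (t i j) = (i == j)%:R)
  (eps_dt : forall i j, eps (dt i j) = 0) (eps_u : eps u = 1).
Hypotheses (S_t : forall i j, S (t i j) = sm i j)
  (S_dt : forall i j, S (dt i j) = dsm i j) (S_u : S u = v).
Hypotheses (uv : u * v = 1) (vu : v * u = 1).
Hypotheses (st : forall i j, \sum_k sm i k * t k j = (i == j)%:R *: (1 : A))
  (ts : forall i j, \sum_k t i k * sm k j = (i == j)%:R *: (1 : A)).
Hypotheses
  (dst : forall i j, \sum_k dsm i k * t k j + \sum_k sm i k * dt k j = 0)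
  (tds : forall i j, \sum_k dt i k * sm k j + \sum_k t i k * dsm k j = 0).

Lemma matrix_coassoc_u :
  tassoc (tmap Delta idfun (Delta u)) = tmap idfun Delta (Delta u).
Proof.
rewrite Delta_u [tmap Delta idfun _]tmapE [RHS]tmapE Delta_u.
exact: tassocE.
Qed.

Lemma matrix_counit_t i j :
  tforml eps (Delta (t i j)) = t i j /\ tformr eps (Delta (t i j)) = t i j.
Proof.
split; first exact: (matrix_counit (fun i => Delta_t i j) eps_t).
rewrite Delta_t tformr_sum.
by under eq_bigr do rewrite eps_t; rewrite sum_delta.
Qed.

Lemma matrix_counit_dt i j :
  tforml eps (Delta (dt i j)) = dt i j /\ tformr eps (Delta (dt i j)) = dt i j.
Proof.
split; first exact: (matrix_counit_d (fun i => Delta_dt i j) eps_t eps_dt).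
have l2 : linear (tformr eps : gtens G G -> A) by apply: tformr_linear.
have D2 x y : tformr eps (x + y) = tformr eps x + tformr eps y :> A.
  exact: (linearD (linear_of l2)).
rewrite Delta_dt D2 !tformr_sum.
rewrite [X in _ + X]big1 ?addr0 => [|k _]; last by rewrite eps_dt scale0r.
by under eq_bigr do rewrite eps_t; rewrite sum_delta.
Qed.

Lemma matrix_counit_u : tforml eps (Delta u) = u /\ tformr eps (Delta u) = u.
Proof. by rewrite Delta_u [tforml _ _]tformlE [tformr _ _]tformrE eps_u !scale1r. Qed.

Lemma matrix_antipode_t i j :
  tmult (tmap S idfun (Delta (t i j))) = eps (t i j) *: (1 : A) /\
  tmult (tmap idfun S (Delta (t i j))) = eps (t i j) *: (1 : A).
Proof.
rewrite Delta_t !tmult_sum eps_t -st; split.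
  by apply: eq_bigr => k _; rewrite S_t.
by rewrite st -ts; apply: eq_bigr => k _; rewrite S_t.
Qed.

Lemma matrix_antipode_dt i j :
  tmult (tmap S idfun (Delta (dt i j))) = eps (dt i j) *: (1 : A) /\
  tmult (tmap idfun S (Delta (dt i j))) = eps (dt i j) *: (1 : A).
Proof.
have tmD (f g : {linear A -> A}) (x y : gtens G G) :
    tmult (tmap f g (x + y)) = tmult (tmap f g x) + tmult (tmap f g y) :> A.
  rewrite [tmap f g _](linearD (tmap f g)).
  exact: (linearD (linear_of (@tmult_linear K A))).
rewrite Delta_dt !tmD !tmult_sum eps_dt scale0r; split.
  by rewrite -[RHS](dst i j); congr (_ + _); apply: eq_bigr => k _; rewrite ?S_t ?S_dt.
by rewrite -[RHS](tds i j); congr (_ + _); apply: eq_bigr => k _; rewrite ?S_t ?S_dt.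
Qed.

Lemma matrix_antipode_u :
  tmult (tmap S idfun (Delta u)) = eps u *: (1 : A) /\
  tmult (tmap idfun S (Delta u)) = eps u *: (1 : A).
Proof.
rewrite Delta_u ![tmap _ _ _]tmapE !tmultE S_u /= uv vu eps_u.
by rewrite scale1r.
Qed.
End MatrixHopf.

(** * Hopf axioms for the forms *)

Section HopfGLAssembly.
Variables (R : realType) (n : nat) (theta : 'M[R]_n) (b : bool).
Hypothesis theta_anti : theta^T = - theta.
Local Notation C := (R[i]).
Local Notation I := (idx n b).
Local Notation L := (@Lam R n theta b).
Local Notation w0 := (top_word n b).
Local Notation t := (tGL theta (b := b)).
Local Notation dt := (dtGL theta (b := b)).
Local Notation dinv := (detinv theta b).
Local Notation A := (OmegaGL theta b).
Variable s : seq I -> C.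
Hypotheses (s_br : @braided C I L C^o s) (s_w0 : s w0 = 1).
Variable GL : gida conjc A.
Hypothesis GL_str : OmegaGL_structure GL.
Let hG := genGL_homog GL_str.

Lemma GL_hopf (Delta : {linear A -> gtens GL GL}) (eps : {scalar A})
    (S : {linear A -> A}) :
    gida_hom GL (tgida GL GL) Delta ->
    (forall i j, Delta (t i j) = \sum_k gten GL GL (t i k) (t k j)) ->
    Delta dinv = gten GL GL dinv dinv ->
    monoid_morphism eps -> (forall i j, eps (t i j) = (i == j)%:R) ->
    (forall i j, eps (dt i j) = 0) -> eps dinv = 1 ->
    graded_antihom GL GL idfun S ->
    (forall i j, S (t i j) = @qantipode R n theta b s i j) ->
    S dinv = qdet s w0 t -> (forall x, S (dif GL x) = dif GL (S x)) ->
  gida_hopf Delta eps S.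
Proof.
move=> D_hom Dt Du e_hom et edt eu SA St Su Sd.
have [th dtE bt bdt [uh _ bu]] := GL_str.
have t0 i j : homog GL 0 (t i j) by case: (th i j).
pose sm i j := @qantipode R n theta b s i j; pose dsm i j := dif GL (sm i j).
have sm0 i j : homog GL 0 (sm i j) by apply: (qinv_homog0 s w0 t0 i j uh).
have Ddt i j : Delta (dt i j) =
    \sum_k gten GL GL (dt i k) (t k j) + \sum_k gten GL GL (t i k) (dt k j).
  have [_ _ _ Dd] := D_hom; rewrite -dtE Dd Dt.
  have := coaction_dif GL (fun j k => t k j) t0 (i, j); rewrite /coaction /= => ->.
  by congr (_ + _); apply: eq_bigr => k _; rewrite dtE.
have Sdt i j : S (dt i j) = dsm i j by rewrite -dtE Sd St.
have detL := qdet_detinv theta_anti s_br s_w0.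
have detR := detinv_qdet theta_anti s_br s_w0.
have st := qantipode_left theta_anti s_br s_w0.
have ts := qantipode_right theta_anti s_br s_w0.
have d1 (k : C) : dif GL (k *: (1 : A)) = 0.
  by rewrite linearZ /= (antider1 (gida_dif_antider GL)) scaler0.
(* The antipode axioms at [dt] are the differentials of those at [t], whose right-hand sides are
   constants. *)
have dst i j : \sum_k dsm i k * t k j + \sum_k sm i k * dt k j = 0.
  rewrite -[RHS](d1 (i == j)%:R) -st linear_sum -big_split; apply: eq_bigr => k _ /=.
  by rewrite (difM _ (sm0 i k)) scale1r dtE.
have tds i j : \sum_k dt i k * sm k j + \sum_k t i k * dsm k j = 0.
  rewrite -[RHS](d1 (i == j)%:R) -ts linear_sum -big_split; apply: eq_bigr => k _ /=.
  by rewrite (difM _ (t0 i k)) scale1r dtE.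
apply: (gida_hopf_of (@genGL_generates R n theta b) hG) => //.
- by move=> [[[i j]|[i j]]|] //= _; apply: edt.
- move=> [[[i j]|[i j]]|].
  + rewrite [X in eps X]bt [eps _]et [eps _]et (inj_eq (inv_inj (@conj_idxK n b))).
    by rewrite rmorph_nat.
  + by rewrite [X in eps X]bdt [eps _]edt [eps _]edt rmorph0.
  + by rewrite [X in eps X]bu [eps _]eu rmorph1.
- move=> [[[i j]|[i j]]|].
  + exact: (matrix_coassoc Dt (fun i => Dt i j)).
  + exact: (matrix_coassoc_d Dt Ddt (fun i => Dt i j) (fun i => Ddt i j)).
  + exact: (matrix_coassoc_u Du).
- move=> [[[i j]|[i j]]|].
  + exact: (matrix_counit_t Dt et).
  + exact: (matrix_counit_dt Ddt et edt).
  + exact: (matrix_counit_u Du eu).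
move=> [[[i j]|[i j]]|].
- exact: (matrix_antipode_t Dt et St st ts).
- exact: (matrix_antipode_dt Ddt edt St Sdt dst tds).
- exact: (matrix_antipode_u Du eu Su detR detL).
Qed.
End HopfGLAssembly.

(** * The Hopf subalgebra of functions *)

Lemma triv_homogS (K : comNzRingType) (A : ualgebra K) p (x : A) :
  homog (triv_graded A) p.+1 x -> x = 0.
Proof. by move=> <-. Qed.

Lemma triv_antider0 (K : comNzRingType) (A : ualgebra K) :
  antiderivation (triv_graded A) (\0 : {linear A -> A}).
Proof.
split=> [p x _|p x y _] /=; first exact: linear0.
by rewrite mul0r mulr0 scaler0 addr0.
Qed.

Lemma tmap_sum (K : comNzRingType) (I : finType) (A A' B B' : ualgebra K)
    (GA : graded A) (GA' : graded A') (GB : graded B) (GB' : graded B')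
    (f : {linear A -> A'}) (g : {linear B -> B'}) (x : I -> A) (z : I -> B) :
  tmap f g (\sum_k gten GA GB (x k) (z k)) =
  \sum_k gten GA' GB' (f (x k)) (g (z k)) :> gtens GA' GB'.
Proof.
have F_lin : linear (tmap f g : gtens GA GB -> gtens GA' GB') by apply: tmap_linear.
rewrite -[LHS]/(linear_of F_lin _) linear_sum.
by apply: eq_bigr => k _; apply: tmapE.
Qed.

Lemma tmap_gten (K : comNzRingType) (A A' B B' : ualgebra K)
    (GA : graded A) (GA' : graded A') (GB : graded B) (GB' : graded B')
    (f : {linear A -> A'}) (g : {linear B -> B'}) (x : A) (z : B) :
  tmap f g (gten GA GB x z) = gten GA' GB' (f x) (g z).
Proof. exact: tmapE. Qed.

Section TrivMaps.
Variables (K : comNzRingType) (A C : ualgebra K) (G : graded A).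
Variables (iota : {linear C -> A}) (pi : {linear A -> C}).
Hypotheses (iota_hom : monoid_morphism iota) (pi_hom : monoid_morphism pi).
Hypothesis iota0 : forall x, homog G 0 (iota x).

Lemma triv_graded_hom : graded_hom (triv_graded C) G iota.
Proof.
move=> [|p] x; first by move=> _; apply: iota0.
by move=> /triv_homogS ->; rewrite linear0; apply: linear0.
Qed.

Lemma triv_graded_antihom tau (f : A -> A) : graded_antihom G G tau f ->
  graded_antihom (triv_graded C) (triv_graded C) tau (fun x => pi (f (iota x))).
Proof.
move=> [fD fZ f1 fh fM]; case: iota_hom pi_hom => [i1 iM] [p1 pM].
have f0 : f 0 = 0 by apply: additive0.
split=> [x y|k x||[|p] x xp|p q x y xp yq].
- by rewrite linearD fD linearD.
- by rewrite linearZ /= fZ linearZ.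
- by rewrite i1 f1 p1.
- by [].
- by rewrite (triv_homogS xp) linear0 f0 linear0; apply: linear0.
case: p xp => [|p] xp; last first.
  by rewrite (triv_homogS xp) mul0r linear0 f0 linear0 mulr0 scaler0.
by rewrite iM (fM _ _ _ _ (iota0 x) (iota0 y)) !scale1r pM.
Qed.

Lemma retract_coproduct (GC : graded C) (Delta : {linear A -> gtens G G}) :
    monoid_morphism Delta -> graded_hom G GC pi ->
  exists2 Delta0 : {linear C -> gtens GC GC}, monoid_morphism Delta0 &
    forall x, Delta0 x = tmap pi pi (Delta (iota x)).
Proof.
move=> D_hom pi_gr.
have pp_lin : linear (tmap pi pi : gtens G G -> gtens GC GC) by apply: tmap_linear.
have pp_hom : monoid_morphism (tmap pi pi : gtens G G -> gtens GC GC).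
  exact: tmap_graded_hom.
have D_lin : linear Delta by move=> k x y; apply: linearP.
have i_lin : linear iota by move=> k x y; apply: linearP.
have lin := comp_linear pp_lin (comp_linear D_lin i_lin).
exists (linear_of lin) => //; exact: (comp_hom pp_hom (comp_hom D_hom iota_hom)).
Qed.

Lemma hom_coproduct (GC : graded C) (Delta : {linear A -> gtens G G})
    (Delta0 : {linear C -> gtens GC GC}) (X : Type) (gen : X -> C) :
    generates gen -> monoid_morphism Delta -> monoid_morphism Delta0 ->
    graded_hom GC G iota ->
    (forall x, Delta (iota (gen x)) = tmap iota iota (Delta0 (gen x))) ->
  forall x, Delta (iota x) = tmap iota iota (Delta0 x).
Proof.
move=> genC D_hom D0_hom i_gr gens.
have ii_lin : linear (tmap iota iota : gtens GC GC -> gtens G G) by apply: tmap_linear.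
have ii_hom : monoid_morphism (tmap iota iota : gtens GC GC -> gtens G G).
  exact: tmap_graded_hom.
have D_lin : linear Delta by move=> k x y; apply: linearP.
have D0_lin : linear Delta0 by move=> k x y; apply: linearP.
have i_lin : linear iota by move=> k x y; apply: linearP.
exact: (alg_hom_ext genC (comp_linear D_lin i_lin) (comp_hom D_hom iota_hom)
  (comp_linear ii_lin D0_lin) (comp_hom ii_hom D0_hom)).
Qed.
End TrivMaps.

Section CGLHopf.
Variables (R : realType) (n : nat) (theta : 'M[R]_n) (b : bool).
Hypothesis theta_anti : theta^T = - theta.
Local Notation C := (R[i]).
Local Notation I := (idx n b).
Local Notation L := (@Lam R n theta b).
Local Notation LM := (LamM theta (b := b)).
Local Notation w0 := (top_word n b).
Local Notation t := (tGL theta (b := b)).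
Local Notation dinv := (detinv theta b).
Local Notation A := (OmegaGL theta b).
Local Notation A0 := (CGL theta b).
Local Notation t' := (tC theta (b := b)).
Local Notation dinv' := (detinvC theta b).
Local Notation genC := (pgen (inv_rel (q_rel LM) (det_term theta b))).
Variable s : seq I -> C.
Hypotheses (s_br : @braided C I L C^o s) (s_w0 : s w0 = 1).
Variable GL : gida conjc A.
Hypothesis GL_str : OmegaGL_structure GL.
Let hG := genGL_homog GL_str.

Lemma genC_generates : generates (genC : _ -> A0).
Proof. exact: pgen_generates. Qed.

Lemma CGL_iota : exists iota : {linear A0 -> A},
  [/\ monoid_morphism iota, forall i j, iota (t' i j) = t i j,
      iota dinv' = dinv & forall x, homog GL 0 (iota x)].
Proof.
have [|||f [f_hom ft fd]] := @CGL_lift R n theta b theta_anti s s_br s_w0 A t dinv.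
- exact: tGL_quantum.
- by move=> i j; apply: detinv_central.
- exact: (qdet_detinv theta_anti s_br s_w0).
have [th _ _ _ [dh _ _]] := GL_str.
exists f; split=> //; apply: genC_generates => [[[i j]|]||k x|x y|x y].
- by rewrite [f _]ft; case: (th i j).
- by rewrite [f _]fd.
- by rewrite (fst f_hom); apply: homog1.
- by rewrite linearZ; apply: homogZ.
- by rewrite linearD; apply: homogD.
by rewrite (snd f_hom) => x0 y0; apply: (homogM x0 y0).
Qed.

(** Sending the [dt] to [0] gives a retraction of [iota]: [pi \o iota] is the identity on the
    generators of [CGL]. *)
Lemma CGL_pi : exists pi : {linear A -> A0},
  [/\ monoid_morphism pi, forall i j, pi (t i j) = t' i j, pi dinv = dinv' &
      graded_hom GL (triv_graded A0) pi].
Proof.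
have [||||f [f_hom ft fdt fd]] := @OmegaGL_lift R n theta b theta_anti s s_br s_w0
  A0 t' (fun _ _ => 0) dinv'.
- split=> [x y|x y|x y]; last 2 first.
  + by rewrite mul0r mulr0 scaler0.
  + by rewrite mul0r scaler0.
  exact: (@tC_quantum R n theta b).
- by move=> i j; apply: detinvC_central.
- by move=> i j; rewrite mul0r mulr0.
- exact: (qdetC_detinv theta_anti s_br s_w0).
exists f; split=> //.
apply: (graded_hom_gen (@genGL_generates R n theta b) hG f_hom).
move=> [[[i j]|[i j]]|] //=; rewrite [f _]fdt; exact: linear0.
Qed.

(** The structure maps of [CGL] are those of [OmegaGL] preceded by [iota] and, except for the
    counit, followed by [pi]. That [iota] intertwines them requires [bar] and [S] to preserve its
    image; for the coproduct it is checked on generators. *)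
Lemma GL_extends_CGL (Delta : {linear A -> gtens GL GL}) (eps : {scalar A})
    (S : {linear A -> A}) :
    gida_hom GL (tgida GL GL) Delta ->
    (forall i j, Delta (t i j) = \sum_k gten GL GL (t i k) (t k j)) ->
    Delta dinv = gten GL GL dinv dinv ->
    monoid_morphism eps -> (forall i j, eps (t i j) = (i == j)%:R) -> eps dinv = 1 ->
    graded_antihom GL GL idfun S ->
    (forall i j, S (t i j) = @qantipode R n theta b s i j) ->
    S dinv = qdet s w0 t ->
  extends_CGL Delta eps S.
Proof.
move=> D_hom Dt Du e_hom et eu SA St Su.
have [iota [i_hom it id i0]] := CGL_iota.
have [pi [p_hom pt pd p_gr]] := CGL_pi.
have [i1 iM] := i_hom; have [p1 pM] := p_hom.
have i_gr := triv_graded_hom i0.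
have [_ _ bt _ [_ _ bu]] := GL_str.
have [Dmon _ _ _] := D_hom.
have bA := gida_bar_antihom GL.
(* Such elements lie in the image of [iota]. The condition is closed under the operations, hence
   holds for the determinant and the entries of the antipode. *)
pose P y := iota (pi y) = y.
have P0 : P 0 by rewrite /P !linear0.
have P1 : P 1 by rewrite /P p1 i1.
have PD x y : P x -> P y -> P (x + y) by rewrite /P !linearD => -> ->.
have PZ k x : P x -> P (k *: x) by rewrite /P !linearZ /= => ->.
have PM x y : P x -> P y -> P (x * y) by rewrite /P pM iM => -> ->.
have Pt i j : P (t i j) by rewrite /P pt it.
have Pu : P dinv by rewrite /P pd id.
have P_anti tau (f : A -> A) : graded_antihom GL GL tau f ->
    (forall i j, P (f (t i j))) -> P (f dinv) -> forall x, P (f (iota x)).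
  move=> [fD fZ f1 fh fM] ft fu.
  apply: genC_generates => [[[i j]|]||k x Px|x y Px Py|x y Px Py].
  - by rewrite [iota _]it; apply: ft.
  - by rewrite [iota _]id.
  - by rewrite i1 f1.
  - by rewrite linearZ /= fZ; apply: PZ.
  - by rewrite linearD fD; apply: PD.
  by rewrite iM (fM _ _ _ _ (i0 x) (i0 y)) scale1r; apply: PM.
have Pbar : forall x, P (bar GL (iota x)).
  by apply: P_anti bA _ _ => [i j|]; rewrite ?bt ?bu.
have PS : forall x, P (S (iota x)).
  apply: P_anti SA _ _ => [i j|]; rewrite ?St ?Su.
    exact: (qinv_closed s w0 P0 P1 PD PZ PM Pt i j Pu).
  exact: (qdet_closed s w0 P0 P1 PD PZ PM Pt).
have hC (x : option (I * I)) : homog (triv_graded A0) 0 (genC x) by [].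
have b0A := triv_graded_antihom i_hom p_hom i0 bA.
have piK x : pi (iota (genC x)) = genC x.
  by case: x => [[i j]|]; [rewrite [iota _]it [pi _]pt|rewrite [iota _]id [pi _]pd].
have b0K x : pi (bar GL (iota (pi (bar GL (iota (genC x)))))) = genC x.
  by rewrite Pbar barK piK.
have [|G0 [G0G G0b G0d]] := gida_of genC_generates hC (@conjcK R) b0A b0K
    (triv_antider0 A0) (fun=> erefl).
  by move=> x; rewrite /= linear0 bar0 linear0.
have hG0 x : homog G0 0 (genC x) by rewrite G0G.
have p_gr0 : graded_hom GL G0 pi by rewrite G0G.
have i_gr0 : graded_hom G0 GL iota by rewrite G0G.
have [Delta0 Delta0_hom D0E] := retract_coproduct i_hom p_hom Dmon p_gr0.
have D0t i j : Delta0 (t' i j) = \sum_k gten G0 G0 (t' i k) (t' k j).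
  transitivity (tmap pi pi (\sum_k gten GL GL (t i k) (t k j))).
    by rewrite D0E it Dt.
  apply: etrans; first exact: (tmap_sum GL G0 GL G0).
  apply: eq_bigr => k _.
  by rewrite !pt.
have D0u : Delta0 dinv' = gten G0 G0 dinv' dinv'.
  by rewrite D0E id Du (tmap_gten GL G0 GL G0) !pd.
have e_lin : scalar (fun x => eps (iota x)).
  by move=> k x y; rewrite linearP linearP.
pose eps0 : {scalar A0} := scalar_of e_lin.
have e0_hom : monoid_morphism eps0.
  case: e_hom => e1 eM; split=> [|x y]; first by rewrite -[LHS]/(eps (iota 1)) i1.
  by rewrite -[LHS]/(eps (iota (x * y))) iM eM.
have e0t i j : eps0 (t' i j) = (i == j)%:R by rewrite -et -it.
have e0u : eps0 dinv' = 1 by rewrite -eu -id.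
have S0A := triv_graded_antihom i_hom p_hom i0 SA.
have S0_lin : linear (fun x : A0 => pi (S (iota x)) : A0).
  by move=> k x y; rewrite !linearP.
pose S0 : {linear A0 -> A0} := linear_of S0_lin.
have S0t i j : S0 (t' i j) = pi (@qantipode R n theta b s i j) by rewrite -St -it.
have S0u : S0 dinv' = pi (qdet s w0 t) by rewrite -Su -id.
have bt0 i j : bar G0 (t' i j) = t' (conj_idx i) (conj_idx j).
  by rewrite G0b it bt pt.
have bu0 : bar G0 dinv' = dinv'.
  by rewrite G0b id bu pd.
have d0 x : dif G0 x = 0 by rewrite G0d.
exists G0, Delta0, eps0, S0, iota; split.
- by split=> // x; rewrite G0G.
- split; [|exact: D0t|exact: D0u|exact: e0t|exact: e0u].
  apply: (gida_hopf_of genC_generates hG0) => //.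
  + apply: (gida_hom_of genC_generates hG0) => //.
    * move=> [[i j]|]; rewrite ?[Delta0 _]D0t ?[Delta0 _]D0u; last first.
        exact: (homog_gten (hG0 None) (hG0 None)).
      elim/big_ind: _ => [|y z|k _]; [exact: linear0|exact: homogD|].
      exact: (homog_gten (hG0 (Some (i, k))) (hG0 (Some (k, j)))).
    * move=> [[i j]|].
        rewrite [X in Delta0 X]bt0 [LHS]D0t [Delta0 _]D0t.
        rewrite (big_morph _ (barD (tgida G0 G0)) (bar0 (tgida G0 G0))).
        rewrite (reindex_inj (inv_inj (@conj_idxK n b))); apply: eq_bigr => k _.
        by rewrite [RHS]tbarE !bt0.
      by rewrite [X in Delta0 X]bu0 [LHS]D0u [Delta0 _]D0u [RHS]tbarE bu0.
    (* With zero differential on [CGL], that of the tensor square is zero as well. *)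
    move=> x; rewrite d0 linear0; apply/esym.
    elim/gten_ind: (Delta0 _) => [|y z yE zE|p q y z yp zq].
    * by rewrite linear0.
    * by rewrite linearD yE zE addr0.
    by rewrite [LHS](tdifE _ _ yp) !d0 gten0l gten0r scaler0 addr0.
  + move=> [[i j]|]; last by rewrite [X in eps0 X]bu0 [eps0 _]e0u rmorph1.
    rewrite [X in eps0 X]bt0 [eps0 _]e0t [eps0 _]e0t.
    by rewrite (inj_eq (inv_inj (@conj_idxK n b))) rmorph_nat.
  + by rewrite G0G.
  + by move=> x; rewrite !d0 linear0.
  + by move=> [[i j]|]; [exact: (matrix_coassoc D0t (D0t^~ j))|
      exact: (matrix_coassoc_u D0u)].
  + by move=> [[i j]|]; [exact: (matrix_counit_t D0t e0t)|
      exact: (matrix_counit_u D0u e0u)].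
  have st i j : \sum_k pi (@qantipode R n theta b s i k) * t' k j =
      (i == j)%:R *: (1 : A0).
    rewrite -p1 -linear_scale -(qantipode_left theta_anti s_br s_w0) linear_sum.
    by apply: eq_bigr => k _; rewrite [RHS]pM pt.
  have ts i j : \sum_k t' i k * pi (@qantipode R n theta b s k j) =
      (i == j)%:R *: (1 : A0).
    rewrite -p1 -linear_scale -(qantipode_right theta_anti s_br s_w0) linear_sum.
    by apply: eq_bigr => k _; rewrite [RHS]pM pt.
  have uv : dinv' * pi (qdet s w0 t) = 1.
    by rewrite -pd -pM (detinv_qdet theta_anti s_br s_w0).
  have vu : pi (qdet s w0 t) * dinv' = 1.
    by rewrite -pd -pM (qdet_detinv theta_anti s_br s_w0).
  move=> [[i j]|]; first exact: (matrix_antipode_t D0t e0t S0t st ts).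
  exact: (matrix_antipode_u D0u e0u S0u uv vu).
- by split.
- by move=> x; rewrite G0b Pbar.
move=> x; split; [| |by rewrite -[S0 x]/(pi (S (iota x))) PS]; last by [].
move: x.
apply: (hom_coproduct i_hom genC_generates Dmon Delta0_hom i_gr0) => -[[i j]|].
- rewrite [iota _]it [Delta0 _]D0t Dt; apply: esym; apply: etrans.
    exact: (tmap_sum G0 GL G0 GL).
  by apply: eq_bigr => k _; rewrite !it.
by rewrite [iota _]id [Delta0 _]D0u Du (tmap_gten G0 GL G0 GL) !id.
Qed.
End CGLHopf.

(** * The comodule of forms on the theta-deformed space *)

Section OmegaR.
Variables (R : realType) (n : nat) (theta : 'M[R]_n) (b : bool).
Hypothesis theta_anti : theta^T = - theta.
Local Notation C := (R[i]).
Local Notation I := (idx n b).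
Local Notation L := (@Lam R n theta b).
Local Notation c := (@conj_idx n b).
Local Notation A := (OmegaGL theta b).
Local Notation B := (OmegaR theta b).
Local Notation z := (xi theta (b := b)).
Local Notation dz := (dxi theta (b := b)).
Local Notation t := (tGL theta (b := b)).
Local Notation dt := (dtGL theta (b := b)).
Local Notation genR := (pgen (dq_rel L)).

Let L_sym := @Lam_sym R n theta b theta_anti.

Definition degR (x : dgen I) : nat := if x is Df _ then 1 else 0.

Let zdz : forms_rel L z dz := pgen_dq_rel L.

Lemma genR_generates : generates (genR : _ -> B).
Proof. exact: pgen_generates. Qed.

Lemma OmegaR_gida : exists Rm : gida conjc B, OmegaR_structure Rm.
Proof.
have [rho [r_hom rE]] := q_forms_lift (poly_forms_rel zdz).
have [G hG] : exists G : graded B, forall x, homog G (degR x) (genR x).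
  by apply: (graded_of (rho := rho) genR_generates r_hom) => -[i|i]; rewrite rE.
have z0 i : homog G 0 (z i) by apply: (hG (Fn i)).
have dz1 i : homog G 1 (dz i) by apply: (hG (Df i)).
have [h [h_hom hE]] := q_forms_lift (tri_forms_rel z0 dz1 L_sym zdz).
have [d dA hd] : exists2 d : {linear B -> B}, antiderivation G d &
    (forall x, h x = tr G x (d x)).
  apply: (@antider_of _ _ _ _ genR degR genR_generates hG h
    (fun x => if x is Fn i then dz i else 0)) => //.
  - by case=> i; rewrite hE.
  - by case=> i; [apply: dz1|apply: linear0].
have dzE i : d (z i) = dz i.
  by have := hE (Fn i); rewrite hd => /(congr1 (fun y : tri G => (y.2 : B))).
have ddz i : d (dz i) = 0.
  by have := hE (Df i); rewrite hd => /(congr1 (fun y : tri G => (y.2 : B))).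
have dd x : d (d (genR x)) = 0.
  by case: x => i; rewrite -/(z i) -/(dz i) ?dzE ddz ?linear0.
have [zz zd dzdz] := zdz.
have conjL i j : conjc (L i j) = L (c j) (c i).
  by rewrite Lam_conj_idx (@conjc_Lam R n theta b theta_anti).
have TdT : forms_rel L (fun i => z (c i) : gop conjc G) (fun i => dz (c i)).
  apply: gop_forms_rel => [x|x|i j|i j|i j].
  - exact: z0.
  - exact: dz1.
  - by rewrite [X in X *: _]conjL; apply: zz.
  - rewrite [X in X *: _]conjL [X in _ *: X](zd (c i) (c j)) scalerA.
    by rewrite L_sym scale1r.
  - by rewrite [X in - X *: _]conjL; apply: dzdz.
have [f [f_hom fE]] := q_forms_lift TdT.
have fA : graded_antihom G G conjc (f : B -> B).
  apply: (graded_antihomP genR_generates hG f_hom) => -[i|i].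
  - by rewrite [f _](fE (Fn i)); apply: z0.
  - by rewrite [f _](fE (Df i)); apply: dz1.
have fz i : f (z i) = z (c i) by apply: (fE (Fn i)).
have fdz i : f (dz i) = dz (c i) by apply: (fE (Df i)).
have ffK x : (f : B -> B) (f (genR x)) = genR x.
  case: x => i; first by rewrite [f (genR _)]fz [LHS]fz conj_idxK.
  by rewrite [f (genR _)]fdz [LHS]fdz conj_idxK.
have fd x : (f : B -> B) (d (genR x)) = d (f (genR x)).
  case: x => i; first by rewrite [d (genR _)]dzE [LHS]fdz [f _]fz dzE.
  rewrite [d (genR _)]ddz [f (genR _)]fdz ddz.
  by case: fA => fD _ _ _ _; apply: additive0.
have [Rm [RmG Rmb Rmd]] := gida_of genR_generates hG (@conjcK R) fA ffK dA dd fd.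
by exists Rm; rewrite /OmegaR_structure RmG Rmb Rmd; split.
Qed.

Lemma OmegaR_comodule (GL : gida conjc A) (Rm : gida conjc B)
    (Delta : {linear A -> gtens GL GL}) (eps : {scalar A}) :
    OmegaGL_structure GL -> OmegaR_structure Rm ->
    gida_hom GL (tgida GL GL) Delta ->
    (forall i j, Delta (t i j) = \sum_k gten GL GL (t i k) (t k j)) ->
    monoid_morphism eps -> (forall i j, eps (t i j) = (i == j)%:R) ->
    (forall x, eps (dif GL x) = 0) ->
    (forall p x, homog GL p.+1 x -> eps x = 0) ->
  exists delta : {linear B -> gtens GL Rm},
    gida_comodule Delta eps delta /\
    forall i, delta (z i) = \sum_j gten GL Rm (t i j) (z j).
Proof.
move=> GL_str Rm_str D_hom Dt e_hom et ed e_pos.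
have [Dmon Dgr Dbar Ddif] := D_hom.
have [th dtE bt bdt _] := GL_str; have [zh dzE bz bdz] := Rm_str.
have t0 i j : homog GL 0 (t i j) by case: (th i j).
have z0 i : homog Rm 0 (z i) by case: (zh i).
have hR x : homog Rm (degR x) (genR x) by case: x => i; case: (zh i).
(* The coordinates form a single column, so the second index is trivial and carries no scalars. *)
pose r (u : unit) k := z k; pose m (u v : unit) : C := 1.
have m_sym u v : m u v * m v u = 1 by apply: mulr1.
have rdr : forms_rel (fun x y => L x.2 y.2 * m x.1 y.1)
    (fun x => r x.1 x.2) (fun x => dif Rm (r x.1 x.2)).
  have [zz zd dd] := zdz.
  by split=> -[u i] [v j]; rewrite /r /m /= ?dzE mulr1; [apply: zz|apply: zd|apply: dd].
have r0 u a : homog Rm 0 (r u a) by apply: z0.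
pose T i := coaction GL Rm t r (i, tt); pose dT i := dif (tgida GL Rm) (T i).
have TdT : forms_rel L T dT.
  have [zz zd dd] := coaction_forms_rel L_sym m_sym t0 r0 (GL_dif_rel GL_str) rdr.
  have mE i j : L i j = L i j * m tt tt by rewrite mulr1.
  by split=> i j; rewrite mE; [apply: (zz (i, tt) (j, tt))|apply: (zd (i, tt) (j, tt))|
    apply: (dd (i, tt) (j, tt))].
have [f [f_hom fE]] := q_forms_lift TdT.
have fz i : f (z i) = T i by apply: (fE (Fn i)).
have fdz i : f (dz i) = dT i by apply: (fE (Df i)).
have T0 i : homog (tgida GL Rm) 0 (T i) by apply: coaction_homog.
have f_bz i : f (bar Rm (z i)) = bar (tgida GL Rm) (f (z i)).
  rewrite bz !fz.
  transitivity (\sum_k bar (tgida GL Rm) (gten GL Rm (t i k) (z k))).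
    rewrite /T /coaction (reindex_inj (inv_inj (@conj_idxK n b))).
    by apply: eq_bigr => k _; rewrite [RHS]tbarE bt bz.
  by rewrite /T /coaction (big_morph _ (barD (tgida GL Rm)) (bar0 (tgida GL Rm))).
have f_dz i : f (dif Rm (z i)) = dif (tgida GL Rm) (f (z i)) by rewrite dzE fdz fz.
have f_gida : gida_hom Rm (tgida GL Rm) f.
  apply: (gida_hom_of genR_generates hR f_hom) => -[i|i].
  - by rewrite [f _]fz; apply: T0.
  - by rewrite [f _]fdz; apply: (dif_homog (T0 i)).
  - exact: f_bz.
  - rewrite -[genR _]/(dz i) -dzE -dif_bar f_dz -dif_bar -f_bz.
    by rewrite bz f_dz.
  - exact: f_dz.
  - by rewrite -[genR _]/(dz i) -[in LHS]dzE difK linear0 fdz difK.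
have Ddt i j : Delta (dt i j) =
    \sum_k gten GL GL (dt i k) (t k j) + \sum_k gten GL GL (t i k) (dt k j).
  rewrite -dtE Ddif Dt.
  have := coaction_dif GL (fun j k => t k j) t0 (i, j); rewrite /coaction /= => ->.
  by congr (_ + _); apply: eq_bigr => k _; rewrite dtE.
have fdzE i : f (dz i) =
    \sum_k gten GL Rm (dt i k) (z k) + \sum_k gten GL Rm (t i k) (dz k).
  rewrite fdz /dT; have := coaction_dif Rm r t0 (i, tt) => ->.
  by congr (_ + _); apply: eq_bigr => k _; rewrite ?dtE ?dzE.
have edt i j : eps (dt i j) = 0 by rewrite -dtE.
have [_ f_gr _ _] := f_gida.
exists f; split=> //; split=> //.
- apply: (coaction_assoc genR_generates Dmon Dgr f_hom f_gr) => -[i|i].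
    exact: (matrix_coassoc Dt fz).
  exact: (matrix_coassoc_d Dt Ddt fz fdzE).
apply: (coaction_counit genR_generates e_hom e_pos f_hom) => -[i|i].
  exact: (matrix_counit fz et).
exact: (matrix_counit_d fdzE et edt).
Qed.
End OmegaR.

Theorem theorem5 (R : realType) (n : nat) (n_ge2 : (2 <= n)%N)
    (theta : 'M[R]_n) (theta_antisym : theta^T = - theta) (b : bool) :
  exists (GL : gida conjc (OmegaGL theta b))
    (Delta : {linear OmegaGL theta b -> gtens GL GL})
    (eps : {scalar OmegaGL theta b})
    (S : {linear OmegaGL theta b -> OmegaGL theta b}),
  [/\ OmegaGL_structure GL,
      gida_hopf Delta eps S,
      extends_CGL Delta eps S,
      [/\ forall i j : idx n b,
            Delta (tGL theta i j) =
              \sum_(k : idx n b) gten GL GL (tGL theta i k) (tGL theta k j),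
          Delta (detinv theta b) = gten GL GL (detinv theta b) (detinv theta b),
          forall i j : idx n b, eps (tGL theta i j) = (i == j)%:R &
          eps (detinv theta b) = 1] &
      exists (Rm : gida conjc (OmegaR theta b))
        (delta : {linear OmegaR theta b -> gtens GL Rm}),
      [/\ OmegaR_structure Rm,
          gida_comodule Delta eps delta &
          forall i : idx n b,
            delta (xi theta i) =
              \sum_(j : idx n b) gten GL Rm (tGL theta i j) (xi theta j)]].
Proof.
have [s s_br s_w0] :=
  braided_sign_exists (Lam_sym (b := b) theta_antisym) (top_word_uniq n b).
have [G hG] := OmegaGL_graded theta_antisym s_br s_w0.
have [GL [GLG GL_str]] := OmegaGL_gida theta_antisym s_br s_w0 hG.
have [Delta [D_hom Dt Du]] := GL_coproduct theta_antisym s_br s_w0 GL_str.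
have [eps [e_hom et edt eu]] := GL_counit theta_antisym s_br s_w0.
have [S [SA St Su Sd]] := GL_antipode theta_antisym s_br s_w0 GL_str.
have GLH := GL_hopf theta_antisym s_br s_w0 GL_str D_hom Dt Du e_hom et edt eu
  SA St Su Sd.
have [Rm Rm_str] := OmegaR_gida b theta_antisym.
have ed x : eps (dif GL x) = 0 by case: GLH => _ _ _ ->.
have e_pos p x : homog GL p.+1 x -> eps x = 0.
  apply: (counit_pos (@genGL_generates R n theta b) (genGL_homog GL_str) e_hom).
  by move=> [[[i j]|[i j]]|] //= _; apply: edt.
have [delta [dC dz]] := OmegaR_comodule theta_antisym GL_str Rm_str D_hom Dt e_hom
  et ed e_pos.
exists GL, Delta, eps, S; split=> //.
  exact: (GL_extends_CGL theta_antisym s_br s_w0 GL_str D_hom Dt Du e_hom et eu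
    SA St Su).
by exists Rm, delta.
Qed.
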